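(* Let $\Omega\subset\mathbb{C}$ be a simply connected domain and let $F_\lambda:\Omega\to\Lambda U(3)_\tau$ be a family of Hamiltonian stationary Lagrangian conformal immersions, with $A_\lambda=F_\lambda^{-1}dF_\lambda$, which is of quasi-finite type, with associated $p\in\mathbb{N}$ and $\xi_\lambda:\Omega\to\Lambda^{2+4p}\mathfrak{u}(3)_\tau$. Then there exists a gauge transformation $F_\lambda\mapsto F_\lambda^G:=F_\lambda\cdot G$, with $G\in C^\infty(\Omega,U(3)_0)$, such that $F_\lambda^G$ is of finite type. More precisely, setting $A_\lambda^G:=G^{-1}A_\lambda G+G^{-1}dG$ and $\xi_\lambda^G:=G^{-1}\xi_\lambda G$, one has $$d\xi_\lambda^G+[A_\lambda^G,\xi_\lambda^G]=G^{-1}\left(d\xi_\lambda+[A_\lambda,\xi_\lambda]\right)G=0\qquad\text{and}\qquad(\lambda^{4p}\xi_\lambda^G\,dz)_{\Lambda_{\mathfrak{su}}}=A_\lambda^G.$$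
   Context: Notation. $M^\dagger$ is the conjugate transpose; $z=x+iy$ is the coordinate on $\Omega$; $\mathbb{N}=\{0,1,2,\dots\}$. Let $J=\begin{pmatrix}0&-1\\1&0\end{pmatrix}$. On $\mathfrak{u}(3)^{\mathbb{C}}=M(3,\mathbb{C})$ let $$\tau(M)=-\begin{pmatrix}-J&0\\0&1\end{pmatrix}\,{}^tM\,\begin{pmatrix}J&0\\0&1\end{pmatrix},$$ and on $U(3)^{\mathbb{C}}=GL(3,\mathbb{C})$ let $$\tau(M)=\begin{pmatrix}-J&0\\0&1\end{pmatrix}\,{}^tM^{-1}\,\begin{pmatrix}J&0\\0&1\end{pmatrix};$$ these are automorphisms with $\tau^4=\mathrm{Id}$. $U(3)_0=\{g\in U(3):\tau(g)=g\}\simeq SU(2)$ (upper-left block, with 1 as last diagonal entry). $\mathfrak{u}(3)_0^{\mathbb{C}}$ is the fixed space of $\tau$ on $\mathfrak{u}(3)^{\mathbb{C}}$, i.e. $\mathfrak{sl}(2,\mathbb{C})$ in the upper-left block and zeros elsewhere. Twisted loops. $\Lambda U(3)_\tau=\{S^1\ni\lambda\mapsto g_\lambda\in U(3):\tau(g_\lambda)=g_{i\lambda}\}$; $\Lambda\mathfrak{u}(3)_\tau$ (resp. $\Lambda\mathfrak{u}(3)_\tau^{\mathbb{C}}$) is the set of loops $S^1\ni\lambda\mapsto\xi_\lambda=\sum_k\widehat\xi_k\lambda^k$ in $\mathfrak{u}(3)$ (resp. $\mathfrak{u}(3)^{\mathbb{C}}$) with $\tau(\xi_\lambda)=\xi_{i\lambda}$;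 for $p\in\mathbb{N}$, $\Lambda^{2+4p}\mathfrak{u}(3)_\tau=\{\xi_\lambda\in\Lambda\mathfrak{u}(3)_\tau:\xi_\lambda=\sum_{k=-2-4p}^{2+4p}\widehat\xi_k\lambda^k\}$. Let $\mathfrak{b}\subset\mathfrak{sl}(2,\mathbb{C})$ be the real Lie algebra of lower triangular traceless matrices with real diagonal; $\mathfrak{sl}(2,\mathbb{C})=\mathfrak{su}(2)\oplus\mathfrak{b}$, with projection $(\cdot)_{\mathfrak{su}}$ on $\mathfrak{su}(2)$. Define $(\cdot)_{\Lambda_{\mathfrak{su}}}:\Lambda\mathfrak{u}(3)_\tau^{\mathbb{C}}\to\Lambda\mathfrak{u}(3)_\tau$ by $$(\xi_\lambda)_{\Lambda_{\mathfrak{su}}}=\sum_{k<0}\widehat\xi_k\lambda^k+(\widehat\xi_0)_{\mathfrak{su}}-\sum_{k>0}(\widehat\xi_{-k})^\dagger\lambda^k,$$ and $(\xi_\lambda dz)_{\Lambda_{\mathfrak{su}}}:=(\xi_\lambda)_{\Lambda_{\mathfrak{su}}}dx+(i\xi_\lambda)_{\Lambda_{\mathfrak{su}}}dy$. Families. Fix a base point $z_0\in\Omega$. A family of Hamiltonian stationary conformal Lagrangian immersions is a smooth map $F_\lambda:\Omega\to\Lambda U(3)_\tau$ with $F_\lambda(z_0)=\mathrm{Id}$ such that the Fourier coefficients of $A_\lambda:=F_\lambda^{-1}dF_\lambda=\sum_k\widehat A_k\lambda^k$ satisfy: $\widehat A_k=0$ for $k\le-3$; $\widehat A_{-2}=\alpha(z)\,dz\,\mathrm{diag}(i,i,0)$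 with $\alpha\in C^\infty(\Omega,\mathbb{C})$; $\widehat A_{-1}(\partial/\partial\bar z)=0$; and $\widehat A_{-1}(\partial/\partial z)$ vanishes nowhere. (The third column of $F_{\lambda}$ for each fixed $\lambda$ is then a Legendrian lift to $S^5$ of a Hamiltonian stationary conformal Lagrangian immersion into $\mathbb{C}P^2$.) Such a family is of quasi-finite type if there exist $p\in\mathbb{N}$, a constant $a\in\mathbb{C}$, a smooth map $\xi_\lambda:\Omega\to\Lambda^{2+4p}\mathfrak{u}(3)_\tau$ and a 1-form $B$ on $\Omega$ with coefficients in $\mathfrak{u}(3)_0^{\mathbb{C}}$ (independent of $\lambda$) such that $\widehat\xi_{-4p-2}=\mathrm{diag}(ia,ia,0)$, $d\xi_\lambda=[\xi_\lambda,A_\lambda]$ and $(\lambda^{4p}\xi_\lambda dz)_{\Lambda_{\mathfrak{su}}}=A_\lambda+B$. It is of finite type if this holds with $B=0$. *)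

(* Defs.v *)
From HB Require Import structures.
From mathcomp Require Import all_boot all_order all_algebra.
From mathcomp Require Import complex.
From mathcomp Require Import all_classical all_reals all_analysis.

Set Implicit Arguments.
Unset Strict Implicit.
Unset Printing Implicit Defensive.

Import Order.TTheory GRing.Theory Num.Theory.
Import numFieldNormedType.Exports.

Local Open Scope classical_set_scope.
Local Open Scope ring_scope.
Local Open Scope complex_scope.
Local Open Scope sesquilinear_scope.

(* A subset of the complex plane is represented as a set of pairs (x, y), the
   coordinate being z = x + iy; the values of functions lie in R[i]. *)
Notation plane R := (R * R)%type.
Notation mat3 R := 'M[R[i]]_3.
(* Only the values at points of modulus 1 are meaningful. *)
Notation loop R := (R[i] -> mat3 R).
(* The value at a point of a matrix-valued 1-form: w = w.1 dx + w.2 dy. *)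
Notation mform R := (mat3 R * mat3 R)%type.

Section Smoothness.
Variables (R : realType) (V : normedModType R).

(* For U open: all iterated directional derivatives of order at most k exist
   and are continuous on U. *)
Fixpoint is_Ck (k : nat) (U : set V) (f : V -> R) : Prop :=
  {in U, forall x, {for x, continuous f}} /\
  match k with
  | 0 => True
  | k'.+1 => forall v : V,
      {in U, forall x, derivable f x v} /\ is_Ck k' U (fun x => 'D_v f x)
  end.

Definition smooth (U : set V) (f : V -> R) : Prop := forall k, is_Ck k U f.

Definition csmooth (U : set V) (f : V -> R[i]) : Prop :=
  smooth U (fun x => complex.Re (f x)) /\ smooth U (fun x => complex.Im (f x)).

Definition mxsmooth (U : set V) (f : V -> mat3 R) : Prop :=
  forall a b, csmooth U (fun x => f x a b).

Definition mxderive (f : V -> mat3 R) (x v : V) : mat3 R :=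
  \matrix_(a, b) ('D_v (fun y => complex.Re (f y a b)) x
               +i* 'D_v (fun y => complex.Im (f y a b)) x).

End Smoothness.

Section Domain.
Variable R : realType.

Definition simply_connected (U : set (plane R)) : Prop :=
  forall g : R -> plane R,
    {within `[0, 1], continuous g} -> (forall t : R, t \in `[0, 1] -> U (g t)) ->
    g 0 = g 1 ->
  exists H : R * R -> plane R,
    [/\ {within `[0, 1] `*` `[0, 1], continuous H},
        forall s t : R, s \in `[0, 1] -> t \in `[0, 1] -> U (H (s, t)),
        forall t : R, t \in `[0, 1] -> H (0, t) = g t,
        forall t : R, t \in `[0, 1] -> H (1, t) = g 0
      & forall s : R, s \in `[0, 1] -> H (s, 0) = g 0 /\ H (s, 1) = g 0].

Definition simply_connected_domain (U : set (plane R)) : Prop :=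
  [/\ open U, U !=set0, connected U & simply_connected U].

End Domain.

Section Algebra.
Variable R : realType.
Local Notation C := R[i].

Definition J : 'M[C]_2 :=
  \matrix_(a, b) if (a < b)%N then -1 else if (b < a)%N then 1 else 0.

Definition diagJ1 : mat3 R := (block_mx J 0 0 1%:M : 'M[C]_(2 + 1)).
Definition diagNJ1 : mat3 R := (block_mx (- J) 0 0 1%:M : 'M[C]_(2 + 1)).

Definition tau_alg (M : mat3 R) : mat3 R := - (diagNJ1 *m M^T *m diagJ1).
Definition tau_grp (M : mat3 R) : mat3 R := diagNJ1 *m (invmx M)^T *m diagJ1.

Definition in_U3 (M : mat3 R) : Prop := M \is unitarymx.
Definition in_u3 (M : mat3 R) : Prop := M ^t* = - M.

Definition in_U3_0 (M : mat3 R) : Prop := in_U3 M /\ tau_grp M = M.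
Definition in_u3_0C (M : mat3 R) : Prop := tau_alg M = M.

Definition diag110 (a : C) : mat3 R := (block_mx a%:M 0 0 0 : 'M[C]_(2 + 1)).

Definition lie (M N : mat3 R) : mat3 R := M *m N - N *m M.

Definition in_su2 (M : 'M[C]_2) : Prop := M ^t* = - M /\ \tr M = 0.

Definition in_b (M : 'M[C]_2) : Prop :=
  [/\ is_trig_mx M, \tr M = 0 & forall k, M k k \is Num.real].

(* Meaningful for traceless M, as sl(2,C) is the direct sum of su(2) and b. *)
Definition su_proj (M : 'M[C]_2) : 'M[C]_2 :=
  xget 0 [set S | in_su2 S /\ in_b (M - S)].

Definition su_proj3 (M : mat3 R) : mat3 R :=
  (block_mx (su_proj (ulsubmx (M : 'M[C]_(2 + 1)))) 0 0 0 : 'M[C]_(2 + 1)).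

End Algebra.

Section Loops.
Variable R : realType.
Local Notation C := R[i].

Definition expi (t : R) : C := cos t +i* sin t.

Definition fourier (g : loop R) (k : int) : mat3 R :=
  let c a b (t : R) : C := g (expi t) a b * expi t ^ (- k) in
  \matrix_(a, b)
    ((2 * pi)^-1 * \int[lebesgue_measure]_(t in `[0, 2 * pi])
                       complex.Re (c a b t)
  +i* ((2 * pi)^-1 * \int[lebesgue_measure]_(t in `[0, 2 * pi])
                       complex.Im (c a b t))).

Definition LambdaU3 (g : loop R) : Prop :=
  forall l : C, `|l| = 1 -> in_U3 (g l) /\ tau_grp (g l) = g ('i * l).

Definition Lambdau3 (g : loop R) : Prop :=
  forall l : C, `|l| = 1 -> in_u3 (g l) /\ tau_alg (g l) = g ('i * l).

Definition Lambdau3_le (n : nat) (g : loop R) : Prop :=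
  Lambdau3 g /\
  forall l : C, `|l| = 1 ->
    g l = \sum_(j < (n + n).+1) l ^ (j%:Z - n%:Z) *: fourier g (j%:Z - n%:Z).

Definition mxseries (u : nat -> mat3 R) : mat3 R :=
  \matrix_(a, b) (limn (series (fun n => complex.Re (u n a b)))
              +i* limn (series (fun n => complex.Im (u n a b)))).

Definition Lambda_su (g : loop R) : loop R := fun l =>
  mxseries (fun n => l ^ (- n.+1%:Z) *: fourier g (- n.+1%:Z))
  + su_proj3 (fourier g 0)
  - mxseries (fun n => l ^ n.+1%:Z *: (fourier g (- n.+1%:Z)) ^t*).

Definition Lambda_su_dz (g : loop R) : R[i] -> mform R := fun l =>
  (Lambda_su g l, Lambda_su (fun m => 'i *: g m) l).

End Loops.

Section Forms.
Variable R : realType.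
Local Notation C := R[i].

Definition form_map (h : mat3 R -> mat3 R) (w : mform R) : mform R := (h w.1, h w.2).

Definition fdz (M : mat3 R) : mform R := (M, 'i *: M).

(* Contraction with d/dz = (d/dx - i d/dy)/2 and d/dzbar = (d/dx + i d/dy)/2. *)
Definition contr_dz (w : mform R) : mat3 R := 2^-1 *: (w.1 - 'i *: w.2).
Definition contr_dzbar (w : mform R) : mat3 R := 2^-1 *: (w.1 + 'i *: w.2).

Definition ext_d (f : plane R -> mat3 R) (z : plane R) : mform R :=
  (mxderive f z (1, 0), mxderive f z (0, 1)).

Definition fourierf (w : R[i] -> mform R) (k : int) : mform R :=
  (fourier (fun l => (w l).1) k, fourier (fun l => (w l).2) k).

Definition maurer_cartan (F : plane R -> loop R) (z : plane R) (l : C) : mform R :=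
  form_map (mulmx (invmx (F z l))) (ext_d (fun y => F y l) z).

(* Smoothness of a map into a loop space is joint smoothness in the point and
   in the angle t, with l = exp (it). *)
Definition smooth_loops (U : set (plane R)) (F : plane R -> loop R) : Prop :=
  mxsmooth [set q : plane R * R | U q.1] (fun q => F q.1 (expi q.2)).

Definition HSL_family (U : set (plane R)) (z0 : plane R)
    (F : plane R -> loop R) : Prop :=
  let A := maurer_cartan F in
  [/\ smooth_loops U F,
      forall z, U z -> LambdaU3 (F z),
      forall l : C, `|l| = 1 -> F z0 l = 1%:M
    & [/\ forall z, U z -> forall k : int, k <= -3 -> fourierf (A z) k = 0,
          exists alpha : plane R -> C, csmooth U alpha /\
            forall z, U z ->
              fourierf (A z) (-2) = fdz (alpha z *: diag110 'i),
          forall z, U z -> contr_dzbar (fourierf (A z) (-1)) = 0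
        & forall z, U z -> contr_dz (fourierf (A z) (-1)) != 0]].

Definition finite_type_eqs (U : set (plane R)) (F : plane R -> loop R)
    (p : nat) (a : C) (xi : plane R -> loop R) (B : plane R -> mform R) : Prop :=
  let A := maurer_cartan F in
  [/\ smooth_loops U xi,
      forall z, U z -> Lambdau3_le (2 + 4 * p)%N (xi z),
      forall z, U z -> fourier (xi z) (- (4 * p + 2)%N%:Z) = diag110 ('i * a),
      forall z, U z -> forall l : C, `|l| = 1 ->
        ext_d (fun y => xi y l) z = form_map (lie (xi z l)) (A z l)
    & forall z, U z -> forall l : C, `|l| = 1 ->
        Lambda_su_dz (fun m => m ^+ (4 * p) *: xi z m) l = A z l + B z].

Definition form_u3_0C (U : set (plane R)) (B : plane R -> mform R) : Prop :=
  [/\ mxsmooth U (fun z => (B z).1), mxsmooth U (fun z => (B z).2)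
    & forall z, U z -> in_u3_0C (B z).1 /\ in_u3_0C (B z).2].

Definition quasi_finite_with (U : set (plane R)) (F : plane R -> loop R)
    (p : nat) (xi : plane R -> loop R) : Prop :=
  exists a B, form_u3_0C U B /\ finite_type_eqs U F p a xi B.

Definition finite_with (U : set (plane R)) (F : plane R -> loop R)
    (p : nat) (xi : plane R -> loop R) : Prop :=
  exists a, finite_type_eqs U F p a xi (fun=> 0).

Definition finite_type (U : set (plane R)) (z0 : plane R)
    (F : plane R -> loop R) : Prop :=
  HSL_family U z0 F /\ exists p xi, finite_with U F p xi.

Definition gauge (F : plane R -> loop R) (G : plane R -> mat3 R) :
    plane R -> loop R :=
  fun z l => F z l *m G z.

Definition gauge_form (A : plane R -> C -> mform R) (G : plane R -> mat3 R)
    (z : plane R) (l : C) : mform R :=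
  form_map (fun M => invmx (G z) *m M *m G z) (A z l)
  + form_map (mulmx (invmx (G z))) (ext_d G z).

Definition gauge_loops (xi : plane R -> loop R) (G : plane R -> mat3 R) :
    plane R -> loop R :=
  fun z l => invmx (G z) *m xi z l *m G z.

Definition cov_d (A : plane R -> C -> mform R) (xi : plane R -> loop R)
    (z : plane R) (l : C) : mform R :=
  ext_d (fun y => xi y l) z + form_map (fun M => lie M (xi z l)) (A z l).

End Forms.

(* Main.v *)
Require Import Defs.
From mathcomp Require Import all_boot all_order all_algebra.
From mathcomp Require Import complex ring lra zify.
From mathcomp Require Import all_classical all_reals all_analysis.

Set Implicit Arguments.
Unset Strict Implicit.
Unset Printing Implicit Defensive.

Import Order.TTheory GRing.Theory Num.Theory.
Import numFieldNormedType.Exports.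

Local Open Scope sesquilinear_scope.
Local Open Scope classical_set_scope.
Local Open Scope ring_scope.
Local Open Scope complex_scope.

(** Put Theta = A - lambda^(4p) xi dz.  The hypothesis on the projection of
    lambda^(4p) xi dz turns, after expansion in powers of lambda, into two facts:
    Theta contains no negative power of lambda ([flow_form_laurent]), and its
    constant term is theta = X_su - B - X, where X is the constant term of
    lambda^(4p) xi dz and X_su its su(2)-part.  Moreover B takes values in su(2),
    because A and the projection are skew-Hermitian ([remainder_su2]).

    Suppose that G takes values in SU(2) and that G^-1 theta G + G^-1 dG takes
    values in b.  Then G^-1 X G differs by a b-valued form from the su(2)-valued
    form G^-1 (X_su - B) G + G^-1 dG, which is therefore its su(2)-part
    ([gauge_su_proj]).  As G does not depend on lambda, conjugation by G acts on
    each Fourier coefficient separately; the coefficients other than the constant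
    one transform in the expected way and B disappears ([Lambda_su_dz_conj]).  All
    other requirements on the new family are preserved since G is unitary, fixed
    by tau and commutes with diag(i, i, 0).

    To find G one wants a solution of dh = h theta with h(z0) = Id: when h is
    written as a lower triangular matrix with positive diagonal times a matrix
    of SU(2), the latter factor is G^-1.  Only the first row r of h matters, for
    its normalisation is the first row of G^-1, and in SU(2) the first row
    determines the second.  Instead of integrating the flat form theta, one can
    write down such an h.  From d xi = [xi, A] and A = F^-1 dF it follows that
    F xi F^-1 is constant ([potential_conj]), so that
        H = exp (- (z - z0) lambda^(4p) xi(z0)) F
    solves dH = H Theta for each lambda ([flow_derive]).  The Fourier
    coefficients satisfy dH_k = sum_(j >= 0) H_(k - j) Theta_j
    ([flow_fourier_derive]), an infinite linear system in which the coefficients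
    of negative index are coupled only to one another.  They vanish at z0 and are
    bounded locally in z and uniformly in k, so they vanish on the connected set
    Omega by uniqueness for bounded linear systems ([linear_system_unique],
    [flow_fourier_neg]).
    What remains at k = 0 is dH_0 = H_0 theta and H_0(z0) = Id.  The same
    uniqueness principle shows that the row r of H_0 has no zero ([row_neq0]), so
    it can be normalised.

    The analytic preparations serve this construction: the exponential is taken
    by diagonalising the normal matrix lambda^(4p) xi(z0), and a
    Lipschitz estimate makes it continuous in lambda; Fourier coefficients are
    differentiated under the integral sign; smoothness of the Fourier coefficients
    of xi comes from inverting a Vandermonde matrix of points of the circle. *)

(** * Uniqueness for bounded linear systems on a connected open set *)

Section Lines.
Variables (R : realType) (V : normedModType R).

(** Reduces directional derivatives to derivatives of functions of one real
    variable. *)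
Lemma is_derive_line (f : V -> R) (x v : V) (s d : R) :
  is_derive (s *: v + x) v f d <->
  is_derive s (1 : R) (fun u => f (u *: v + x)) d.
Proof.
have E : (fun h : R => h^-1 *: ((f \o shift (s *: v + x)) (h *: v)
             - f (s *: v + x))) =
  (fun h : R => h^-1 *: (((fun u : R => f (u *: v + x)) \o shift s) (h *: (1 : R))
             - f (s *: v + x))).
  by apply/funext => h /=; rewrite [h *: (1:R)]mulr1 scalerDl addrA.
split=> -[D1 D2]; constructor.
- by rewrite /derivable -E.
- by rewrite /derive -E.
- by rewrite /derivable E.
- by rewrite /derive E.
Qed.

Lemma mean_value_bound (f : V -> R) (x v : V) (C : R) (df : V -> R) :
  (forall s : R, 0 <= s <= 1 -> is_derive (s *: v + x) v f (df (s *: v + x))) ->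
  (forall s : R, 0 <= s <= 1 -> `|df (s *: v + x)| <= C) ->
  `|f (v + x) - f x| <= C.
Proof.
move=> fD dfC.
pose g u := f (u *: v + x).
have gD (s : R) : 0 <= s <= 1 -> is_derive s (1 : R) g (df (s *: v + x)).
  by move=> s01; apply/is_derive_line/fD.
have [||s s01 /= gE] := @MVT_segment R g (fun s => df (s *: v + x)) 0 1 ler01.
- by move=> s /andP[/ltW s0 /ltW s1]; apply: gD; apply/andP; split.
- apply: derivable_within_continuous => s; rewrite in_itv /= => s01.
  by have [] := gD s s01.
move: gE; rewrite /g scale1r scale0r add0r subr0 mulr1 => ->.
by apply: dfC; move: s01; rewrite in_itv.
Qed.

Lemma ball_segment (z1 z w : V) (r s : R) : ball z1 r z -> ball z1 r w ->
  0 <= s <= 1 -> ball z1 r (s *: (w - z) + z).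
Proof.
rewrite -!ball_normE /ball_ /= => zr wr /andP[s0 s1].
have -> : z1 - (s *: (w - z) + z) = (1 - s) *: (z1 - z) + s *: (z1 - w).
  have -> : w - z = (z1 - z) - (z1 - w) by rewrite opprB [RHS]addrC subrKA.
  rewrite opprD addrCA scalerBl scale1r scalerBr opprB [LHS]addrC addrA.
  by rewrite addrAC.
apply: le_lt_trans (ler_normD _ _) _.
rewrite !normrZ (ger0_norm s0) ger0_norm ?subr_ge0//.
have [->|s00] := eqVneq s 0; first by rewrite subr0 mul1r mul0r addr0.
have sp : 0 < s by rewrite lt0r s00.
apply: (@lt_le_trans _ _ ((1 - s) * `|z1 - z| + s * r)).
  by rewrite ltrD2l ltr_pM2l.
have : (1 - s) * `|z1 - z| <= (1 - s) * r by rewrite ler_wpM2l ?subr_ge0 // ltW.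
by nra.
Qed.

(** On a ball of radius r around z1, the supremum E of all |f i| satisfies
    E <= C E 2r <= E / 2 by the mean value theorem from z, hence E = 0.  The
    index type is arbitrary: only the supremum over the indices enters, so the
    system may be infinite. *)
Lemma linear_system_local (I : Type) (f : I -> V -> R) (df : I -> V -> V -> R)
    (z1 z : V) (r C M : R) : 0 <= C -> 4 * r * C <= 1 ->
  (forall i w v, ball z1 r w -> is_derive w v (f i) (df i w v)) ->
  (forall i w, ball z1 r w -> `|f i w| <= M) ->
  (forall w b, ball z1 r w -> (forall j, `|f j w| <= b) ->
     forall i v, `|df i w v| <= C * b * `|v|) ->
  ball z1 r z -> (forall i, f i z = 0) ->
  forall i w, ball z1 r w -> f i w = 0.
Proof.
move=> C0 rC fD fM dfC zr fz0 i w wr.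
pose E := [set y | exists i w, ball z1 r w /\ y = `|f i w|].
have supE : has_sup E.
  split; first by exists `|f i w|, i, w.
  by exists M => _ [j [w' [w'r ->]]]; exact: fM.
have leE j w' : ball z1 r w' -> `|f j w'| <= sup E.
  by move=> w'r; apply: sup_upper_bound => //; exists j, w'.
have E0 : 0 <= sup E by apply: le_trans (leE i w wr).
(* The segment from z to w' has length at most 2r and stays in the ball. *)
have half j w' : ball z1 r w' -> `|f j w'| <= sup E / 2.
  move=> w'r.
  have -> : f j w' = f j ((w' - z) + z) - f j z by rewrite subrK fz0 subr0.
  apply: (@mean_value_bound _ _ _ _ (fun y => df j y (w' - z))).
    by move=> s s01; apply: fD; exact: ball_segment.
  move=> s s01.
  apply: (le_trans (dfC _ (sup E) (ball_segment zr w'r s01) _ _ _)).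
    by move=> k; apply: leE; exact: ball_segment.
  have wz : `|w' - z| <= 2 * r.
    move: zr w'r; rewrite -!ball_normE /ball_ /= => zr w'r.
    have -> : w' - z = (z1 - z) - (z1 - w') by rewrite opprB [RHS]addrC subrKA.
    apply: le_trans (ler_normB _ _) _; lra.
  have := ler_wpM2l (mulr_ge0 C0 E0) wz; nra.
have : sup E <= sup E / 2.
  apply: ge_sup; first by have [] := supE.
  by move=> _ [j [w' [w'r ->]]]; exact: half.
move=> EE; have E00 : sup E <= 0 by lra.
by apply/normr0_eq0/eqP; rewrite eq_le normr_ge0 andbT (le_trans (leE i w wr)).
Qed.

(** The set of common zeros is closed and open in U, by [linear_system_local]
    on small balls.  The local bound M makes the suprema over the indices
    finite. *)
Lemma linear_system_unique (I : Type) (U : set V) (f : I -> V -> R)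
    (df : I -> V -> V -> R) (z0 : V) :
  open U -> connected U -> U z0 ->
  (forall i w v, U w -> is_derive w v (f i) (df i w v)) ->
  (forall z1, U z1 -> exists C M : R,
     \forall w \near z1, (forall i, `|f i w| <= M) /\
       forall b : R, (forall j, `|f j w| <= b) ->
         forall i v, `|df i w v| <= C * b * `|v|) ->
  (forall i, f i z0 = 0) ->
  forall i z, U z -> f i z = 0.
Proof.
move=> oU cU Uz0 fD loc f0.
pose Z := [set z | U z /\ forall i, f i z = 0].
have key z1 : U z1 -> exists2 r, 0 < r & forall z, ball z1 r z ->
    (forall i, f i z = 0) -> forall w, ball z1 r w -> Z w.
  move=> Uz1; have [C [M nC]] := loc z1 Uz1.
  have /nbhs_ballP[r /= r0 rP] : \forall w \near z1, U w /\
     ((forall i, `|f i w| <= M) /\ forall b : R, (forall j, `|f j w| <= b) ->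
         forall i v, `|df i w v| <= C * b * `|v|).
    by near=> w; split; near: w => //; exact: open_nbhs_nbhs.
  (* The radius is small enough for 4 r C <= 1. *)
pose C' := `|C|; pose r' := Num.min r (4 * (C' + 1))^-1.
  have C'1 : 0 < 4 * (C' + 1) by rewrite mulr_gt0 // ltr_wpDl // normr_ge0.
  have r'0 : 0 < r' by rewrite /r' lt_min r0 invr_gt0.
  have sub w : ball z1 r' w -> ball z1 r w.
    by apply: le_ball; rewrite /r' ge_min lexx.
  exists r' => // z zr fz w wr; split; first by have [] := rP _ (sub _ wr).
  move=> i; apply: (@linear_system_local I f df z1 z r' C' M) => //.
  - by rewrite /C'.
  - have : r' <= (4 * (C' + 1))^-1 by rewrite /r' ge_min lexx orbT.
    rewrite -(ler_pM2r C'1) mulVf ?gt_eqF//.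
    have : 0 <= r' * 4 by rewrite mulr_ge0// ltW.
    by nra.
  - by move=> j y v yr; apply: fD; have [] := rP _ (sub _ yr).
  - by move=> j y yr; have [_ [H _]] := rP _ (sub _ yr); exact: H.
  - move=> y b yr fb j v; have [_ [_ H]] := rP _ (sub _ yr).
    apply: le_trans (H b fb j v) _; rewrite ler_wpM2r // ler_wpM2r ?ler_norm //.
    exact: le_trans (fb j).
have ZU : Z = U.
  apply: cU.
  - by exists z0.
  - exists Z; last by apply/seteqP; split=> [y [] | y []].
    rewrite openE => y [Uy fy]; have [r r0 rP] := key y Uy.
    by apply/nbhs_ballP; exists r => //= w; apply: (rP y) => //; exact: ballxx.
  - exists (closure Z); first exact: closed_closure.
    apply/seteqP; split=> [y Zy | y [Uy cy]].
      by split; [case: Zy | exact: subset_closure].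
    have [r r0 rP] := key y Uy.
    have [z [[_ Zz] yz]] := cy _ (nbhsx_ballx y r r0).
    by apply: (rP z) => //; exact: ballxx.
by move=> i z; rewrite -{1}ZU => -[].
Unshelve. all: by end_near. Qed.

Lemma derive0_cst (U : set V) (f : V -> R) (z0 : V) :
  open U -> connected U -> U z0 ->
  (forall w v, U w -> is_derive w v f 0) -> forall z, U z -> f z = f z0.
Proof.
move=> oU cU Uz0 fD z Uz; apply/eqP; rewrite -subr_eq0; apply/eqP.
apply: (@linear_system_unique unit U (fun _ z => f z - f z0) (fun _ _ _ => 0) z0)
  => //.
- move=> _ w v Uw; have -> : (fun z => f z - f z0) = f - cst (f z0) by [].
  rewrite -(subr0 (0 : R)).
  by apply: is_deriveB; exact: fD.
- move=> z1 Uz1; exists 0, `|f z1 - f z0|.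
  have /nbhs_ballP[r /= r0 rU] := open_nbhs_nbhs (conj oU Uz1).
  near=> w.
  have wr : ball z1 r w by near: w; exact: nbhsx_ballx.
  split=> [_|b _ _ v]; last by rewrite normr0 mul0r mul0r.
  have : `|f ((w - z1) + z1) - f z1| <= 0.
    apply: (@mean_value_bound _ _ _ _ (fun _ => 0)); last by rewrite normr0.
    by move=> s s01; apply/fD/rU/ball_segment => //; exact: ballxx.
  by rewrite subrK normr_le0 subr_eq0 => /eqP ->.
- by move=> _; rewrite subrr.
Unshelve. all: by end_near. Qed.
End Lines.

(** * Complex matrices: norms and directional derivatives *)

Section ReIm.
Variable R : realType.
Implicit Types x y : R[i].

Lemma cReD x y : complex.Re (x + y) = complex.Re x + complex.Re y.
Proof. by case: x; case: y. Qed.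
Lemma cImD x y : complex.Im (x + y) = complex.Im x + complex.Im y.
Proof. by case: x; case: y. Qed.
Lemma cReN x : complex.Re (- x) = - complex.Re x.
Proof. by case: x. Qed.
Lemma cImN x : complex.Im (- x) = - complex.Im x.
Proof. by case: x. Qed.
Lemma cReM x y : complex.Re (x * y) =
  complex.Re x * complex.Re y - complex.Im x * complex.Im y.
Proof. by case: x; case: y. Qed.
Lemma cImM x y : complex.Im (x * y) =
  complex.Re x * complex.Im y + complex.Im x * complex.Re y.
Proof. by case: x; case: y => *; rewrite /= [X in _ + X]mulrC addrC. Qed.
Lemma cReJ x : complex.Re (Num.conj x) = complex.Re x.
Proof. by case: x. Qed.
Lemma cImJ x : complex.Im (Num.conj x) = - complex.Im x.
Proof. by case: x. Qed.
Lemma cRe_sum (I : Type) (r : seq I) (P : pred I) (F : I -> R[i]) :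
  complex.Re (\sum_(i <- r | P i) F i) = \sum_(i <- r | P i) complex.Re (F i).
Proof. by apply: (big_morph (@complex.Re R)) => // x y; rewrite cReD. Qed.
Lemma ReIm_eq x y : complex.Re x = complex.Re y -> complex.Im x = complex.Im y ->
  x = y.
Proof. by case: x y => [a b] [c d] /= -> ->. Qed.

End ReIm.

Section Norm1.
Variable R : realType.
Local Notation C := R[i].

(** A real-valued norm on C, submultiplicative and continuous in the real and
    imaginary parts; it combines with estimates on these parts without square
    roots. *)
Definition cnorm1 (x : C) : R := `|complex.Re x| + `|complex.Im x|.

Lemma cnorm1_ge0 x : 0 <= cnorm1 x. Proof. by rewrite addr_ge0. Qed.

Lemma cnorm1D x y : cnorm1 (x + y) <= cnorm1 x + cnorm1 y.
Proof. by rewrite /cnorm1 cReD cImD addrACA lerD // ler_normD. Qed.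

Lemma cnorm1M x y : cnorm1 (x * y) <= cnorm1 x * cnorm1 y.
Proof.
rewrite /cnorm1 cReM cImM mulrDl !mulrDr.
apply: le_trans (lerD (ler_normB _ _) (ler_normD _ _)) _.
by rewrite !normrM; lra.
Qed.

Lemma cnorm10 : cnorm1 0 = 0. Proof. by rewrite /cnorm1 /= normr0 addr0. Qed.

Lemma cnorm1_sum (I : Type) (r : seq I) (P : pred I) (F : I -> C) :
  cnorm1 (\sum_(i <- r | P i) F i) <= \sum_(i <- r | P i) cnorm1 (F i).
Proof.
apply: (big_rec2 (fun x y => cnorm1 x <= y)); first by rewrite cnorm10.
by move=> i y x _ xy; apply: le_trans (cnorm1D _ _) _; rewrite lerD2l.
Qed.

Definition mnorm1 m n (M : 'M[C]_(m, n)) : R := \sum_a \sum_b cnorm1 (M a b).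

Lemma mnorm1_ge0 m n (M : 'M[C]_(m, n)) : 0 <= mnorm1 M.
Proof. by do 2!apply: sumr_ge0 => ? _; exact: cnorm1_ge0. Qed.

Lemma cnorm1_le_mnorm1 m n (M : 'M[C]_(m, n)) a b : cnorm1 (M a b) <= mnorm1 M.
Proof.
rewrite /mnorm1 (bigD1 a) //= (bigD1 b) //= -addrA lerDl addr_ge0 //.
  by apply: sumr_ge0 => ? _; exact: cnorm1_ge0.
by do 2!apply: sumr_ge0 => ? _; exact: cnorm1_ge0.
Qed.

Lemma Re_le_mnorm1 m n (M : 'M[C]_(m, n)) a b :
  `|complex.Re (M a b)| <= mnorm1 M.
Proof.
by apply: le_trans (cnorm1_le_mnorm1 M a b); rewrite /cnorm1 lerDl.
Qed.

Lemma Im_le_mnorm1 m n (M : 'M[C]_(m, n)) a b :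
  `|complex.Im (M a b)| <= mnorm1 M.
Proof.
by apply: le_trans (cnorm1_le_mnorm1 M a b); rewrite /cnorm1 lerDr.
Qed.

Lemma mnorm1_le m n (M : 'M[C]_(m, n)) (c : R) :
  (forall a b, cnorm1 (M a b) <= c) -> mnorm1 M <= (m * n)%:R * c.
Proof.
move=> Mc; rewrite /mnorm1.
apply: (@le_trans _ _ (\sum_(a < m) \sum_(b < n) c)).
  by do 2!apply: ler_sum => ? _.
by rewrite !sumr_const !card_ord -mulrnA mulr_natl mulnC.
Qed.

Lemma mnorm1D m n (M N : 'M[C]_(m, n)) : mnorm1 (M + N) <= mnorm1 M + mnorm1 N.
Proof.
rewrite /mnorm1 -big_split; apply: ler_sum => a _ /=.
rewrite -big_split; apply: ler_sum => b _ /=.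
by rewrite mxE cnorm1D.
Qed.

Lemma mnorm1Z m n x (M : 'M[C]_(m, n)) : mnorm1 (x *: M) <= cnorm1 x * mnorm1 M.
Proof.
rewrite /mnorm1 mulr_sumr; apply: ler_sum => a _.
by rewrite mulr_sumr; apply: ler_sum => b _; rewrite mxE cnorm1M.
Qed.

Lemma mnorm1M m n p (M : 'M[C]_(m, n)) (N : 'M[C]_(n, p)) :
  mnorm1 (M *m N) <= mnorm1 M * mnorm1 N.
Proof.
rewrite /mnorm1 mulr_suml; apply: ler_sum => a _.
apply: (@le_trans _ _ (\sum_b \sum_c cnorm1 (M a c) * cnorm1 (N c b))).
  apply: ler_sum => b _; rewrite mxE; apply: le_trans (cnorm1_sum _ _ _) _.
  by apply: ler_sum => c _; exact: cnorm1M.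
rewrite exchange_big /= mulr_suml; apply: ler_sum => c _.
rewrite -mulr_sumr ler_wpM2l ?cnorm1_ge0 // (bigD1 c) //= lerDl.
by do 2!apply: sumr_ge0 => ? _; exact: cnorm1_ge0.
Qed.

Lemma mnorm10 m n : mnorm1 (0 : 'M[C]_(m, n)) = 0.
Proof.
by rewrite /mnorm1 big1 // => a _; rewrite big1 // => b _; rewrite mxE cnorm10.
Qed.

Lemma mnorm1_sum m n (I : Type) (r : seq I) (P : pred I) (F : I -> 'M[C]_(m, n)) :
  mnorm1 (\sum_(i <- r | P i) F i) <= \sum_(i <- r | P i) mnorm1 (F i).
Proof.
apply: (big_rec2 (fun x y => mnorm1 x <= y)); first by rewrite mnorm10.
by move=> i y x _ xy; apply: le_trans (mnorm1D _ _) _; rewrite lerD2l.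
Qed.

End Norm1.

Section ComplexDerivative.
Variables (R : realType) (V : normedModType R).
Local Notation C := R[i].

Definition is_cderive (x v : V) (f : V -> C) (d : C) : Prop :=
  is_derive x v (fun y => complex.Re (f y)) (complex.Re d) /\
  is_derive x v (fun y => complex.Im (f y)) (complex.Im d).

Lemma is_cderive_cst (x v : V) (c : C) : is_cderive x v (fun=> c) 0.
Proof. by split; exact: is_derive_cst. Qed.

Lemma is_cderiveD (x v : V) f g df dg : is_cderive x v f df ->
  is_cderive x v g dg -> is_cderive x v (fun y => f y + g y) (df + dg).
Proof.
move=> [f1 f2] [g1 g2]; split.
  rewrite cReD; have := is_deriveD f1 g1; congr is_derive.
  by apply/funext => y; rewrite [RHS]cReD.
rewrite cImD; have := is_deriveD f2 g2; congr is_derive.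
by apply/funext => y; rewrite [RHS]cImD.
Qed.

Lemma is_cderiveM (x v : V) f g df dg : is_cderive x v f df ->
  is_cderive x v g dg ->
  is_cderive x v (fun y => f y * g y) (df * g x + f x * dg).
Proof.
move=> [f1 f2] [g1 g2]; split.
  have := is_deriveB (is_deriveM f1 g1) (is_deriveM f2 g2).
  have -> : complex.Re (df * g x + f x * dg) = complex.Re (f x) *: complex.Re dg
      + complex.Re (g x) *: complex.Re df - (complex.Im (f x) *: complex.Im dg
      + complex.Im (g x) *: complex.Im df).
    by rewrite cReD !cReM /GRing.scale /=; ring.
  by congr is_derive; apply/funext => y; rewrite [RHS]cReM.
have := is_deriveD (is_deriveM f1 g2) (is_deriveM f2 g1).
have -> : complex.Im (df * g x + f x * dg) = complex.Re (f x) *: complex.Im dg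
      + complex.Im (g x) *: complex.Re df + (complex.Im (f x) *: complex.Re dg
      + complex.Re (g x) *: complex.Im df).
  by rewrite cImD !cImM /GRing.scale /=; ring.
by congr is_derive; apply/funext => y; rewrite [RHS]cImM.
Qed.

Lemma is_cderive_conj (x v : V) f df : is_cderive x v f df ->
  is_cderive x v (fun y => Num.conj (f y)) (Num.conj df).
Proof.
move=> [f1 f2]; split.
  rewrite cReJ; move: f1; congr is_derive.
  by apply/funext => y; rewrite [RHS]cReJ.
rewrite cImJ; have := is_deriveN f2; congr is_derive.
by apply/funext => y; rewrite [RHS]cImJ.
Qed.

Lemma is_cderive_sum (x v : V) (I : Type) (r : seq I) (f : I -> V -> C)
    (df : I -> C) : (forall i, is_cderive x v (f i) (df i)) ->
  is_cderive x v (fun y => \sum_(i <- r) f i y) (\sum_(i <- r) df i).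
Proof.
move=> fD; elim: r => [|i r IH].
  rewrite big_nil; have := is_cderive_cst x v 0; congr is_cderive.
  by apply/funext => y; rewrite big_nil.
rewrite big_cons; have := is_cderiveD (fD i) IH; congr is_cderive.
by apply/funext => y; rewrite big_cons.
Qed.

Definition is_mxderive m n (x v : V) (f : V -> 'M[C]_(m, n)) (d : 'M[C]_(m, n)) :=
  forall a b, is_cderive x v (fun y => f y a b) (d a b).

Lemma is_mxderive_cst m n (x v : V) (c : 'M[C]_(m, n)) :
  is_mxderive x v (fun=> c) 0.
Proof. by move=> a b; rewrite mxE; exact: is_cderive_cst. Qed.

Lemma is_mxderiveM m n p (x v : V) (f : V -> 'M[C]_(m, n))
    (g : V -> 'M[C]_(n, p)) df dg :
  is_mxderive x v f df -> is_mxderive x v g dg ->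
  is_mxderive x v (fun y => f y *m g y) (df *m g x + f x *m dg).
Proof.
move=> fD gD a b; rewrite !mxE -big_split /=.
have := @is_cderive_sum x v _ (index_enum 'I_n) (fun c y => f y a c * g y c b)
  (fun c => df a c * g x c b + f x a c * dg c b)
  (fun c => is_cderiveM (fD a c) (gD c b)).
by congr is_cderive; apply/funext => y; rewrite mxE.
Qed.

Lemma is_mxderive_ctrans m n (x v : V) (f : V -> 'M[C]_(m, n)) df :
  is_mxderive x v f df -> is_mxderive x v (fun y => (f y) ^t*) (df ^t*).
Proof.
move=> fD a b; rewrite !mxE; have := is_cderive_conj (fD b a).
by congr is_cderive; apply/funext => y; rewrite !mxE.
Qed.

Lemma is_mxderiveMl m n p (x v : V) (N : 'M[C]_(m, n)) (g : V -> 'M[C]_(n, p)) dg :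
  is_mxderive x v g dg -> is_mxderive x v (fun y => N *m g y) (N *m dg).
Proof.
move=> gD; have := is_mxderiveM (is_mxderive_cst x v N) gD.
by rewrite mul0mx add0r.
Qed.

Lemma is_mxderiveMr m n p (x v : V) (N : 'M[C]_(n, p)) (g : V -> 'M[C]_(m, n)) dg :
  is_mxderive x v g dg -> is_mxderive x v (fun y => g y *m N) (dg *m N).
Proof.
move=> gD; have := is_mxderiveM gD (is_mxderive_cst x v N).
by rewrite mulmx0 addr0.
Qed.

Lemma is_mxderive_near m n (x v : V) (f g : V -> 'M[C]_(m, n)) d :
  (\near x, f x = g x) -> is_mxderive x v f d -> is_mxderive x v g d.
Proof.
move=> fg fD a b; have [f1 f2] := fD a b; split.
  by apply: near_eq_is_derive f1; near=> y; have -> : f y = g y by near: y.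
by apply: near_eq_is_derive f2; near=> y; have -> : f y = g y by near: y.
Unshelve. all: by end_near. Qed.

Lemma is_mxderive_val (x v : V) (f : V -> mat3 R) d :
  is_mxderive x v f d -> mxderive f x v = d.
Proof.
move=> fD; apply/matrixP => a b; have [[_ e1] [_ e2]] := fD a b.
by rewrite mxE e1 e2; case: (d a b).
Qed.

Lemma is_mxderive_unique m n (x v : V) (f : V -> 'M[C]_(m, n)) d d' :
  is_mxderive x v f d -> is_mxderive x v f d' -> d = d'.
Proof.
move=> fD fD'; apply/matrixP => a b; have [[_ e1] [_ e2]] := fD a b.
have [[_ e1'] [_ e2']] := fD' a b.
by apply: ReIm_eq; rewrite -?e1 -?e2 ?e1' ?e2'.
Qed.

Lemma is_mxderive_cst_on m n (U : set V) (f : V -> 'M[C]_(m, n)) (z0 : V) :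
  open U -> connected U -> U z0 ->
  (forall w v, U w -> is_mxderive w v f 0) -> forall z, U z -> f z = f z0.
Proof.
move=> oU cU Uz0 fD z Uz; apply/matrixP => a b.
apply: ReIm_eq.
  apply: (derive0_cst (f := fun y => complex.Re (f y a b)) oU cU Uz0) => // w v Uw.
  by have [] := fD w v Uw a b; rewrite mxE.
apply: (derive0_cst (f := fun y => complex.Im (f y a b)) oU cU Uz0) => // w v Uw.
by have [] := fD w v Uw a b; rewrite mxE.
Qed.

End ComplexDerivative.

(** * Closure properties of smooth functions *)

Section Smooth.
Variables (R : realType) (V : normedModType R).
Implicit Types (U : set V) (f g : V -> R).

Lemma is_Ck_continuous k U f : is_Ck k U f -> forall x, U x -> {for x, continuous f}.
Proof. by case: k => [|k] [fc _] x Ux; apply: fc; rewrite inE. Qed.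

Lemma continuous_at_eq U f g x : open U -> U x -> (forall x, U x -> f x = g x) ->
  {for x, continuous f} -> {for x, continuous g}.
Proof.
move=> oU Ux fg fc; have near_fg : \forall y \near x, f y = g y.
  by near=> y; apply: fg; near: y; exact: open_nbhs_nbhs.
have : g @ x --> g x.
  rewrite -(fg x Ux); apply: cvg_trans fc.
  by apply: near_eq_cvg.
by [].
Unshelve. all: by end_near. Qed.

Lemma is_Ck_eq k U f g : open U -> (forall x, U x -> f x = g x) ->
  is_Ck k U f -> is_Ck k U g.
Proof.
elim: k f g => [|k IH] f g oU fg [fc fS].
  by split=> // x /set_mem Ux; apply: continuous_at_eq fg (fc x (mem_set Ux)).
split=> [x /set_mem Ux|].
  by apply: continuous_at_eq fg (fc x (mem_set Ux)).
move=> v; have [fD fk] := fS v.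
have near_fg x : U x -> \forall y \near x, f y = g y.
  by move=> Ux; near=> y; apply: fg; near: y; exact: open_nbhs_nbhs.
have gD x : U x -> is_derive x v g ('D_v f x).
  move=> Ux; apply: near_eq_is_derive (near_fg x Ux) _.
  by apply: derivableP; apply: fD; rewrite inE.
split; first by move=> x /set_mem Ux; have [] := gD x Ux.
by apply: IH fk => // x Ux; have [_ ->] := gD x Ux.
Unshelve. all: by end_near. Qed.

(** Allows proofs of smoothness by induction on k from a formula for the
    derivative, which needs to hold on the open set U only. *)
Lemma is_CkS k U f (df : V -> V -> R) : open U ->
  (forall x, U x -> {for x, continuous f}) ->
  (forall v x, U x -> is_derive x v f (df v x)) ->
  (forall v, is_Ck k U (df v)) -> is_Ck k.+1 U f.
Proof.
move=> oU fc fD dfk; split; first by move=> x /set_mem; exact: fc.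
move=> v; split; first by move=> x /set_mem Ux; have [] := fD v x Ux.
by apply: is_Ck_eq (dfk v) => // x Ux; have [_ ->] := fD v x Ux.
Qed.

Lemma is_Ck_derive k U f v : is_Ck k.+1 U f ->
  (forall x, U x -> is_derive x v f ('D_v f x)) /\ is_Ck k U (fun x => 'D_v f x).
Proof.
move=> [_ /(_ v)[fD fk]]; split=> // x Ux.
by apply: derivableP; apply: fD; rewrite inE.
Qed.

Lemma is_CkW k U f : is_Ck k.+1 U f -> is_Ck k U f.
Proof.
elim: k f => [|k IH] f [fc fS]; split => // v; have [fD fk] := fS v.
by split=> //; exact: IH.
Qed.

Lemma is_Ck_cst k U (c : R) : is_Ck k U (fun=> c).
Proof.
elim: k c => [|k IH] c; split=> //; try by move=> x _; exact: cst_continuous.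
move=> v; split; first by move=> x _; exact: derivable_cst.
by rewrite (_ : (fun x => 'D_v _ x) = fun=> 0) //; apply/funext => x; exact: derive_cst.
Qed.

Lemma is_CkD k U f g : open U -> is_Ck k U f -> is_Ck k U g ->
  is_Ck k U (fun x => f x + g x).
Proof.
move=> oU; elim: k f g => [|k IH] f g fk gk.
  split=> // x /set_mem Ux; apply: cvgD.
  - exact: is_Ck_continuous fk _ Ux.
  - exact: is_Ck_continuous gk _ Ux.
apply: (@is_CkS _ _ _ (fun v x => 'D_v f x + 'D_v g x)) => //.
- move=> x Ux; apply: cvgD.
  + exact: is_Ck_continuous fk _ Ux.
  + exact: is_Ck_continuous gk _ Ux.
- move=> v x Ux; have [fD _] := is_Ck_derive v fk; have [gD _] := is_Ck_derive v gk.
  exact: is_deriveD (fD x Ux) (gD x Ux).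
- move=> v; have [_ fD] := is_Ck_derive v fk; have [_ gD] := is_Ck_derive v gk.
  exact: IH.
Qed.

Lemma is_CkM k U f g : open U -> is_Ck k U f -> is_Ck k U g ->
  is_Ck k U (fun x => f x * g x).
Proof.
move=> oU; elim: k f g => [|k IH] f g fk gk.
  split=> // x /set_mem Ux; apply: cvgM.
  - exact: is_Ck_continuous fk _ Ux.
  - exact: is_Ck_continuous gk _ Ux.
apply: (@is_CkS _ _ _ (fun v x => f x * 'D_v g x + g x * 'D_v f x)) => //.
- move=> x Ux; apply: cvgM.
  + exact: is_Ck_continuous fk _ Ux.
  + exact: is_Ck_continuous gk _ Ux.
- move=> v x Ux; have [fD _] := is_Ck_derive v fk; have [gD _] := is_Ck_derive v gk.
  exact: is_deriveM (fD x Ux) (gD x Ux).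
- move=> v; have [_ fD] := is_Ck_derive v fk; have [_ gD] := is_Ck_derive v gk.
  by apply: is_CkD => //; apply: IH => //; exact: is_CkW.
Qed.

Lemma smooth_cst U (c : R) : smooth U (fun=> c).
Proof. by move=> k; exact: is_Ck_cst. Qed.

Lemma smoothD U f g : open U -> smooth U f -> smooth U g ->
  smooth U (fun x => f x + g x).
Proof. by move=> oU fs gs k; exact: is_CkD. Qed.

Lemma smoothM U f g : open U -> smooth U f -> smooth U g ->
  smooth U (fun x => f x * g x).
Proof. by move=> oU fs gs k; exact: is_CkM. Qed.

Lemma smoothN U f : open U -> smooth U f -> smooth U (fun x => - f x).
Proof.
move=> oU fs k; apply: (@is_Ck_eq k U (fun x => -1 * f x)) => //.
  by move=> x _; rewrite mulN1r.
by apply: is_CkM => //; exact: is_Ck_cst.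
Qed.

Lemma smooth_eq U f g : open U -> (forall x, U x -> f x = g x) ->
  smooth U f -> smooth U g.
Proof. by move=> oU fg fs k; exact: is_Ck_eq (fs k). Qed.

Lemma smooth_derive U f : smooth U f -> forall x v, U x ->
  is_derive x v f ('D_v f x).
Proof. by move=> fs x v Ux; have [H _] := is_Ck_derive v (fs 1%N); exact: H. Qed.

Lemma smooth_deriveS U f v : smooth U f -> smooth U (fun x => 'D_v f x).
Proof. by move=> fs k; have [_ H] := is_Ck_derive v (fs k.+1). Qed.

Lemma smooth_continuous U f : smooth U f -> forall x, U x -> {for x, continuous f}.
Proof. by move=> fs x Ux; exact: is_Ck_continuous (fs 0%N) x Ux. Qed.

Lemma is_derive1_line (f : V -> R) (g : R -> R) x v df dg :
  is_derive x v f df -> is_derive (f x) (1:R) g dg ->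
  is_derive x v (fun y => g (f y)) (dg * df).
Proof.
move=> fD gD; have := @is_derive_line R V (fun y => g (f y)) x v 0 (dg * df).
rewrite scale0r add0r => ->.
have H : is_derive (0:R) (1:R) (fun u => f (u *: v + x)) df.
  by have := (is_derive_line f x v 0 df).1; rewrite scale0r add0r; apply.
have E : f (0 *: v + x) = f x by rewrite scale0r add0r.
have := @is_derive1_comp R g (fun u => f (u *: v + x)) 0 dg df.
by rewrite E; apply.
Qed.

Lemma is_derive_rsqrt (x : R) : 0 < x ->
  is_derive x (1:R) (fun y => (Num.sqrt y)^-1) (- 2^-1 * (Num.sqrt x)^-1 ^+ 3).
Proof.
move=> x0.
have s0 : 0 < Num.sqrt x by rewrite sqrtr_gt0.
have := is_deriveV (lt0r_neq0 s0) (is_derive1_sqrt x0).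
congr is_derive; rewrite /GRing.scale /=; field; exact: lt0r_neq0.
Qed.

(** The derivative of f^(-1/2) is - f^(-1/2)^3 Df / 2, a polynomial in the
    function itself and the derivative of f, so smoothness bootstraps. *)
Lemma smooth_rsqrt U f : open U -> (forall x, U x -> 0 < f x) -> smooth U f ->
  smooth U (fun x => (Num.sqrt (f x))^-1).
Proof.
move=> oU f0 fs.
have gD v x : U x -> is_derive x v (fun x => (Num.sqrt (f x))^-1)
    (- 2^-1 * ((Num.sqrt (f x))^-1 * ((Num.sqrt (f x))^-1 * (Num.sqrt (f x))^-1))
      * 'D_v f x).
  move=> Ux; have := is_derive1_line (smooth_derive fs v Ux)
    (is_derive_rsqrt (f0 x Ux)).
  by rewrite !exprS expr0 mulr1.
have gc x : U x -> {for x, continuous (fun x => (Num.sqrt (f x))^-1)}.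
  move=> Ux; apply: (@continuous_comp _ _ _ f (fun y => (Num.sqrt y)^-1)).
    exact: smooth_continuous fs x Ux.
  apply: differentiable_continuous; apply/derivable1_diffP.
  by have [] := is_derive_rsqrt (f0 x Ux).
elim=> [|k IH]; first by split=> // x /set_mem; exact: gc.
apply: (is_CkS oU gc gD) => v.
apply: is_CkM => //; last by exact: smooth_deriveS.
by apply: is_CkM => //; [exact: is_Ck_cst|do 2!apply: is_CkM => //].
Qed.

End Smooth.

Section SmoothAffine.
Variables (R : realType) (V W : normedModType R).

(** The map L is affine with linear part l; this covers the restriction of a
    function of (z, t) to a fixed t, and the pullback along a projection. *)
Lemma smooth_affine (U : set V) (U' : set W) (f : V -> R) (L : W -> V) (l : W -> V) :
  open U' -> (forall (s : R) w x, L (s *: w + x) = s *: l w + L x) ->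
  continuous L -> (forall x, U' x -> U (L x)) ->
  smooth U f -> smooth U' (fun x => f (L x)).
Proof.
move=> oU' Ll Lc LU fs k; move: {fs}(fs k); elim: k f => [|k IH] f fk.
  split=> // x /set_mem Ux; apply: continuous_comp; first exact: Lc.
  by apply: is_Ck_continuous fk _ _; exact: LU.
apply: (@is_CkS _ _ _ _ _ (fun v x => 'D_(l v) f (L x))) => //.
- move=> x Ux; apply: continuous_comp; first exact: Lc.
  by apply: is_Ck_continuous fk _ _; exact: LU.
- move=> v x Ux; have [fD _] := is_Ck_derive (l v) fk.
  have := fD _ (LU _ Ux); rewrite -{1}[L x]add0r -(scale0r (l v)).
  move/is_derive_line => H; have := @is_derive_line R W (fun y => f (L y)) x v 0.
  rewrite scale0r add0r => ->; move: H; congr is_derive.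
  by apply/funext => u; rewrite Ll.
- by move=> v; have [_ H] := is_Ck_derive (l v) fk; exact: IH H.
Qed.

End SmoothAffine.

Section ComplexSmooth.
Variables (R : realType) (V : normedModType R).
Local Notation C := R[i].
Implicit Types (U : set V).

Lemma csmooth_cst U (c : C) : csmooth U (fun=> c).
Proof. by split; exact: smooth_cst. Qed.

Lemma csmoothD U (f g : V -> C) : open U -> csmooth U f -> csmooth U g ->
  csmooth U (fun x => f x + g x).
Proof.
move=> oU [f1 f2] [g1 g2]; split.
  by apply: (smooth_eq oU _ (smoothD oU f1 g1)) => x _; rewrite cReD.
by apply: (smooth_eq oU _ (smoothD oU f2 g2)) => x _; rewrite cImD.
Qed.

Lemma csmoothM U (f g : V -> C) : open U -> csmooth U f -> csmooth U g ->
  csmooth U (fun x => f x * g x).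
Proof.
move=> oU [f1 f2] [g1 g2]; split.
  apply: (smooth_eq oU _ (smoothD oU (smoothM oU f1 g1)
    (smoothN oU (smoothM oU f2 g2)))) => x _; exact/esym/cReM.
apply: (smooth_eq oU _ (smoothD oU (smoothM oU f1 g2) (smoothM oU f2 g1))) => x _.
exact/esym/cImM.
Qed.

Lemma csmoothJ U (f : V -> C) : open U -> csmooth U f ->
  csmooth U (fun x => Num.conj (f x)).
Proof.
move=> oU [f1 f2]; split.
  by apply: (smooth_eq oU _ f1) => x _; rewrite cReJ.
by apply: (smooth_eq oU _ (smoothN oU f2)) => x _; rewrite cImJ.
Qed.

Lemma csmooth_real U (f : V -> R) : smooth U f -> csmooth U (fun x => (f x)%:C).
Proof. by move=> fs; split=> //; exact: smooth_cst. Qed.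

Lemma csmoothN U (f : V -> C) : open U -> csmooth U f -> csmooth U (fun x => - f x).
Proof.
move=> oU [f1 f2]; split.
  by apply: (smooth_eq oU _ (smoothN oU f1)) => x _; rewrite cReN.
by apply: (smooth_eq oU _ (smoothN oU f2)) => x _; rewrite cImN.
Qed.

Lemma csmooth_eq U (f g : V -> C) : open U -> (forall x, U x -> f x = g x) ->
  csmooth U f -> csmooth U g.
Proof.
move=> oU fg [f1 f2]; split.
  by apply: smooth_eq f1 => // x Ux; rewrite fg.
by apply: smooth_eq f2 => // x Ux; rewrite fg.
Qed.

Lemma csmooth_sum U (I : Type) (r : seq I) (f : I -> V -> C) : open U ->
  (forall i, csmooth U (f i)) -> csmooth U (fun x => \sum_(i <- r) f i x).
Proof.
move=> oU fs; elim: r => [|i r IH].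
  by apply: (csmooth_eq oU _ (csmooth_cst U 0)) => x _; rewrite big_nil.
apply: (csmooth_eq oU _ (csmoothD oU (fs i) IH)) => x _.
by rewrite big_cons.
Qed.

Lemma mxsmooth_mul U (f g : V -> mat3 R) : open U -> mxsmooth U f ->
  mxsmooth U g -> mxsmooth U (fun x => f x *m g x).
Proof.
move=> oU fs gs a b.
have := @csmooth_sum U _ (index_enum 'I_3) (fun c x => f x a c * g x c b) oU
  (fun c => csmoothM oU (fs a c) (gs c b)).
by apply: csmooth_eq => // x _; rewrite mxE.
Qed.

Lemma mxsmooth_ctrans U (f : V -> mat3 R) : open U -> mxsmooth U f ->
  mxsmooth U (fun x => (f x) ^t*).
Proof.
move=> oU fs a b; apply: (csmooth_eq oU _ (csmoothJ oU (fs b a))) => x _.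
by rewrite !mxE.
Qed.

Lemma mxsmooth_eq U (f g : V -> mat3 R) : open U -> (forall x, U x -> f x = g x) ->
  mxsmooth U f -> mxsmooth U g.
Proof.
by move=> oU fg fs a b; apply: (csmooth_eq oU _ (fs a b)) => x Ux; rewrite fg.
Qed.

Lemma mxsmooth_continuous U (f : V -> mat3 R) : mxsmooth U f -> forall x a b, U x ->
  {for x, continuous (fun y => complex.Re (f y a b))} /\
  {for x, continuous (fun y => complex.Im (f y a b))}.
Proof.
by move=> fs x a b Ux; have [f1 f2] := fs a b; split; exact: smooth_continuous Ux.
Qed.

End ComplexSmooth.

Section ComplexSmoothAffine.
Variables (R : realType) (V W : normedModType R).

Lemma mxsmooth_affine (U : set V) (U' : set W) (f : V -> mat3 R) (L l : W -> V) :
  open U' -> (forall (s : R) w x, L (s *: w + x) = s *: l w + L x) ->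
  continuous L -> (forall x, U' x -> U (L x)) ->
  mxsmooth U f -> mxsmooth U' (fun x => f (L x)).
Proof.
move=> oU' Ll Lc LU fs a b; have [f1 f2] := fs a b; split.
  exact: (smooth_affine oU' Ll Lc LU f1).
exact: (smooth_affine oU' Ll Lc LU f2).
Qed.

End ComplexSmoothAffine.

(** * Fourier coefficients of continuous loops *)

Section Circle.
Variable R : realType.
Local Notation C := R[i].

Lemma expiD (s t : R) : expi (s + t) = expi s * expi t.
Proof.
apply: ReIm_eq; rewrite /expi /= ?cosD ?sinD //.
by rewrite addrC mulrC [X in _ + X]mulrC.
Qed.

Lemma expi0 : expi (0 : R) = 1.
Proof. by rewrite /expi cos0 sin0. Qed.

Lemma norm_expi (t : R) : `|expi t| = 1.
Proof. by rewrite normc_def /= cos2Dsin2 sqrtr1. Qed.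

Lemma expi_neq0 (t : R) : expi t != 0.
Proof. by rewrite -normr_eq0 norm_expi oner_eq0. Qed.

Lemma expiN (t : R) : expi (- t) = (expi t)^-1.
Proof.
apply: (mulfI (expi_neq0 t)); rewrite divff ?expi_neq0 //.
by rewrite -expiD subrr expi0.
Qed.

Lemma expiX (t : R) (n : nat) : expi t ^+ n = expi (n%:R * t).
Proof.
elim: n => [|n IH]; first by rewrite mul0r expi0.
by rewrite exprS IH -expiD mulrSr mulrDl mul1r addrC.
Qed.

Lemma expiZ (t : R) (k : int) : expi t ^ k = expi (k%:~R * t).
Proof.
case: k => n; first by rewrite -exprnP expiX.
by rewrite NegzE -exprnN expiX mulrNz mulNr expiN.
Qed.

Lemma expi_surj (l : C) : `|l| = 1 -> exists2 t : R, - pi <= t <= pi & l = expi t.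
Proof.
case: l => x y; rewrite normc_def /= => /(congr1 (@complex.Re R)) /= xy1.
have xy : x ^+ 2 + y ^+ 2 = 1.
  by rewrite -(sqr_sqrtr (_ : 0 <= x ^+ 2 + y ^+ 2)) ?xy1 ?expr1n // addr_ge0 // sqr_ge0.
have x1 : -1 <= x <= 1 by have y2 := sqr_ge0 y; apply/andP; split; nra.
have [/andP[a0 api] cosx] := acos_def x1.
have pi0 := pi_gt0 R.
have sinx : sin (acos x) = `|y|.
  rewrite sin_acos // (_ : 1 - x ^+ 2 = y ^+ 2) ?sqrtr_sqr //.
  by rewrite -xy addrC addKr.
have [y0|y0] := leP 0 y.
  exists (acos x); first by apply/andP; split; lra.
  by rewrite /expi cosx sinx ger0_norm.
exists (- acos x); first by apply/andP; split; lra.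
by rewrite /expi cosN sinN cosx sinx ltr0_norm // opprK.
Qed.

Lemma cnorm1_expi (t : R) : cnorm1 (expi t) <= 2.
Proof.
by rewrite /cnorm1 /=; have := cos_max t; have := sin_max t; lra.
Qed.

Definition ccont (f : R -> C) := continuous (fun t => complex.Re (f t)) /\
  continuous (fun t => complex.Im (f t)).

Lemma ccont_cst (c : C) : ccont (fun=> c).
Proof. by split=> t; exact: cst_continuous. Qed.

Lemma ccontD f g : ccont f -> ccont g -> ccont (fun t => f t + g t).
Proof.
move=> [f1 f2] [g1 g2]; split=> t.
  under [fun t => _]eq_fun do rewrite cReD; apply: cvgD; [exact: f1|exact: g1].
under [fun t => _]eq_fun do rewrite cImD; apply: cvgD; [exact: f2|exact: g2].
Qed.

Lemma ccontM f g : ccont f -> ccont g -> ccont (fun t => f t * g t).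
Proof.
move=> [f1 f2] [g1 g2]; split=> t.
  under [fun t => _]eq_fun do rewrite cReM.
  by apply: cvgB; apply: cvgM; [exact: f1|exact: g1|exact: f2|exact: g2].
under [fun t => _]eq_fun do rewrite cImM.
by apply: cvgD; apply: cvgM; [exact: f1|exact: g2|exact: f2|exact: g1].
Qed.

Lemma ccont_sum (I : Type) (r : seq I) (f : I -> R -> C) :
  (forall i, ccont (f i)) -> ccont (fun t => \sum_(i <- r) f i t).
Proof.
move=> fs; elim: r => [|i r IH].
  by under [fun t => _]eq_fun do rewrite big_nil; exact: ccont_cst.
by under [fun t => _]eq_fun do rewrite big_cons; exact: ccontD.
Qed.

Lemma ccont_expi (k : int) : ccont (fun t => expi t ^ k).
Proof.
have E : continuous (fun t : R => k%:~R * t) by move=> t; exact: mulrl_continuous.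
split; under eq_fun do rewrite expiZ.
  by move=> t; apply: continuous_comp; [exact: E|exact: continuous_cos].
by move=> t; apply: continuous_comp; [exact: E|exact: continuous_sin].
Qed.

(** The Fourier integral of a scalar function; [fourier] applies it to each
    entry ([fourierE]). *)
Definition cmean (f : R -> C) : C :=
  ((2 * pi)^-1 * \int[lebesgue_measure]_(t in `[0, 2 * pi]) complex.Re (f t)
  +i* ((2 * pi)^-1 * \int[lebesgue_measure]_(t in `[0, 2 * pi]) complex.Im (f t))).

Let pi2_gt0 : 0 < 2 * pi :> R. Proof. by rewrite mulr_gt0 // pi_gt0. Qed.

Lemma continuous_integrable_2pi (f : R -> R) : continuous f ->
  lebesgue_measure.-integrable `[0, 2 * pi] (EFin \o f).
Proof.
move=> fc; apply: continuous_compact_integrable; first exact: segment_compact.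
exact: continuous_subspaceT.
Qed.

Lemma cmeanD f g : ccont f -> ccont g ->
  cmean (fun t => f t + g t) = cmean f + cmean g.
Proof.
move=> [f1 f2] [g1 g2]; apply: ReIm_eq; rewrite ?cReD ?cImD /= -mulrDr; congr (_ * _).
  under eq_Rintegral do rewrite cReD.
  by rewrite RintegralD //; exact: continuous_integrable_2pi.
under eq_Rintegral do rewrite cImD.
by rewrite RintegralD //; exact: continuous_integrable_2pi.
Qed.

Lemma cmeanZ (c : C) f : ccont f -> cmean (fun t => c * f t) = c * cmean f.
Proof.
move=> [f1 f2]; have i1 := continuous_integrable_2pi f1.
have i2 := continuous_integrable_2pi f2.
have lin (a b : R) : \int[lebesgue_measure]_(t in `[0, 2 * pi])
      (a * complex.Re (f t) + b * complex.Im (f t))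
    = a * \int[lebesgue_measure]_(t in `[0, 2 * pi]) complex.Re (f t)
    + b * \int[lebesgue_measure]_(t in `[0, 2 * pi]) complex.Im (f t).
  rewrite RintegralD //; first by rewrite !RintegralZl.
    apply: continuous_integrable_2pi => t; apply: cvgM; [exact: cvg_cst|exact: f1].
  apply: continuous_integrable_2pi => t; apply: cvgM; [exact: cvg_cst|exact: f2].
apply: ReIm_eq; rewrite ?cReM ?cImM /=.
  under eq_Rintegral do rewrite cReM -mulNr.
  by rewrite lin; ring.
under eq_Rintegral do rewrite cImM addrC.
by rewrite lin; ring.
Qed.

Lemma Rintegral_cst_2pi (c : R) :
  \int[lebesgue_measure]_(t in `[0, 2 * pi]) c = c * (2 * pi).
Proof.
have := @lebesgue_measure_itv R `[0, 2 * pi].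
rewrite /= lte_fin pi2_gt0 -EFinB subr0 => /(congr1 fine) /= mu2pi.
by rewrite Rintegral_cst //; congr (c * _); exact: mu2pi.
Qed.

Lemma cmean_cst (c : C) : cmean (fun=> c) = c.
Proof.
by apply: ReIm_eq; rewrite /= Rintegral_cst_2pi mulrCA mulVf ?mulr1 // gt_eqF.
Qed.

Lemma cmean_sum (I : Type) (r : seq I) (f : I -> R -> C) :
  (forall i, ccont (f i)) ->
  cmean (fun t => \sum_(i <- r) f i t) = \sum_(i <- r) cmean (f i).
Proof.
move=> fs; elim: r => [|i r IH].
  by rewrite big_nil -[RHS]cmean_cst; congr cmean; apply/funext => t; rewrite big_nil.
rewrite big_cons -IH -cmeanD //; last exact: ccont_sum.
by congr cmean; apply/funext => t; rewrite big_cons.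
Qed.

Lemma Rintegral_derive_2pi (f F : R -> R) : continuous f ->
  (forall t, is_derive t (1:R) F (f t)) ->
  \int[lebesgue_measure]_(t in `[0, 2 * pi]) f t = F (2 * pi) - F 0.
Proof.
move=> fc FD; rewrite /Rintegral (@continuous_FTC2 _ f F) //.
- exact: continuous_subspaceT.
- have Fc t : F x @[x --> t] --> F t.
    apply: differentiable_continuous; apply/derivable1_diffP.
    by have [] := FD t.
  split; first by move=> t _; have [] := FD t.
    by apply: cvg_at_right_filter; exact: Fc.
  by apply: cvg_at_left_filter; exact: Fc.
- by move=> t _; rewrite derive1E; have [_ ->] := FD t.
Qed.

Lemma is_derive_scale (g : R -> R) (a t d : R) : is_derive (a * t) (1:R) g d ->
  is_derive t (1:R) (fun t => g (a * t)) (d * a).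
Proof.
move=> gD; apply: (@is_derive1_comp R g (fun t => a * t)).
by have := is_deriveZ a (is_derive_id t (1:R)); rewrite [a *: 1]mulr1.
Qed.

Lemma cmean_expi (k : int) : cmean (fun t => expi t ^ k) = (k == 0)%:R.
Proof.
have [->|k0] := eqVneq k 0.
  by rewrite -[RHS]cmean_cst; congr cmean; apply/funext => t; rewrite expr0z.
have a0 : k%:~R != 0 :> R by rewrite intr_eq0.
have /(congr1 (fun x : C => x ^ k)) : expi (2 * pi) = 1 :> C.
  by rewrite /expi mulr_natl cos2pi sin2pi.
rewrite exp1rz expiZ; set b := k%:~R * (2 * pi) => -[cosb sinb].
have [c1 c2] := ccont_expi k.
have E (t : R) : expi t ^ k = expi (k%:~R * t) by exact: expiZ.
have sinD (t : R) : is_derive t (1:R) (fun t => k%:~R^-1 * sin (k%:~R * t))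
    (complex.Re (expi t ^ k)).
  have := is_deriveZ k%:~R^-1 (is_derive_scale (is_derive_sin (k%:~R * t))).
  by rewrite E; congr is_derive; rewrite /GRing.scale /= mulrC mulfK.
have cosD (t : R) : is_derive t (1:R) (fun t => - k%:~R^-1 * cos (k%:~R * t))
    (complex.Im (expi t ^ k)).
  have := is_deriveZ (- k%:~R^-1) (is_derive_scale (is_derive_cos (k%:~R * t))).
  by rewrite E; congr is_derive; rewrite /GRing.scale /= !mulNr mulrN opprK mulrC mulfK.
apply: ReIm_eq => /=.
  by rewrite (Rintegral_derive_2pi c1 sinD) -/b sinb !mulr0 sin0 mulr0 subr0 mulr0.
by rewrite (Rintegral_derive_2pi c2 cosD) -/b cosb !mulr0 cos0 subrr mulr0.
Qed.

Lemma Rintegral_bound_2pi (f : R -> R) (K : R) : continuous f ->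
  (forall t, `|f t| <= K) ->
  `|\int[lebesgue_measure]_(t in `[0, 2 * pi]) f t| <= K * (2 * pi).
Proof.
move=> fc fK; apply: le_trans (le_normr_Rintegral _ _) _ => //.
  exact: continuous_integrable_2pi.
apply: le_trans (le_Rintegral (f2 := fun=> K) _ _ _ _) _ => //.
- apply: continuous_integrable_2pi => t; apply: cvg_norm; exact: fc.
- by apply: continuous_integrable_2pi => t; exact: cvg_cst.
by rewrite Rintegral_cst_2pi.
Qed.

Lemma cmean_bound f (K : R) : ccont f -> (forall t, cnorm1 (f t) <= K) ->
  cnorm1 (cmean f) <= 2 * K.
Proof.
move=> [f1 f2] fK.
have b1 : `|\int[lebesgue_measure]_(t in `[0, 2 * pi]) complex.Re (f t)| <= K * (2 * pi).
  apply: Rintegral_bound_2pi => // t; apply: le_trans (fK t).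
  by rewrite /cnorm1 lerDl.
have b2 : `|\int[lebesgue_measure]_(t in `[0, 2 * pi]) complex.Im (f t)| <= K * (2 * pi).
  apply: Rintegral_bound_2pi => // t; apply: le_trans (fK t).
  by rewrite /cnorm1 lerDr.
rewrite /cnorm1 /= !normrM (ger0_norm (_ : 0 <= (2 * pi)^-1)) ?invr_ge0 ?(ltW pi2_gt0) //.
rewrite -mulrDr mulrC ler_pdivrMr //; lra.
Qed.

End Circle.

Section Fourier.
Variable R : realType.
Local Notation C := R[i].
Implicit Types g h : loop R.

Lemma fourierE g k a b :
  fourier g k a b = cmean (fun t => g (expi t) a b * expi t ^ (- k)).
Proof. by rewrite mxE. Qed.

(** Continuity on the unit circle, the only place where the values of a loop are
    meaningful. *)
Definition ctsloop g := forall a b, ccont (fun t => g (expi t) a b).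

Lemma ctsloop_term g k a b : ctsloop g ->
  ccont (fun t => g (expi t) a b * expi t ^ (- k)).
Proof. by move=> gc; apply: ccontM; [exact: gc|exact: ccont_expi]. Qed.

Lemma eq_fourier g h k : (forall l, `|l| = 1 -> g l = h l) ->
  fourier g k = fourier h k.
Proof.
move=> gh; apply/matrixP => a b; rewrite !fourierE; congr cmean.
by apply/funext => t; rewrite gh // norm_expi.
Qed.

Lemma eq_ctsloop g h : (forall l, `|l| = 1 -> g l = h l) -> ctsloop g -> ctsloop h.
Proof.
move=> gh gc a b; have := gc a b; congr ccont.
by apply/funext => t; rewrite gh // norm_expi.
Qed.

Lemma ctsloop_cst M : ctsloop (fun=> M).
Proof. by move=> a b; exact: ccont_cst. Qed.

Lemma ctsloopD g h : ctsloop g -> ctsloop h -> ctsloop (fun l => g l + h l).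
Proof.
move=> gc hc a b; have := ccontD (gc a b) (hc a b); congr ccont.
by apply/funext => t; rewrite mxE.
Qed.

Lemma ctsloopM g h : ctsloop g -> ctsloop h -> ctsloop (fun l => g l *m h l).
Proof.
move=> gc hc a b.
have := @ccont_sum R _ (index_enum 'I_3) (fun c t => g (expi t) a c * h (expi t) c b)
  (fun c => ccontM (gc a c) (hc c b)).
by congr ccont; apply/funext => t; rewrite mxE.
Qed.

Lemma ctsloopZ (k : int) g : ctsloop g -> ctsloop (fun l => l ^ k *: g l).
Proof.
move=> gc a b; have := ccontM (ccont_expi R k) (gc a b); congr ccont.
by apply/funext => t; rewrite mxE.
Qed.

Lemma ctsloop_sum (I : Type) (r : seq I) (g : I -> loop R) :
  (forall i, ctsloop (g i)) -> ctsloop (fun l => \sum_(i <- r) g i l).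
Proof.
move=> gc a b.
have := @ccont_sum R _ r (fun i t => g i (expi t) a b) (fun i => gc i a b).
by congr ccont; apply/funext => t; rewrite summxE.
Qed.

Lemma fourierD g h k : ctsloop g -> ctsloop h ->
  fourier (fun l => g l + h l) k = fourier g k + fourier h k.
Proof.
move=> gc hc; apply/matrixP => a b; rewrite [RHS]mxE !fourierE.
rewrite -cmeanD; [|exact: ctsloop_term..].
by congr cmean; apply/funext => t; rewrite mxE mulrDl.
Qed.

Lemma fourier_sum (I : Type) (r : seq I) (g : I -> loop R) k :
  (forall i, ctsloop (g i)) ->
  fourier (fun l => \sum_(i <- r) g i l) k = \sum_(i <- r) fourier (g i) k.
Proof.
move=> gc; apply/matrixP => a b; rewrite fourierE summxE.
under [RHS]eq_bigr do rewrite fourierE.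
rewrite -cmean_sum; last by move=> i; exact: ctsloop_term.
by congr cmean; apply/funext => t; rewrite summxE mulr_suml.
Qed.

Lemma fourierMl (P : mat3 R) g k : ctsloop g ->
  fourier (fun l => P *m g l) k = P *m fourier g k.
Proof.
move=> gc; apply/matrixP => a b; rewrite fourierE [RHS]mxE.
have E c : P a c * fourier g k c b
    = cmean (fun t => P a c * (g (expi t) c b * expi t ^ (- k))).
  by rewrite fourierE cmeanZ //; exact: ctsloop_term.
under [RHS]eq_bigr do rewrite E.
rewrite -cmean_sum; last first.
  by move=> c; apply: ccontM; [exact: ccont_cst|exact: ctsloop_term].
congr cmean; apply/funext => t; rewrite mxE mulr_suml.
by apply: eq_bigr => c _; rewrite mulrA.
Qed.

Lemma fourierMr (P : mat3 R) g k : ctsloop g ->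
  fourier (fun l => g l *m P) k = fourier g k *m P.
Proof.
move=> gc; apply/matrixP => a b; rewrite fourierE [RHS]mxE.
have E c : fourier g k a c * P c b
    = cmean (fun t => P c b * (g (expi t) a c * expi t ^ (- k))).
  by rewrite fourierE mulrC cmeanZ //; exact: ctsloop_term.
under [RHS]eq_bigr do rewrite E.
rewrite -cmean_sum; last first.
  by move=> c; apply: ccontM; [exact: ccont_cst|exact: ctsloop_term].
congr cmean; apply/funext => t; rewrite mxE mulr_suml.
by apply: eq_bigr => c _; rewrite mulrA [P c b * _]mulrC.
Qed.

Lemma fourierZ (c : C) g k : ctsloop g ->
  fourier (fun l => c *: g l) k = c *: fourier g k.
Proof.
move=> gc; rewrite -mul_scalar_mx -fourierMl //; apply: eq_fourier => l _.
by rewrite mul_scalar_mx.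
Qed.

Lemma fourier_shift (j : int) g k :
  fourier (fun l => l ^ j *: g l) k = fourier g (k - j).
Proof.
apply/matrixP => a b; rewrite !fourierE; congr cmean; apply/funext => t.
by rewrite mxE opprB expfzDr ?expi_neq0 // [RHS]mulrA [X in X * _ = _]mulrC.
Qed.

Lemma fourier_cst (M : mat3 R) k : fourier (fun=> M) k = (k == 0)%:R *: M.
Proof.
apply/matrixP => a b; rewrite fourierE mxE cmeanZ; last exact: ccont_expi.
by rewrite cmean_expi oppr_eq0 mulrC.
Qed.

Lemma fourier_monomial (M : mat3 R) (j k : int) :
  fourier (fun l => l ^ j *: M) k = (k == j)%:R *: M.
Proof. by rewrite fourier_shift fourier_cst subr_eq0. Qed.

Lemma ctsloop_monomial (M : mat3 R) (j : int) : ctsloop (fun l => l ^ j *: M).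
Proof. exact/ctsloopZ/ctsloop_cst. Qed.

(** Orthogonality of the characters: the coefficients of a Laurent polynomial can
    be read off. *)
Lemma fourier_laurent (n : nat) (e : 'I_n -> int) (M : 'I_n -> mat3 R) k :
  fourier (fun l => \sum_(i < n) l ^ e i *: M i) k
  = \sum_(i < n | e i == k) M i.
Proof.
rewrite fourier_sum; last by move=> i; exact: ctsloop_monomial.
rewrite [RHS]big_mkcond; apply: eq_bigr => i _.
rewrite fourier_monomial eq_sym; case: eqP => _; by rewrite ?scale1r ?scale0r.
Qed.

(** The bound does not depend on k.  In 36 = 9 * 2 * 2, 9 is the number of
    entries and the factors 2 come from estimating complex numbers by their real
    and imaginary parts. *)
Lemma fourier_bound g k (K : R) : ctsloop g ->
  (forall t, mnorm1 (g (expi t)) <= K) -> mnorm1 (fourier g k) <= 36%:R * K.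
Proof.
move=> gc gK; have -> : 36%:R * K = (3 * 3)%:R * (2 * (K * 2)) by ring.
apply: mnorm1_le => a b; rewrite fourierE; apply: cmean_bound.
  exact: ctsloop_term.
move=> t; apply: le_trans (cnorm1M _ _) _.
apply: ler_pM; rewrite ?cnorm1_ge0 //.
  exact: le_trans (cnorm1_le_mnorm1 _ _ _) (gK t).
by rewrite expiZ cnorm1_expi.
Qed.

End Fourier.

(** * Differentiation of Fourier coefficients *)

Section UnderIntegral.
Variables (R : realType) (V : normedModType R).
Local Notation C := R[i].

(** Dominated differentiation along the line through z in the direction v; K is
    the integrable bound on a segment inside the ball. *)
Lemma derive_under_Rintegral (f df : V -> R -> R) (z v : V) (K r : R) : 0 < r ->
  (forall y t, ball z r y -> is_derive y v (f^~ t) (df y t)) ->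
  (forall y, ball z r y -> continuous (f y)) ->
  (forall y t, ball z r y -> `|df y t| <= K) ->
  is_derive z v (fun y => \int[lebesgue_measure]_(t in `[0, 2 * pi]) f y t)
    (\int[lebesgue_measure]_(t in `[0, 2 * pi]) df z t).
Proof.
move=> r0 fD fc dfK.
pose e := r / (`|v| + 1).
have v1 : 0 < `|v| + 1 by rewrite ltr_wpDl.
have e0 : 0 < e by rewrite divr_gt0.
have inb (s : R) : `]- e, e[%classic s -> ball z r (s *: v + z).
  rewrite /= in_itv /= -ltr_norml -ball_normE /ball_ /= => se.
  rewrite opprD addrCA subrr addr0 normrN normrZ.
  apply: (@le_lt_trans _ _ (`|s| * (`|v| + 1))).
    by rewrite ler_wpM2l // lerDl.
  by rewrite -ltr_pdivlMr.
have K0 : 0 <= K by apply: le_trans (dfK z 0 (ballxx z r0)).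
have I0 : `]- e, e[%classic (0 : R) by rewrite /= in_itv /= oppr_lt0 e0.
pose F (s t : R) := f (s *: v + z) t.
have FD (s t : R) : `]- e, e[%classic s ->
    is_derive s (1:R) (F^~ t) (df (s *: v + z) t).
  by move=> /inb sb; apply/(is_derive_line (f^~ t))/fD.
have H1 (s : R) : `]- e, e[%classic s ->
    lebesgue_measure.-integrable `[0, 2 * pi] (EFin \o F s).
  by move=> /inb sb; apply: continuous_integrable_2pi; exact: fc.
have H2 (s t : R) : `]- e, e[%classic s -> `[0, 2 * pi]%classic t ->
    derivable (F^~ t) s 1.
  by move=> sb _; have [] := FD s t sb.
have H3 : lebesgue_measure.-integrable `[0, 2 * pi] (EFin \o (fun=> K : R)).
  by apply: continuous_integrable_2pi => t; exact: cvg_cst.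
have H4 (s t : R) : `]- e, e[%classic s -> `[0, 2 * pi]%classic t ->
    `|partial1of2 F s t| <= K.
  move=> sb _; rewrite partial1of2E; have [_ ->] := FD s t sb.
  exact: dfK (inb s sb).
have m2 : measurable (`[0, 2 * pi]%classic : set R) by [].
have D1 := @derivable_under_integral _ _ _ lebesgue_measure F _ m2 _ _ _ I0
  H1 H2 _ (fun=> K0) H3 H4.
have D2 := @differentiation_under_integral _ _ _ lebesgue_measure F _ m2 _ _ _ I0
  H1 H2 _ (fun=> K0) H3 H4.
have := is_derive_line
  (fun y => \int[lebesgue_measure]_(t in `[0, 2 * pi]) f y t) z v 0
  (\int[lebesgue_measure]_(t in `[0, 2 * pi]) df z t).
rewrite scale0r add0r => ->; constructor; first exact: D1.
move: D2; rewrite derive1E => ->; apply: eq_Rintegral => t _.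
by rewrite partial1of2E; have [_ ->] := FD 0 t I0; rewrite scale0r add0r.
Qed.

Lemma derive_cmean (f df : V -> R -> C) (z v : V) (K r : R) : 0 < r ->
  (forall y t, ball z r y -> is_cderive y v (f^~ t) (df y t)) ->
  (forall y, ball z r y -> ccont (f y)) ->
  (forall y t, ball z r y -> cnorm1 (df y t) <= K) ->
  is_cderive z v (fun y => cmean (f y)) (cmean (df z)).
Proof.
move=> r0 fD fc dfK; split.
  have D : is_derive z v
      (fun y => \int[lebesgue_measure]_(t in `[0, 2 * pi]) complex.Re (f y t))
      (\int[lebesgue_measure]_(t in `[0, 2 * pi]) complex.Re (df z t)).
    apply: (@derive_under_Rintegral _ (fun y t => complex.Re (df y t)) _ _ K r) => //.
    - by move=> y t yr; have [] := fD y t yr.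
    - by move=> y yr; have [] := fc y yr.
    - by move=> y t yr; apply: le_trans (dfK y t yr); rewrite /cnorm1 lerDl.
  exact: (@is_deriveZ _ _ _ _ (2 * pi)^-1 _ _ _ D).
have D : is_derive z v
    (fun y => \int[lebesgue_measure]_(t in `[0, 2 * pi]) complex.Im (f y t))
    (\int[lebesgue_measure]_(t in `[0, 2 * pi]) complex.Im (df z t)).
  apply: (@derive_under_Rintegral _ (fun y t => complex.Im (df y t)) _ _ K r) => //.
  - by move=> y t yr; have [] := fD y t yr.
  - by move=> y yr; have [] := fc y yr.
  - by move=> y t yr; apply: le_trans (dfK y t yr); rewrite /cnorm1 lerDr.
exact: (@is_deriveZ _ _ _ _ (2 * pi)^-1 _ _ _ D).
Qed.

Lemma derive_fourier (g dg : V -> loop R) (z v : V) (K r : R) k : 0 < r ->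
  (forall y t, ball z r y -> is_mxderive y v (g^~ (expi t)) (dg y (expi t))) ->
  (forall y, ball z r y -> ctsloop (g y)) ->
  (forall y t, ball z r y -> mnorm1 (dg y (expi t)) <= K) ->
  is_mxderive z v (fun y => fourier (g y) k) (fourier (dg z) k).
Proof.
move=> r0 gD gc dgK a b; rewrite fourierE.
have := @derive_cmean (fun y t => g y (expi t) a b * expi t ^ (- k))
  (fun y t => dg y (expi t) a b * expi t ^ (- k)) z v (K * 2) r r0.
have -> : (fun y => fourier (g y) k a b)
  = (fun y => cmean (fun t => g y (expi t) a b * expi t ^ (- k))).
  by apply/funext => y; rewrite fourierE.
apply.
- move=> y t yr; have := is_cderiveM (gD y t yr a b) (is_cderive_cst y v (expi t ^ (- k))).
  by rewrite mulr0 addr0.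
- by move=> y yr; apply: ctsloop_term; exact: gc.
- move=> y t yr; apply: le_trans (cnorm1M _ _) _.
  apply: ler_pM; rewrite ?cnorm1_ge0 //.
    exact: le_trans (cnorm1_le_mnorm1 _ _ _) (dgK y t yr).
  by rewrite expiZ cnorm1_expi.
Qed.

End UnderIntegral.

(** * The exponential of a normal matrix *)

Section LoopBound.
Variable R : realType.
Local Notation C := R[i].

Lemma continuous_sum (I : Type) (r : seq I) (f : I -> R -> R) :
  (forall i, continuous (f i)) -> continuous (fun t => \sum_(i <- r) f i t).
Proof.
move=> fc; elim: r => [|i r IH] t.
  by under [fun t => _]eq_fun do rewrite big_nil; exact: cvg_cst.
by under [fun t => _]eq_fun do rewrite big_cons; apply: cvgD; [exact: fc|exact: IH].
Qed.

Lemma continuous_mnorm1 m n (f : R -> 'M[C]_(m, n)) :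
  (forall a b, ccont (fun t => f t a b)) -> continuous (fun t => mnorm1 (f t)).
Proof.
move=> fc; apply: continuous_sum => a; apply: continuous_sum => b t.
have [f1 f2] := fc a b.
by apply: cvgD; apply: cvg_norm; [exact: f1|exact: f2].
Qed.

(** The circle is the image of the compact interval [-pi, pi]. *)
Lemma ctsloop_bounded (g : loop R) : ctsloop g ->
  exists K : R, forall l, `|l| = 1 -> mnorm1 (g l) <= K.
Proof.
move=> gc; have pi0 := pi_gt0 R.
have pipi : - pi <= pi :> R by lra.
have Nc := @continuous_mnorm1 3 3 (fun t => g (expi t)) gc.
have [c _ cmax] := EVT_max pipi (continuous_subspaceT Nc).
exists (mnorm1 (g (expi c))) => l /expi_surj[t tpi ->].
by apply: cmax; rewrite in_itv.
Qed.

End LoopBound.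

Section MatrixExponential.
Variable R : realType.
Local Notation C := R[i].

(** The exponential e^w. *)
Definition cexp (w : C) : C := (expR (complex.Re w))%:C * expi (complex.Im w).

Lemma cexp0 : cexp 0 = 1.
Proof. by rewrite /cexp /= expR0 expi0 mulr1. Qed.

Lemma cexp_derive (V : normedModType R) (x v : V) (f : V -> C) d :
  is_cderive x v f d -> is_cderive x v (fun y => cexp (f y)) (d * cexp (f x)).
Proof.
move=> [f1 f2].
have e1 := is_derive1_line f1 (is_derive_expR _).
have c1 := is_derive1_line f2 (is_derive_cos _).
have s1 := is_derive1_line f2 (is_derive_sin _).
have H : is_cderive x v (fun y => (expR (complex.Re (f y)))%:C)
    (expR (complex.Re (f x)) * complex.Re d)%:C.
  by split=> //; exact: is_derive_cst.
have H' : is_cderive x v (fun y => expi (complex.Im (f y)))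
  ((- sin (complex.Im (f x)) * complex.Im d) +i* (cos (complex.Im (f x)) * complex.Im d)).
  by split.
have := is_cderiveM H H'; congr is_cderive.
by apply: ReIm_eq; rewrite /cexp ?(cReD, cImD) ?(cReM, cImM) /=; ring.
Qed.

Lemma cnorm1_cexp (w : C) (W : R) : cnorm1 w <= W -> cnorm1 (cexp w) <= 2 * expR W.
Proof.
move=> wW; apply: le_trans (cnorm1M _ _) _; rewrite mulrC.
apply: ler_pM; rewrite ?cnorm1_ge0 ?cnorm1_expi //.
rewrite /cnorm1 /= normr0 addr0 ger0_norm ?expR_ge0 // ler_expR.
apply: le_trans wW; apply: le_trans (ler_norm _) _.
by rewrite /cnorm1 lerDl.
Qed.

Lemma unitary_cnorm1 m n (U : 'M[C]_(m, n)) a b : U \is unitarymx ->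
  cnorm1 (U a b) <= 2.
Proof.
move/unitarymxP => /matrixP /(_ a a); rewrite !mxE eqxx.
move/(congr1 (@complex.Re R)); rewrite cRe_sum /= => S1.
have E c : complex.Re (U a c * (U ^t*) c a)
    = complex.Re (U a c) ^+ 2 + complex.Im (U a c) ^+ 2.
  by rewrite !mxE cReM cReJ cImJ; ring.
move: S1; under eq_bigr do rewrite E; rewrite (bigD1 b) //=.
set S := \sum_(_ < _ | _) _ => S1.
have S0 : 0 <= S by apply: sumr_ge0 => c _; rewrite addr_ge0 // sqr_ge0.
have r2 := sqr_ge0 (complex.Re (U a b)); have i2 := sqr_ge0 (complex.Im (U a b)).
rewrite /cnorm1 (_ : 2 = 1 + 1) //; apply: lerD.
  by rewrite ler_norml; apply/andP; split; nra.
by rewrite ler_norml; apply/andP; split; nra.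
Qed.

Lemma unitary_mnorm1 n (U : 'M[C]_n) : U \is unitarymx -> mnorm1 U <= (n * n * 2)%:R.
Proof.
move=> Uu; rewrite natrM.
by apply: mnorm1_le => a b; exact: unitary_cnorm1.
Qed.

Variable n : nat.
Local Notation u := ((n * n * 2)%:R : R).

Definition conj_diag (U : 'M[C]_n) (d : 'rV[C]_n) : 'M[C]_n :=
  invmx U *m diag_mx d *m U.

Lemma conj_diagM (U : 'M[C]_n) (d e : 'rV[C]_n) : U \in unitmx ->
  conj_diag U d *m conj_diag U e = conj_diag U (\row_j (d 0 j * e 0 j)).
Proof.
move=> Uu; rewrite /conj_diag !mulmxA (mulmxK Uu) -mulmx_diag.
by rewrite -!mulmxA.
Qed.

Lemma conj_diag_derive (V : normedModType R) (x v : V) (U : 'M[C]_n) (d : V -> 'rV[C]_n) dd :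
  is_mxderive x v d dd ->
  is_mxderive x v (fun y => conj_diag U (d y)) (conj_diag U dd).
Proof.
move=> dD; apply/is_mxderiveMr/is_mxderiveMl => a b; rewrite !mxE.
case: (eqVneq a b) => [->|ab].
  rewrite mulr1n; have := dD 0 b; congr is_cderive.
  by apply/funext => y; rewrite !mxE eqxx mulr1n.
rewrite mulr0n; have := is_cderive_cst x v 0; congr is_cderive.
by apply/funext => y; rewrite !mxE (negbTE ab) mulr0n.
Qed.

Lemma conj_diag_bound (U : 'M[C]_n) (d : 'rV[C]_n) (B : R) : U \is unitarymx -> 0 <= B ->
  (forall j, cnorm1 (d 0 j) <= B) ->
  mnorm1 (conj_diag U d) <= u * ((n * n)%:R * B) * u.
Proof.
move=> Uu B0 dB; have U18 := unitary_mnorm1 Uu; have u0 := ler0n R (n * n * 2).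
have iU18 : mnorm1 (invmx U) <= u.
  by rewrite invmx_unitary //; apply: unitary_mnorm1; rewrite trmxC_unitary.
apply: le_trans (mnorm1M _ _) _; apply: ler_pM; rewrite ?mnorm1_ge0 //.
apply: le_trans (mnorm1M _ _) _; apply: ler_pM; rewrite ?mnorm1_ge0 //.
apply: mnorm1_le => a b; rewrite !mxE.
by case: (eqVneq a b) => [->|ab]; rewrite ?mulr1n ?mulr0n ?cnorm10.
Qed.

(** Eigenvalues of a normal matrix are bounded by its norm, because the
    diagonalising matrix is unitary. *)
Lemma conj_diag_coef (U : 'M[C]_n) (d : 'rV[C]_n) j : U \is unitarymx ->
  cnorm1 (d 0 j) <= u * u * mnorm1 (conj_diag U d).
Proof.
move=> Uu; have Uunit := unitarymx_unit Uu; have U18 := unitary_mnorm1 Uu; have u0 := ler0n R (n * n * 2).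
have iU18 : mnorm1 (invmx U) <= u.
  by rewrite invmx_unitary //; apply: unitary_mnorm1; rewrite trmxC_unitary.
have DE : diag_mx d = U *m conj_diag U d *m invmx U.
  by rewrite /conj_diag !mulmxA mulmxV // mul1mx mulmxK.
have -> : d 0 j = diag_mx d j j by rewrite !mxE eqxx mulr1n.
apply: le_trans (cnorm1_le_mnorm1 _ _ _) _; rewrite DE.
apply: le_trans (mnorm1M _ _) _.
apply: (@le_trans _ _ ((u * mnorm1 (conj_diag U d)) * u)).
  apply: ler_pM; rewrite ?mnorm1_ge0 //; apply: le_trans (mnorm1M _ _) _.
  by apply: ler_pM; rewrite ?mnorm1_ge0.
by rewrite mulrAC.
Qed.

(** The exponential e^(wN) of a normal matrix N, defined through the spectral
    theorem; this avoids power series of matrices. *)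
Definition mexp (N : 'M[C]_n) (w : C) : 'M[C]_n :=
  conj_diag (spectralmx N) (\row_j cexp (w * spectral_diag N 0 j)).

Lemma normal_conj_diag (N : 'M[C]_n) : N \is normalmx ->
  N = conj_diag (spectralmx N) (spectral_diag N).
Proof. by move/orthomx_spectralP. Qed.

Lemma mexp0 (N : 'M[C]_n) : mexp N 0 = 1%:M.
Proof.
rewrite /mexp /conj_diag (_ : \row_j _ = const_mx 1).
  by rewrite diag_const_mx mulmx1 mulVmx // unitarymx_unit // spectral_unitarymx.
by apply/rowP => i; rewrite !mxE mul0r cexp0.
Qed.

Lemma mexp_comm (N : 'M[C]_n) w : N \is normalmx -> N *m mexp N w = mexp N w *m N.
Proof.
move=> Nn; rewrite /mexp.
have := unitarymx_unit (spectral_unitarymx N); have := normal_conj_diag Nn.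
move: (spectralmx N) (spectral_diag N) => U d -> Uu.
apply: (etrans (conj_diagM _ _ Uu)); apply: (etrans _ (esym (conj_diagM _ _ Uu))).
apply: (congr1 (conj_diag U)).
by apply/rowP => i; rewrite !mxE mulrC.
Qed.

Lemma mexp_derive (N : 'M[C]_n) (V : normedModType R) (x v : V) (c : V -> C) dc :
  N \is normalmx -> is_cderive x v c dc ->
  is_mxderive x v (fun y => mexp N (c y)) (dc *: (N *m mexp N (c x))).
Proof.
move=> Nn cD; rewrite /mexp.
have := unitarymx_unit (spectral_unitarymx N); have := normal_conj_diag Nn.
move: (spectralmx N) (spectral_diag N) => U d -> Uu.
rewrite conj_diagM // /conj_diag scalemxAl scalemxAr -linearZ -/(conj_diag _ _).
apply: conj_diag_derive => a b; rewrite !mxE.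
have := cexp_derive (is_cderiveM cD (is_cderive_cst x v (d 0 b))).
rewrite mulr0 addr0 -mulrA; congr is_cderive.
by apply/funext => y; rewrite !mxE.
Qed.

Lemma mexp_bound (N : 'M[C]_n) (K W : R) w : N \is normalmx ->
  mnorm1 N <= K -> cnorm1 w <= W ->
  mnorm1 (mexp N w) <= u * ((n * n)%:R * (2 * expR (W * (u * u * K)))) * u.
Proof.
move=> Nn NK wW; apply: conj_diag_bound; first exact: spectral_unitarymx.
  by apply: mulr_ge0; [exact: ler0n|exact: expR_ge0].
move=> j; rewrite !mxE; apply: cnorm1_cexp; apply: le_trans (cnorm1M _ _) _.
apply: ler_pM; rewrite ?cnorm1_ge0 //.
apply: le_trans (conj_diag_coef _ _ (spectral_unitarymx N)) _.
by rewrite -normal_conj_diag // ler_wpM2l // mulr_ge0 // ler0n.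
Qed.

End MatrixExponential.

Section ExponentialContinuity.
Variable R : realType.
Local Notation C := R[i].

(** In 18 = 9 * 2, 9 is the number of entries and 2 accounts for the real and
    imaginary parts. *)
Lemma mx_mean_value (f : R -> mat3 R) (df : R -> mat3 R) (B : R) :
  (forall s : R, 0 <= s <= 1 -> is_mxderive s (1 : R) f (df s)) ->
  (forall s : R, 0 <= s <= 1 -> mnorm1 (df s) <= B) ->
  mnorm1 (f 1 - f 0) <= 18%:R * B.
Proof.
move=> fD dfB; have -> : 18%:R * B = (3 * 3)%:R * (B + B) by ring.
have E (s : R) : s *: (1 : R) + 0 = s by rewrite addr0 [LHS]mulr1.
apply: mnorm1_le => a b; rewrite !mxE /cnorm1 cReD cReN cImD cImN; apply: lerD.
  rewrite -(addr0 (1 : R)).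
  apply: (@mean_value_bound R _ (fun s => complex.Re (f s a b)) 0 1 B
      (fun s => complex.Re (df s a b))) => s s01; rewrite E.
    by have [] := fD s s01 a b.
  exact: le_trans (Re_le_mnorm1 _ _ _) (dfB s s01).
rewrite -(addr0 (1 : R)).
apply: (@mean_value_bound R _ (fun s => complex.Im (f s a b)) 0 1 B
      (fun s => complex.Im (df s a b))) => s s01; rewrite E.
  by have [] := fD s s01 a b.
exact: le_trans (Im_le_mnorm1 _ _ _) (dfB s s01).
Qed.

(** Eigenvectors need not depend continuously on the matrix, so continuity of
    [mexp] is not visible from its definition.  It follows from Duhamel's
    formula: s |-> e^(swN) e^((1 - s)wN') joins e^(wN') to e^(wN), and its
    derivative is w e^(swN) (N - N') e^((1 - s)wN'). *)
Lemma mexp_lipschitz (K : R) (w : C) : exists L : R, forall N N' : mat3 R,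
  N \is normalmx -> N' \is normalmx -> mnorm1 N <= K -> mnorm1 N' <= K ->
  mnorm1 (mexp N w - mexp N' w) <= L * mnorm1 (N - N').
Proof.
pose W := cnorm1 w; pose u := (3 * 3 * 2)%:R : R.
pose B := u * ((3 * 3)%:R * (2 * expR (W * (u * u * K)))) * u.
have W0 : 0 <= W by exact: cnorm1_ge0.
exists (18%:R * (W * (B * B))) => N N' Nn Nn' NK NK'.
(* Interpolates between the two exponentials, at s = 0 and s = 1. *)
pose f (s : R) := mexp N (s%:C * w) *m mexp N' ((1 - s)%:C * w).
pose df (s : R) := w *: (mexp N (s%:C * w) *m (N - N') *m mexp N' ((1 - s)%:C * w)).
have c1 (s : R) : is_cderive s (1 : R) (fun s => s%:C * w) w.
  have H : is_cderive s (1 : R) (fun s : R => s%:C) 1.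
    by split; [exact: is_derive_id|exact: is_derive_cst].
  by have := is_cderiveM H (is_cderive_cst s (1 : R) w); rewrite mulr0 addr0 mul1r.
have c2 (s : R) : is_cderive s (1 : R) (fun s => (1 - s)%:C * w) (- w).
  have := is_cderiveD (is_cderive_cst s (1 : R) w)
    (is_cderiveM (is_cderive_cst s (1 : R) (-1)) (c1 s)).
  rewrite mul0r !add0r mulN1r; congr is_cderive; apply/funext => x.
  by rewrite rmorphB rmorph1 mulrBl mul1r mulN1r.
have fD (s : R) : is_mxderive s (1 : R) f (df s).
  have := is_mxderiveM (mexp_derive Nn (c1 s)) (mexp_derive Nn' (c2 s)).
  congr is_mxderive; rewrite mexp_comm // -scalemxAl -scalemxAr scaleNr -scalerBr.
  by rewrite /df mulmxBr mulmxBl !mulmxA.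
have B1 (s : R) : 0 <= s <= 1 -> cnorm1 (s%:C * w) <= W.
  move=> /andP[s0 s1]; apply: le_trans (cnorm1M _ _) _.
  rewrite /cnorm1 /= normr0 addr0 ger0_norm // ler_piMl //.
have bnd (s : R) : 0 <= s <= 1 -> mnorm1 (df s) <= W * (B * B) * mnorm1 (N - N').
  move=> s01; apply: le_trans (mnorm1Z _ _) _.
  rewrite -mulrA ler_wpM2l //; apply: le_trans (mnorm1M _ _) _.
  rewrite mulrAC; apply: ler_pM; rewrite ?mnorm1_ge0 //.
    apply: le_trans (mnorm1M _ _) _; apply: ler_pM; rewrite ?mnorm1_ge0 //.
    by apply: mexp_bound => //; exact: B1.
  apply: mexp_bound => //; apply: B1; move: s01 => /andP[s0 s1].
  by apply/andP; split; lra.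
have := mx_mean_value (fun s _ => fD s) bnd.
have f1 : f 1 = mexp N w by rewrite /f subrr rmorph0 mul0r rmorph1 mul1r mexp0 mulmx1.
have f0 : f 0 = mexp N' w by rewrite /f subr0 rmorph0 mul0r rmorph1 mul1r mexp0 mul1mx.
by rewrite f1 f0 mulrA.
Qed.

Lemma ctsloop_mexp (N : loop R) (w : C) : ctsloop N ->
  (forall l, `|l| = 1 -> N l \is normalmx) -> ctsloop (fun l => mexp (N l) w).
Proof.
move=> Nc Nn; have [K NK] := ctsloop_bounded Nc.
have [L NL] := mexp_lipschitz K w.
have key (t s : R) : mnorm1 (mexp (N (expi t)) w - mexp (N (expi s)) w)
    <= L * mnorm1 (N (expi t) - N (expi s)).
  by apply: NL; rewrite ?Nn ?NK ?norm_expi.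
have d0 (t : R) : (fun s => L * mnorm1 (N (expi t) - N (expi s))) @ t --> (0 : R).
  have -> : 0 = L * mnorm1 (N (expi t) - N (expi t)) by rewrite subrr mnorm10 mulr0.
  apply: cvgM; first exact: cvg_cst.
  apply: continuous_mnorm1 => a b.
  have := ccontD (ccont_cst (N (expi t) a b)) (ccontM (ccont_cst (-1)) (Nc a b)).
  by congr ccont; apply/funext => s; rewrite !mxE mulN1r.
move=> a b; split=> t; apply/cvgrPdist_le => e e0.
  have /cvgrPdist_le /(_ e e0) := d0 t; apply: filterS => s.
  rewrite sub0r normrN => H; apply: le_trans (le_trans (ler_norm _) H).
  apply: le_trans (key t s); rewrite -cReN -cReD.
  by have := Re_le_mnorm1 (mexp (N (expi t)) w - mexp (N (expi s)) w) a b; rewrite !mxE.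
have /cvgrPdist_le /(_ e e0) := d0 t; apply: filterS => s.
rewrite sub0r normrN => H; apply: le_trans (le_trans (ler_norm _) H).
apply: le_trans (key t s); rewrite -cImN -cImD.
by have := Im_le_mnorm1 (mexp (N (expi t)) w - mexp (N (expi s)) w) a b; rewrite !mxE.
Qed.

End ExponentialContinuity.

(** * Two by two matrices, the twist, and the projection on su(2) *)

Section TwoByTwo.
Variable R : realType.
Local Notation C := R[i].

Lemma cJD (x y : C) : Num.conj (x + y) = Num.conj x + Num.conj y.
Proof. by apply: ReIm_eq; rewrite ?(cReJ, cReD, cImJ, cImD) ?opprD. Qed.
Lemma cJN (x : C) : Num.conj (- x) = - Num.conj x.
Proof. by apply: ReIm_eq; rewrite ?(cReJ, cReN, cImJ, cImN). Qed.
Lemma cJB (x y : C) : Num.conj (x - y) = Num.conj x - Num.conj y.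
Proof. by rewrite cJD cJN. Qed.
Lemma cJM (x y : C) : Num.conj (x * y) = Num.conj x * Num.conj y.
Proof. by apply: ReIm_eq; rewrite ?(cReJ, cReM, cImJ, cImM); ring. Qed.
Lemma cJ0 : Num.conj (0 : C) = 0.
Proof. by apply: ReIm_eq; rewrite ?(cReJ, cImJ) /= ?oppr0. Qed.

Lemma ord2P (i : 'I_2) : i = 0 \/ i = 1.
Proof. by case: i => [[|[|//]] ?]; [left|right]; apply: val_inj. Qed.

Lemma mx2P (A B : 'M[C]_2) : A 0 0 = B 0 0 -> A 0 1 = B 0 1 ->
  A 1 0 = B 1 0 -> A 1 1 = B 1 1 -> A = B.
Proof.
move=> e00 e01 e10 e11; apply/matrixP => i j.
by have [->|->] := ord2P i; have [->|->] := ord2P j.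
Qed.

Lemma sum2E (f : 'I_2 -> C) : \sum_i f i = f 0 + f 1.
Proof.
rewrite big_ord_recl big_ord_recl big_ord0 addr0; congr (_ + f _).
exact: val_inj.
Qed.

Lemma mul2E (A B : 'M[C]_2) i j : (A *m B) i j = A i 0 * B 0 j + A i 1 * B 1 j.
Proof. by rewrite mxE sum2E. Qed.

Lemma tr2E (A : 'M[C]_2) : \tr A = A 0 0 + A 1 1.
Proof. by rewrite /mxtrace sum2E. Qed.

Definition mx2 (a b c d : C) : 'M[C]_2 :=
  \matrix_(i, j) if i == 0 then (if j == 0 then a else b) else (if j == 0 then c else d).

Lemma mx2E a b c d : (mx2 a b c d 0 0 = a) * (mx2 a b c d 0 1 = b) *
  (mx2 a b c d 1 0 = c) * (mx2 a b c d 1 1 = d).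
Proof. by rewrite !mxE. Qed.

Lemma JE : (J R 0 0 = 0) * (J R 0 1 = -1) * (J R 1 0 = 1) * (J R 1 1 = 0).
Proof. by rewrite !mxE. Qed.

(** In dimension two, conjugating the transpose by J gives the adjugate up to
    sign; the fixed points of the twist on the block are thus the traceless
    matrices. *)
Lemma J_conj_tr (a : 'M[C]_2) : J R *m a^T *m J R = a - (\tr a)%:M.
Proof.
by apply: mx2P; rewrite !mul2E !JE !mxE tr2E /=; ring.
Qed.

Lemma JJ : J R *m J R = - 1%:M.
Proof. by apply: mx2P; rewrite mul2E !JE !mxE /=; ring. Qed.

Lemma JTJ : J R *m (J R)^T = 1%:M.
Proof. by apply: mx2P; rewrite mul2E !JE !mxE /=; ring. Qed.

(** A skew-Hermitian matrix which is lower triangular with real diagonal is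
    zero. *)
Lemma su_proj_unique (M S : 'M[C]_2) : in_su2 S -> in_b (M - S) -> su_proj M = S.
Proof.
move=> [S1 S2] [B1 B2 B3]; apply: xget_unique => // S' [[S1' S2'] [B1' B2' B3']].
pose D := S' - S.
have Dskew i j : Num.conj (D j i) = - D i j.
  have := S1' ; have := S1 => /matrixP /(_ i j) e /matrixP /(_ i j) e'.
  by move: e e'; rewrite /D !mxE cJB => -> ->; rewrite opprB opprK addrC.
have tri (X : 'M[C]_2) : is_trig_mx X -> X 0 1 = 0 by move/is_trig_mxP; apply.
have D01 : D 0 1 = 0.
  have := tri _ B1; have := tri _ B1'; rewrite !mxE => /eqP; rewrite subr_eq0 => /eqP <-.
  by move/eqP; rewrite subr_eq0 => /eqP ->; rewrite subrr.
have D10 : D 1 0 = 0.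
  by apply/eqP; rewrite -oppr_eq0 -Dskew D01 cJ0.
have Dkk k : D k k = 0.
  have Dr : D k k \is Num.real.
    have -> : D k k = (M - S) k k - (M - S') k k.
      by rewrite /D !mxE opprD opprK addrACA subrr add0r addrC.
    by rewrite rpredB.
  have := Dskew k k; rewrite (CrealP Dr) => /eqP.
  by rewrite -addr_eq0 -mulr2n mulrn_eq0 /= => /eqP.
apply/eqP; rewrite -subr_eq0; apply/eqP; apply: mx2P; rewrite -/D ?mxE //.
- by rewrite -[RHS](Dkk 0) /D !mxE.
- by rewrite -[RHS]D01 /D !mxE.
- by rewrite -[RHS]D10 /D !mxE.
- by rewrite -[RHS](Dkk 1) /D !mxE.
Qed.

(** An explicit formula for the su(2)-part of a traceless matrix, read off from
    its first row, which elements of b meet only in a real diagonal entry. *)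
Definition su_part (M : 'M[C]_2) : 'M[C]_2 :=
  mx2 (0 +i* complex.Im (M 0 0)) (M 0 1) (- Num.conj (M 0 1)) (0 +i* (- complex.Im (M 0 0))).

Lemma su_part_su2 M : in_su2 (su_part M).
Proof.
split; last by rewrite tr2E !mx2E; apply: ReIm_eq; rewrite ?cReD ?cImD /= ?addr0 ?subrr.
apply: mx2P; rewrite [LHS]mxE [X in Num.conj X]mxE [RHS]mxE !mx2E.
- by apply: ReIm_eq; rewrite ?(cReJ, cImJ, cReN, cImN) /= ?oppr0.
- by rewrite cJN conjCK.
- by rewrite opprK.
- by apply: ReIm_eq; rewrite ?(cReJ, cImJ, cReN, cImN) /= ?oppr0.
Qed.

Lemma su_part_b M : \tr M = 0 -> in_b (M - su_part M).
Proof.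
rewrite tr2E => M0; have M11 : M 1 1 = - M 0 0 by apply/eqP; rewrite -addr_eq0 addrC M0.
split.
- apply/is_trig_mxP => i j ij.
  have [i0|i1] := ord2P i; have [j0|j1] := ord2P j; move: ij; subst i j => //= _.
  by rewrite [LHS]mxE [X in _ + X]mxE mx2E subrr.
- have [_ S0] := su_part_su2 M.
  by rewrite raddfB /= S0 subr0 tr2E.
- move=> k; apply/CrealP.
  have [->|->] := ord2P k; rewrite [(M - _) _ _]mxE [X in _ + X]mxE mx2E ?M11;
  by apply: ReIm_eq; rewrite ?(cReJ, cImJ, cReD, cImD, cReN, cImN) /=; ring.
Qed.

Lemma su_projE M : \tr M = 0 -> su_proj M = su_part M.
Proof. by move=> M0; apply: su_proj_unique; [exact: su_part_su2|exact: su_part_b]. Qed.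

End TwoByTwo.

Section Blocks.
Variable R : realType.
Local Notation C := R[i].

Definition blk (m : 'M[C]_2) (d : C) : mat3 R := (block_mx m 0 0 d%:M : 'M[C]_(2 + 1)).

Lemma blkM m m' d d' : blk m d *m blk m' d' = blk (m *m m') (d * d').
Proof.
apply: (etrans (@mulmx_block C 2 1 2 1 2 1 m 0 0 d%:M m' 0 0 d'%:M)).
by rewrite /blk !mulmx0 !mul0mx !addr0 !add0r -scalar_mxM.
Qed.

Lemma blk1 : blk 1%:M 1 = 1%:M.
Proof. exact: (esym (@scalar_mx_block C 2 1 1)). Qed.

Lemma blkD m m' d d' : blk m d + blk m' d' = blk (m + m') (d + d').
Proof.
apply: (etrans (@add_block_mx C 2 1 2 1 m 0 0 d%:M m' 0 0 d'%:M)).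
by rewrite /blk !addr0 raddfD.
Qed.

Lemma blkN m d : - blk m d = blk (- m) (- d).
Proof.
apply: (etrans (@opp_block_mx C 2 1 2 1 m 0 0 d%:M)).
by rewrite /blk !oppr0 raddfN.
Qed.

Lemma blkZ c m d : c *: blk m d = blk (c *: m) (c * d).
Proof.
apply: (etrans (@scale_block_mx C 2 1 2 1 c m 0 0 d%:M)).
by rewrite /blk !scaler0 scale_scalar_mx.
Qed.

Lemma blkT m d : (blk m d)^T = blk m^T d.
Proof.
apply: (etrans (@tr_block_mx C 2 1 2 1 m 0 0 d%:M)).
by rewrite /blk !trmx0 tr_scalar_mx.
Qed.

Lemma blk_ctrans m d : (blk m d) ^t* = blk (m ^t*) (Num.conj d).
Proof.
rewrite blkT; apply: (etrans (@map_block_mx _ _ Num.conj 2 1 2 1 m^T 0 0 d%:M)).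
by rewrite /blk !map_mx0 map_scalar_mx.
Qed.

Lemma ul_blk m d : ulsubmx (blk m d : 'M[C]_(2 + 1)) = m.
Proof. exact: (@block_mxKul C 2 1 2 1 m 0 0 d%:M). Qed.

Lemma blk_inj m m' d d' : blk m d = blk m' d' -> m = m'.
Proof. by move/(congr1 (fun X : 'M[C]_(2 + 1) => ulsubmx X)); rewrite !ul_blk. Qed.

Lemma diagJ1E : diagJ1 R = blk (J R) 1.
Proof. by []. Qed.

Lemma diagNJ1E : diagNJ1 R = blk (- J R) 1.
Proof. by []. Qed.

Lemma diag110E a : diag110 (R := R) a = blk a%:M 0.
Proof. by rewrite /blk raddf0. Qed.

Lemma su_proj3_blk m d : su_proj3 (blk m d) = blk (su_proj m) 0.
Proof. by rewrite /su_proj3 ul_blk /blk raddf0. Qed.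

Lemma diagPQ : diagNJ1 R *m diagJ1 R = 1%:M.
Proof. by rewrite diagJ1E diagNJ1E blkM mulNmx JJ opprK mulr1 blk1. Qed.

Lemma diagQP : diagJ1 R *m diagNJ1 R = 1%:M.
Proof. by rewrite diagJ1E diagNJ1E blkM mulmxN JJ opprK mulr1 blk1. Qed.

Lemma tau_alg_blk m : tau_alg (blk m 0) = blk (m - (\tr m)%:M) 0.
Proof.
rewrite /tau_alg diagJ1E diagNJ1E blkT !blkM blkN mulNmx mulNmx opprK J_conj_tr.
by rewrite mulr0 mul0r oppr0.
Qed.

Lemma u3_0C_blk m : \tr m = 0 -> in_u3_0C (blk m 0).
Proof. by move=> m0; rewrite /in_u3_0C tau_alg_blk m0 raddf0 subr0. Qed.

(** The off-diagonal blocks b and c of a fixed point satisfy b = J c^T and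
    c = - b^T J, so that b = - b; the last diagonal entry is its own opposite. *)
Lemma u3_0CP (M : mat3 R) : in_u3_0C M -> exists2 m, M = blk m 0 & \tr m = 0.
Proof.
rewrite /in_u3_0C => MM.
pose M' : 'M[C]_(2 + 1) := M.
pose a := ulsubmx M'; pose b := ursubmx M'; pose c := dlsubmx M'; pose d := drsubmx M'.
have ME : M = (block_mx a b c d : 'M[C]_(2 + 1)) by rewrite submxK.
have tE : tau_alg M = (block_mx (a - (\tr a)%:M) (J R *m c^T) (- (b^T *m J R)) (- d^T) : 'M[C]_(2 + 1)).
  rewrite /tau_alg ME.
  have -> : (block_mx a b c d : 'M[C]_(2+1))^T = (block_mx a^T c^T b^T d^T : 'M[C]_(2 + 1)).
    exact: (@tr_block_mx C 2 1 2 1).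
  have -> : diagNJ1 R *m (block_mx a^T c^T b^T d^T : 'M[C]_(2 + 1)) *m diagJ1 R
    = (block_mx (- J R *m a^T *m J R) (- J R *m c^T) (b^T *m J R) d^T : 'M[C]_(2 + 1)).
    apply: (etrans (congr1 (mulmx^~ _) (@mulmx_block C 2 1 2 1 2 1 (- J R) 0 0 1%:M _ _ _ _))).
    apply: (etrans (@mulmx_block C 2 1 2 1 2 1 _ _ _ _ (J R) 0 0 1%:M)).
    by rewrite !mulmx0 !mul0mx !addr0 !add0r !mulmx1 !mul1mx.
  apply: (etrans (@opp_block_mx C 2 1 2 1 _ _ _ _)).
  by rewrite !mulNmx !opprK J_conj_tr.
have [ea eb ec ed] : [/\ a - (\tr a)%:M = a, J R *m c^T = b, - (b^T *m J R) = c & - d^T = d].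
  by apply: (@eq_block_mx C 2 1 2 1); rewrite -ME -tE MM.
have b0 : b = 0.
  have : b = - b by rewrite -{1}eb -ec linearN /= mulmxN trmx_mul trmxK mulmxA JTJ mul1mx.
  move/eqP; rewrite -addr_eq0 -mulr2n -scaler_nat scaler_eq0 => /orP[|/eqP //].
  by rewrite pnatr_eq0.
have c0 : c = 0 by rewrite -ec b0 trmx0 mul0mx oppr0.
have d0 : d = 0.
  have : d = - d by rewrite -{1}ed; congr (- _); apply/matrixP => i j; rewrite mxE !ord1.
  move/eqP; rewrite -addr_eq0 -mulr2n -scaler_nat scaler_eq0 => /orP[|/eqP //].
  by rewrite pnatr_eq0.
exists a; first by rewrite ME b0 c0 d0 /blk raddf0.
move/matrixP: ea => /(_ 0 0); rewrite !mxE eqxx mulr1n => /eqP.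
by rewrite -subr_eq0 addrAC subrr add0r oppr_eq0 => /eqP.
Qed.

Lemma invmx_mul n (A B : 'M[C]_n) : A \in unitmx -> B \in unitmx ->
  invmx (A *m B) = invmx B *m invmx A.
Proof.
move=> Au Bu; have ABu : A *m B \in unitmx by rewrite unitmx_mul Au.
rewrite -[RHS]mul1mx -(mulVmx ABu) -!mulmxA.
by rewrite (mulmxA B) (mulmxV Bu) mul1mx (mulmxV Au) mulmx1.
Qed.

Lemma tau_grpM (A B : mat3 R) : A \in unitmx -> B \in unitmx ->
  tau_grp (A *m B) = tau_grp A *m tau_grp B.
Proof.
move=> Au Bu; rewrite /tau_grp invmx_mul // trmx_mul.
rewrite -[X in _ = X]mulmxA [X in _ = _ *m X]mulmxA [X in _ = _ *m (X *m _)]mulmxA.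
by rewrite [X in _ = _ *m (X *m _ *m _)]diagQP mul1mx !mulmxA.
Qed.

End Blocks.

Section GaugeTwoByTwo.
Variable R : realType.
Local Notation C := R[i].

Lemma ctransM m n p (A : 'M[C]_(m, n)) (B : 'M[C]_(n, p)) :
  (A *m B) ^t* = B ^t* *m A ^t*.
Proof. by rewrite trmx_mul map_mxM. Qed.

Lemma ctransD m n (A B : 'M[C]_(m, n)) : (A + B) ^t* = A ^t* + B ^t*.
Proof. by apply/matrixP => i j; rewrite [LHS]mxE [X in Num.conj X]mxE mxE cJD !mxE. Qed.

Lemma ctransN m n (A : 'M[C]_(m, n)) : (- A) ^t* = - A ^t*.
Proof. by apply/matrixP => i j; rewrite [LHS]mxE [X in Num.conj X]mxE mxE cJN !mxE. Qed.

Lemma ctransZ m n c (A : 'M[C]_(m, n)) : (c *: A) ^t* = Num.conj c *: A ^t*.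
Proof. by apply/matrixP => i j; rewrite [LHS]mxE [X in Num.conj X]mxE mxE cJM !mxE. Qed.

Lemma ctransK m n (A : 'M[C]_(m, n)) : (A ^t*) ^t* = A.
Proof. by apply/matrixP => i j; rewrite !mxE conjCK. Qed.

(** The adjoint of the element of SU(2) with first row (u, w) when this row has
    norm one. *)
Definition gmx (u w : C) : 'M[C]_2 := mx2 (Num.conj u) (- w) (Num.conj w) u.

Lemma gmx_ctrans u w : (gmx u w) ^t* = mx2 u w (- Num.conj w) (Num.conj u).
Proof.
by apply: mx2P; rewrite [LHS]mxE [X in Num.conj X]mxE /gmx !mx2E ?cJN ?conjCK.
Qed.

Lemma gmx_unitary u w : u * Num.conj u + w * Num.conj w = 1 ->
  (gmx u w) ^t* *m gmx u w = 1%:M.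
Proof.
rewrite gmx_ctrans /gmx; move: (Num.conj u) (Num.conj w) => u' w' uw.
apply: mx2P; rewrite mul2E [RHS]mxE !mx2E /= ?mulr1n ?mulr0n.
- exact: uw.
- by ring.
- by ring.
- by rewrite -uw; ring.
Qed.

Lemma gmx_unitary_r u w : u * Num.conj u + w * Num.conj w = 1 ->
  gmx u w *m (gmx u w) ^t* = 1%:M.
Proof. by move=> /gmx_unitary; exact: mulmx1C. Qed.

Lemma gmx_J u w : - J R *m ((gmx u w) ^t*)^T *m J R = gmx u w.
Proof.
rewrite mulNmx mulNmx J_conj_tr gmx_ctrans tr2E !mx2E.
by apply: mx2P; rewrite !mxE /=; ring.
Qed.

Lemma su2_conj (g A : 'M[C]_2) : g *m g ^t* = 1%:M -> in_su2 A -> in_su2 (g ^t* *m A *m g).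
Proof.
move=> gg [A1 A2]; split; first by rewrite !ctransM ctransK A1 mulNmx mulmxN mulmxA.
by rewrite -(mulmxA (g ^t*) A g) (mxtrace_mulC (g ^t*)) -(mulmxA A g) gg mulmx1.
Qed.

Lemma su2D (A B : 'M[C]_2) : in_su2 A -> in_su2 B -> in_su2 (A + B).
Proof.
move=> [A1 A2] [B1 B2]; split; first by rewrite ctransD A1 B1 opprD.
by rewrite raddfD /= A2 B2 addr0.
Qed.

Lemma su2N (A : 'M[C]_2) : in_su2 A -> in_su2 (- A).
Proof. by move=> [A1 A2]; split; rewrite ?ctransN ?A1 // raddfN /= A2 oppr0. Qed.

Section Gauge.
Variables (u w du dw c : C) (X b : 'M[C]_2).
Hypothesis uw1 : u * Num.conj u + w * Num.conj w = 1.
Hypothesis duw : du * Num.conj u + u * Num.conj du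
  + (dw * Num.conj w + w * Num.conj dw) = 0.
Hypothesis c_real : Num.conj c = c.
Hypothesis trX : \tr X = 0.
Hypothesis b_su2 : in_su2 b.
Let th := su_proj X - b - X.
Hypothesis duE : du = u * th 0 0 + w * th 1 0 + c * u.
Hypothesis dwE : dw = u * th 0 1 + w * th 1 1 + c * w.
Let g := gmx u w.
Let dg := gmx du dw.

Let X_su2 : in_su2 (su_proj X).
Proof. by rewrite su_projE //; exact: su_part_su2. Qed.

(** Differentiating |u|^2 + |w|^2 = 1 along g. *)
Lemma gauge_form_su2 : in_su2 (g ^t* *m dg).
Proof.
rewrite /g /dg; split; last by rewrite gmx_ctrans tr2E !mul2E /gmx !mx2E -[RHS]duw; ring.
rewrite ctransM ctransK !gmx_ctrans /gmx; move: duw.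
move: (Num.conj u) (Num.conj w) (Num.conj du) (Num.conj dw) => u' w' du' dw' e.
apply/eqP; rewrite -addr_eq0; apply/eqP.
apply: mx2P; rewrite mxE !mul2E [RHS]mxE !mx2E; first [by ring | by rewrite -e; ring].
Qed.

(** The gauged form g^* th g + g^* dg is lower triangular because the first row
    (u, w) of g^* satisfies (u, w) th = d(u, w) - c (u, w).  The (0, 1) entry pairs
    this with the second column (- w, u) of g: the multiple of (u, w) contributes
    nothing and the rest cancels against g^* dg.  The (0, 0) entry is - c, which
    is real.  The remaining diagonal entry follows from the trace. *)
Lemma gauge_form_b : in_b (- (g ^t* *m th *m g + g ^t* *m dg)).
Proof.
have trth : th 1 1 = - th 0 0.
  have [_ t1] := X_su2; have [_ t2] := b_su2.
  have : \tr th = 0 by rewrite /th !raddfB /= t1 t2 trX !subr0.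
  by rewrite tr2E => /eqP; rewrite addr_eq0 => /eqP ->; rewrite opprK.
set N := _ + _.
have E0 : u * th 0 0 + w * th 1 0 = du - c * u by rewrite duE; ring.
have E1 : u * th 0 1 + w * th 1 1 = dw - c * w by rewrite dwE; ring.
have N00 : N 0 0 = - c.
  rewrite /N /g /dg gmx_ctrans mxE !mul2E /gmx !mx2E.
  rewrite E0 E1 -[RHS]addr0 -duw -[c in RHS]mulr1 -uw1; ring.
have N01 : N 0 1 = 0.
  by rewrite /N /g /dg gmx_ctrans mxE !mul2E /gmx !mx2E E0 E1; ring.
have N11 : N 1 1 = c.
  have : \tr N = 0.
    have [_ t1] := gauge_form_su2; rewrite /N raddfD /= t1 addr0.
    rewrite -mulmxA mxtrace_mulC -mulmxA gmx_unitary_r // mulmx1 tr2E trth.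
    by rewrite subrr.
  by rewrite tr2E N00 => /eqP; rewrite addrC subr_eq0 => /eqP.
split.
- apply/is_trig_mxP => i j ij.
  have [i0|i1] := ord2P i; have [j0|j1] := ord2P j; move: ij; subst i j => //= _.
  by rewrite mxE N01 oppr0.
- by rewrite raddfN /= tr2E N00 N11 addNr oppr0.
- move=> k; apply/CrealP.
  by have [->|->] := ord2P k; rewrite mxE ?N00 ?N11 !cJN c_real.
Qed.

(** The right hand side lies in su(2), and by [gauge_form_b] its difference with
    g^* X g lies in b; uniqueness of the decomposition concludes. *)
Lemma gauge_su_proj :
  su_proj (g ^t* *m X *m g) = g ^t* *m (su_proj X - b) *m g + g ^t* *m dg.
Proof.
have gg := gmx_unitary_r uw1.
apply: su_proj_unique.
  apply: su2D gauge_form_su2; apply: su2_conj gg _.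
  by apply: su2D => //; exact: su2N.
have := gauge_form_b; congr in_b.
rewrite /th (mulmxBr _ _ X) mulmxBl.
by rewrite [in LHS]opprD opprB [in RHS]opprD addrA.
Qed.

End Gauge.
End GaugeTwoByTwo.

(** * Derivatives in the plane *)

Section DirectionalDerivatives.
Variables (R : realType) (V : normedModType R).

Lemma is_derive_dirZ (f : V -> R) (x v : V) (c d : R) :
  is_derive x v f d -> is_derive x (c *: v) f (c * d).
Proof.
move=> fD.
have H : is_derive (c * 0) (1 : R) (fun u => f (u *: v + x)) d.
  by rewrite mulr0; have := (is_derive_line f x v 0 d).1; rewrite scale0r add0r; apply.
have := is_derive_line f x (c *: v) 0 (c * d).
rewrite scale0r add0r => ->; rewrite mulrC.
have := is_derive_scale H; congr is_derive.
by apply/funext => u; rewrite scalerA mulrC.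
Qed.

End DirectionalDerivatives.

Section DerivativeSum.
Variables (R : realType) (V : normedModType R).

(** Partial derivatives add up when one of them is continuous: the increment in
    the direction w, taken from the moved point x + hv, is controlled by the mean
    value theorem. *)
Lemma is_derive_dirD (U : set V) (f : V -> R) (x v w : V) (d : R) (dw : V -> R) :
  open U -> U x -> (forall y, U y -> is_derive y w f (dw y)) ->
  {for x, continuous dw} -> is_derive x v f d ->
  is_derive x (v + w) f (d + dw x).
Proof.
move=> oU Ux fw dwc fv.
pose q (u : V) (h : R) := h^-1 *: ((f \o shift x) (h *: u) - f x).
have qv : q v @ 0^' --> d.
  by have [fd <-] := fv; exact: fd.
have qw : (fun h : R => h^-1 *: (f (h *: w + (h *: v + x)) - f (h *: v + x))) @ 0^' --> dw x.
  apply/cvgrPdist_le => e e0.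
  have /nbhs_ballP[r /= r0 rP] : \forall y \near x, U y /\ `|dw x - dw y| <= e.
    near=> y; split; near: y; first exact: open_nbhs_nbhs.
    by move/cvgrPdist_le: dwc => /(_ e e0).
  pose M := `|v| + `|w| + 1.
  have M0 : 0 < M by rewrite ltr_wpDl // addr_ge0.
  have hr0 : 0 < r / M by rewrite divr_gt0.
  near=> h.
  have h0 : h != 0 by near: h; exact: nbhs_dnbhs_neq.
  have hM : `|h| < r / M.
    near: h; apply: dnbhs0_lt; exact: hr0.
  have inb (s : R) : 0 <= s <= 1 -> ball x r ((s * h) *: w + (h *: v + x)).
    move=> /andP[s0 s1]; rewrite -ball_normE /ball_ /=.
    have -> : x - ((s * h) *: w + (h *: v + x)) = - ((s * h) *: w + h *: v).
      by rewrite addrA opprD addrCA subrr addr0.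
    rewrite normrN; apply: le_lt_trans (ler_normD _ _) _.
    rewrite !normrZ (ger0_norm s0).
    apply: (@le_lt_trans _ _ (`|h| * (`|v| + `|w|))).
      rewrite mulrDr addrC lerD2l ler_wpM2r // ler_piMl //.
    apply: (@le_lt_trans _ _ (`|h| * M)).
      by rewrite ler_wpM2l // /M lerDl.
    by rewrite -ltr_pdivlMr.
  pose phi (u : R) := f (u *: w + (h *: v + x)) - u * dw x.
  have phiD (s : R) : 0 <= s <= 1 -> is_derive (s *: h + 0) h phi
      (h * (dw ((s *: h + 0) *: w + (h *: v + x)) - dw x)).
    move=> s01; rewrite addr0.
    have H : is_derive (s *: h) (1 : R) phi (dw ((s *: h) *: w + (h *: v + x)) - dw x).
      apply: is_deriveB.
        apply/(is_derive_line f); apply: fw.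
        by have [] := rP _ (inb s s01).
      have := is_derive_scale (is_derive_id (dw x * (s *: h)) (1 : R)).
      by rewrite mul1r; congr is_derive; apply/funext => u; exact: mulrC.
    by have := is_derive_dirZ h H; rewrite [h *: (1 : R)]mulr1.
  have phiB (s : R) : 0 <= s <= 1 ->
      `|h * (dw ((s *: h + 0) *: w + (h *: v + x)) - dw x)| <= `|h| * e.
    move=> s01; rewrite normrM ler_wpM2l // addr0 distrC.
    by have [] := rP _ (inb s s01).
  have := @mean_value_bound R _ phi 0 h (`|h| * e)
    (fun u => h * (dw (u *: w + (h *: v + x)) - dw x)) phiD phiB.
  rewrite addr0 /phi scale0r add0r mul0r subr0 => H.
  have hh : 0 < `|h| by rewrite normr_gt0.
  rewrite -(ler_pM2l hh) -normrM; apply: le_trans H.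
  rewrite -[X in _ <= X]normrN le_eqVlt; apply/orP; left; apply/eqP; congr (`|_|).
  by rewrite mulrBr [h^-1 *: _]/(h^-1 * _) mulrA divff // mul1r; ring.
have E : (fun h : R => h^-1 *: ((f \o shift x) (h *: (v + w)) - f x)) =
  (fun h => q v h + h^-1 *: (f (h *: w + (h *: v + x)) - f (h *: v + x))).
  apply/funext => h; rewrite /q /= -scalerDr; congr (_ *: _).
  by rewrite [RHS]addrC subrKA scalerDr [h *: v + h *: w]addrC -addrA.
have H : (fun h : R => h^-1 *: ((f \o shift x) (h *: (v + w)) - f x)) @ 0^' --> d + dw x.
  by rewrite E; apply: cvgD.
constructor; first by apply/cvg_ex; exists (d + dw x).
exact: cvg_lim H.
Unshelve. all: by end_near. Qed.

Lemma continuous_bounded_derive (f : V -> R) (df : V -> V -> R) (x : V) (r C : R) :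
  0 < r -> (forall y v, ball x r y -> is_derive y v f (df y v)) ->
  (forall y v, ball x r y -> `|df y v| <= C * `|v|) -> {for x, continuous f}.
Proof.
move=> r0 fD dfC; apply/cvgrPdist_le => e e0.
pose C' := `|C| + 1.
have C'0 : 0 < C' by rewrite ltr_wpDl.
near=> y.
have yr : ball x r y by near: y; exact: nbhsx_ballx.
have ye : ball x (e / C') y by near: y; apply: nbhsx_ballx; rewrite divr_gt0.
rewrite distrC -{1}[y](subrK x).
apply: le_trans (_ : C * `|y - x| <= _); last first.
  move: ye; rewrite -ball_normE /ball_ /= distrC ltr_pdivlMr // => /ltW ye.
  apply: le_trans ye; rewrite mulrC ler_wpM2l // (le_trans (ler_norm C)) //.
  by rewrite /C' lerDl.
apply: (@mean_value_bound _ _ _ _ _ _ (fun z => df z (y - x))) => s s01.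
  by apply: fD; apply: ball_segment => //; exact: ballxx.
by apply: dfC; apply: ball_segment => //; exact: ballxx.
Unshelve. all: by end_near. Qed.

End DerivativeSum.

Section PlaneDerivatives.
Variable R : realType.
Local Notation C := R[i].

(** The contraction of the form w with the tangent vector v; identities between
    forms become identities between derivatives in all directions. *)
Definition ev (w : mform R) (v : plane R) : mat3 R := v.1%:C *: w.1 + v.2%:C *: w.2.

(** The complex number dz(v). *)
Definition vc (v : plane R) : C := v.1 +i* v.2.

Lemma cRe_realM (x : R) (c : C) : complex.Re (x%:C * c) = x * complex.Re c.
Proof. by rewrite cReM /= mul0r subr0. Qed.

Lemma cIm_realM (x : R) (c : C) : complex.Im (x%:C * c) = x * complex.Im c.
Proof. by rewrite cImM /= mul0r addr0. Qed.

Lemma mxderiveE (f : plane R -> mat3 R) z v a b : mxderive f z v a b =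
  'D_v (fun y => complex.Re (f y a b)) z +i* 'D_v (fun y => complex.Im (f y a b)) z.
Proof. by rewrite mxE. Qed.

Lemma evE w v a b : ev w v a b = v.1%:C * w.1 a b + v.2%:C * w.2 a b.
Proof. by rewrite mxE [X in X + _]mxE [X in _ + X]mxE. Qed.

(** Smoothness as defined here only asserts the existence of directional
    derivatives; this lemma supplies their linearity in the direction. *)
Lemma smooth_derive_plane (U : set (plane R)) (f : plane R -> R) z v :
  open U -> smooth U f -> U z ->
  is_derive z v f (v.1 * 'D_((1, 0) : plane R) f z + v.2 * 'D_((0, 1) : plane R) f z).
Proof.
move=> oU fs Uz.
have D1 y : U y -> is_derive y ((v.1 *: (1, 0)) : plane R) f (v.1 * 'D_((1, 0) : plane R) f y).
  by move=> Uy; apply: is_derive_dirZ; exact: smooth_derive.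
have D2 y : U y -> is_derive y ((v.2 *: (0, 1)) : plane R) f (v.2 * 'D_((0, 1) : plane R) f y).
  by move=> Uy; apply: is_derive_dirZ; exact: smooth_derive.
have vE : v = (v.1 *: (1, 0) : plane R) + (v.2 *: (0, 1) : plane R).
  case: (v) => a b; transitivity ((a * 1 + b * 0, a * 0 + b * 1) : plane R) => //=.
  by rewrite !mulr1 !mulr0 addr0 add0r.
rewrite {1}vE; apply: (is_derive_dirD oU Uz D2 _ (D1 z Uz)).
apply: cvgM; first exact: cvg_cst.
exact: (smooth_continuous (smooth_deriveS ((0, 1) : plane R) fs) Uz).
Qed.

Lemma mxsmooth_derive_plane (U : set (plane R)) (f : plane R -> mat3 R) z v :
  open U -> mxsmooth U f -> U z -> is_mxderive z v f (ev (ext_d f z) v).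
Proof.
move=> oU fs Uz a b; have [f1 f2] := fs a b; split.
  have := smooth_derive_plane v oU f1 Uz; congr is_derive.
  rewrite evE -[(ext_d f z).1]/(mxderive f z (1, 0)) -[(ext_d f z).2]/(mxderive f z (0, 1)).
  by rewrite cReD (cRe_realM v.1) (cRe_realM v.2) (mxderiveE f z (1, 0)) (mxderiveE f z (0, 1)).
have := smooth_derive_plane v oU f2 Uz; congr is_derive.
rewrite evE -[(ext_d f z).1]/(mxderive f z (1, 0)) -[(ext_d f z).2]/(mxderive f z (0, 1)).
by rewrite cImD (cIm_realM v.1) (cIm_realM v.2) (mxderiveE f z (1, 0)) (mxderiveE f z (0, 1)).
Qed.

Lemma vc_derive (z0 z v : plane R) :
  is_cderive z v (fun y => vc (y - z0)) (vc v).
Proof.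
have aff (g : R -> R) (a b : R) : (forall u, g u = u * a + b) -> is_derive (0 : R) (1 : R) g a.
  move=> gE; have := is_derive_scale (is_derive_id (a * 0) (1 : R)).
  move=> H; have := is_deriveD H (is_derive_cst b (0 : R) (1 : R)).
  rewrite addr0 mul1r; congr is_derive; apply/funext => u; rewrite gE.
  by congr (_ + _); rewrite mulrC.
split.
  have := is_derive_line (fun y : plane R => complex.Re (vc (y - z0))) z v 0 v.1.
  rewrite scale0r add0r => ->; apply: (aff _ _ (z.1 - z0.1)) => u.
  by rewrite addrA.
have := is_derive_line (fun y : plane R => complex.Im (vc (y - z0))) z v 0 v.2.
rewrite scale0r add0r => ->; apply: (aff _ _ (z.2 - z0.2)) => u.
by rewrite addrA.
Qed.

End PlaneDerivatives.

(** * Loops depending smoothly on a point *)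

Section LoopSlices.
Variable R : realType.
Local Notation C := R[i].
Implicit Types (U : set (plane R)) (f : plane R -> loop R).

Lemma open_cylinder U : open U -> open [set q : plane R * R | U q.1].
Proof.
move=> oU; apply: (@open_comp _ _ (fst : plane R * R -> plane R)) => //.
by move=> q _; exact: cvg_fst.
Qed.

Lemma smooth_loops_slice U f l : open U -> smooth_loops U f -> `|l| = 1 ->
  mxsmooth U (fun z => f z l).
Proof.
move=> oU fs /expi_surj[t _ ->].
have := @mxsmooth_affine R (plane R * R)%type (plane R)
  [set q : plane R * R | U q.1] U (fun q => f q.1 (expi q.2)) (fun z => (z, t)) (fun w => (w, 0)).
apply => //.
  move=> s w x; transitivity ((s *: w + x, s *: 0 + t) : plane R * R) => //.
  by rewrite scaler0 add0r.
by move=> z; apply: (cvg_pair (G := nbhs z) (H := nbhs t) (f := id) (g := fun=> t)); [exact: cvg_id|exact: cvg_cst].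
Qed.

Lemma smooth_loops_cts U f z : open U -> smooth_loops U f -> U z -> ctsloop (f z).
Proof.
move=> oU fs Uz.
have H : mxsmooth [set: R] (fun t => f z (expi t)).
  have := @mxsmooth_affine R (plane R * R)%type R
    [set q : plane R * R | U q.1] setT (fun q => f q.1 (expi q.2)) (fun t => (z, t)) (fun s => (0, s)).
  apply => //.
  - exact: openT.
  - move=> s w x; transitivity ((s *: 0 + z, s *: w + x) : plane R * R) => //.
    by rewrite scaler0 add0r.
  - by move=> t; apply: (cvg_pair (G := nbhs z) (H := nbhs t) (f := fun=> z) (g := id)); [exact: cvg_cst|exact: cvg_id].
move=> a b; split=> t; have [] := mxsmooth_continuous H a b (I : [set: R] t) => //.
Qed.

Lemma smooth_loops_pull U (G : plane R -> mat3 R) : open U -> mxsmooth U G ->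
  mxsmooth [set q : plane R * R | U q.1] (fun q => G q.1).
Proof.
move=> oU Gs.
apply: (@mxsmooth_affine R (plane R) (plane R * R)%type U _ G fst fst) => //.
  exact: open_cylinder.
by move=> q; exact: cvg_fst.
Qed.

End LoopSlices.

Section Vandermonde.
Variable R : realType.
Local Notation C := R[i].

(** Points of the unit circle with pairwise distinct abscissas i / n. *)
Definition circle_point (n : nat) (i : 'I_n) : C :=
  let c := i%:R / n%:R in c +i* Num.sqrt (1 - c ^+ 2).

Lemma norm_circle_point n (i : 'I_n) : `|circle_point i| = 1.
Proof.
have n0 : (0 < n)%N by apply: leq_ltn_trans (ltn_ord i).
rewrite normc_def /= sqr_sqrtr; first by rewrite addrC subrK sqrtr1.
rewrite subr_ge0 expr_le1 ?divr_ge0 //.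
by rewrite ler_pdivrMr ?ltr0n // mul1r ler_nat ltnW.
Qed.

Lemma circle_point_inj n : injective (@circle_point n).
Proof.
move=> i j [] /eqP.
have n0 : (n%:R : R) != 0.
  by rewrite pnatr_eq0; case: i => k /= kn; apply: contraTneq kn => ->.
by rewrite (inj_eq (mulIf _)) ?invr_eq0 // eqr_nat => /eqP /val_inj.
Qed.

(** Evaluating at n distinct points of the circle gives a linear system for the
    coefficients with a Vandermonde matrix, so each coefficient is a fixed linear
    combination of values of f. *)
Lemma laurent_coef_smooth (V : normedModType R) (U : set V) (n : nat)
    (f : V -> loop R) (c : V -> 'I_n -> mat3 R) (e : nat) :
  open U -> (forall l, `|l| = 1 -> mxsmooth U (fun z => f z l)) ->
  (forall z l, U z -> `|l| = 1 -> l ^+ e *: f z l = \sum_(j < n) l ^+ j *: c z j) ->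
  forall j, mxsmooth U (fun z => c z j).
Proof.
move=> oU fs fE j a b.
pose A : 'rV[C]_n := \row_m circle_point m.
pose W := invmx (Vandermonde n A).
have Wu : Vandermonde n A \in unitmx.
  rewrite unitmxE det_Vandermonde unitfE; apply/prodf_neq0 => i _.
  apply/prodf_neq0 => k ik; rewrite !mxE subr_eq0; apply: contraTneq ik.
  by move/circle_point_inj => ->; rewrite ltnn.
have cE z : U z -> c z j a b =
    \sum_m (circle_point m ^+ e * f z (circle_point m) a b) * W m j.
  move=> Uz; pose X : 'rV[C]_n := \row_k c z k a b.
  pose Y : 'rV[C]_n := \row_m (circle_point m ^+ e * f z (circle_point m) a b).
  have XY : X *m Vandermonde n A = Y.
    apply/rowP => m; rewrite !mxE.
    have /matrixP /(_ a b) := fE z _ Uz (norm_circle_point m).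
    rewrite mxE => ->; rewrite summxE; apply: eq_bigr => k _.
    by rewrite !mxE mulrC.
  have : X = Y *m W by rewrite -XY mulmxK.
  by move/rowP/(_ j); rewrite !mxE => ->; apply: eq_bigr => m _; rewrite mxE.
have sm : csmooth U (fun z => \sum_m (circle_point m ^+ e * f z (circle_point m) a b) * W m j).
  apply: csmooth_sum => // m; apply: csmoothM => //; last exact: csmooth_cst.
  apply: csmoothM => //; first exact: csmooth_cst.
  exact: fs (norm_circle_point m) a b.
by apply: csmooth_eq sm => // z Uz; rewrite cE.
Qed.

End Vandermonde.

(** * Values of one-forms on vectors *)

Section Evaluation.
Variable R : realType.
Local Notation C := R[i].

Lemma ev_fdz (M : mat3 R) v : ev (fdz M) v = vc v *: M.
Proof.
rewrite /ev /fdz scalerA -scalerDl; congr (_ *: _).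
by apply: ReIm_eq; rewrite ?(cReD, cImD) ?(cReM, cImM) /=; ring.
Qed.

Lemma evD w w' (v : plane R) : ev (w + w') v = ev w v + ev w' v.
Proof. by rewrite /ev /= !scalerDr addrACA. Qed.

Lemma evN w (v : plane R) : ev (- w) v = - ev w v.
Proof. by rewrite /ev /= !scalerN opprD. Qed.

Lemma ev_mull M w (v : plane R) : M *m ev w v = ev (form_map (mulmx M) w) v.
Proof. by rewrite /ev /form_map /= mulmxDr -!scalemxAr. Qed.

Lemma ev_mulr M w (v : plane R) : ev w v *m M = ev (form_map (mulmx^~ M) w) v.
Proof. by rewrite /ev /form_map /= mulmxDl -!scalemxAl. Qed.

Lemma sum_pair n (f g : 'I_n -> mat3 R) :
  \sum_i ((f i, g i) : mform R) = (\sum_i f i, \sum_i g i).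
Proof.
elim: n f g => [|n IH] f g; first by rewrite !big_ord0.
by rewrite !big_ord_recl IH.
Qed.

Lemma ev_sum n (w : 'I_n -> mform R) v :
  ev (\sum_i w i) v = \sum_i ev (w i) v.
Proof.
apply: (big_morph (fun w => ev w v)) => [x y|]; first exact: evD.
by rewrite /ev /= !scaler0 addr0.
Qed.

Lemma ev_scale c w (v : plane R) : c *: ev w v = ev (c *: w.1, c *: w.2) v.
Proof. by rewrite /ev scalerDr !scalerA /= ![c * _]mulrC -!scalerA. Qed.

Lemma ev_dx w : ev w ((1, 0) : plane R) = w.1.
Proof. by rewrite /ev /= scale1r scale0r addr0. Qed.

Lemma ev_dy w : ev w ((0, 1) : plane R) = w.2.
Proof. by rewrite /ev /= scale1r scale0r add0r. Qed.

Lemma norm_fst_le (v : plane R) : `|v.1| <= `|v|.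
Proof. by rewrite prod_normE le_max lexx. Qed.

Lemma norm_snd_le (v : plane R) : `|v.2| <= `|v|.
Proof. by rewrite prod_normE le_max lexx orbT. Qed.

Lemma mnorm1_ev w (v : plane R) :
  mnorm1 (ev w v) <= (mnorm1 w.1 + mnorm1 w.2) * `|v|.
Proof.
have real1 (x : R) : cnorm1 x%:C = `|x| by rewrite /cnorm1 /= normr0 addr0.
apply: le_trans (mnorm1D _ _) _; rewrite mulrDl; apply: lerD;
  apply: le_trans (mnorm1Z _ _) _; rewrite real1 mulrC;
  rewrite ler_wpM2l ?mnorm1_ge0 //.
  exact: norm_fst_le.
exact: norm_snd_le.
Qed.

Lemma cnorm1_vc (v : plane R) : cnorm1 (vc v) <= 2 * `|v|.
Proof.
by rewrite /cnorm1 /= (_ : 2 = 1 + 1) // mulrDl !mul1r lerD ?norm_fst_le ?norm_snd_le.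
Qed.

Lemma mnorm1_continuous (V : normedModType R) (U : set V) (f : V -> mat3 R) x :
  mxsmooth U f -> U x -> {for x, continuous (fun y => mnorm1 (f y))}.
Proof.
move=> fs Ux; rewrite /mnorm1.
have sumc (I : Type) (r : seq I) (g : I -> V -> R) :
    (forall i, continuous_at x (g i)) -> continuous_at x (fun y => \sum_(i <- r) g i y).
  move=> gc; elim: r => [|i r IH]; rewrite /continuous_at.
    by rewrite big_nil; under [fun y => _]eq_fun do rewrite big_nil; exact: cvg_cst.
  rewrite big_cons; under [fun y => _]eq_fun do rewrite big_cons.
  by apply: cvgD; [exact: gc|exact: IH].
rewrite -[{for x, continuous _}]/(continuous_at x (fun y => \sum_a \sum_b cnorm1 (f y a b))).
apply: (sumc _ _ (fun a y => \sum_b cnorm1 (f y a b))) => a.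
apply: (sumc _ _ (fun b y => cnorm1 (f y a b))) => b.
have [c1 c2] := mxsmooth_continuous fs a b Ux.
by apply: cvgD; apply: cvg_norm; [exact: c1|exact: c2].
Qed.

End Evaluation.

Section BlockSmooth.
Variables (R : realType) (V : normedModType R) (U : set V).
Hypothesis oU : open U.

Lemma mxsmooth_blk (m : V -> 'M[R[i]]_2) d :
  (forall i j, csmooth U (fun z => m z i j)) -> mxsmooth U (fun z => blk (m z) d).
Proof.
move=> ms a b; case: (@split_ordP 2 1 a) => i ->; case: (@split_ordP 2 1 b) => j ->.
- apply: (csmooth_eq oU _ (ms i j)) => z _.
  by rewrite [RHS](@block_mxEul _ 2 1 2 1).
- apply: (csmooth_eq oU _ (csmooth_cst U 0)) => z _.
  by rewrite [RHS](@block_mxEur _ 2 1 2 1) mxE.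
- apply: (csmooth_eq oU _ (csmooth_cst U 0)) => z _.
  by rewrite [RHS](@block_mxEdl _ 2 1 2 1) mxE.
- apply: (csmooth_eq oU _ (csmooth_cst U (d%:M i j))) => z _.
  by rewrite [RHS](@block_mxEdr _ 2 1 2 1).
Qed.

Lemma mxsmoothD (f g : V -> mat3 R) : mxsmooth U f -> mxsmooth U g ->
  mxsmooth U (fun z => f z + g z).
Proof.
move=> fs gs a b; apply: (csmooth_eq oU _ (csmoothD oU (fs a b) (gs a b))) => z _.
by rewrite [RHS]mxE.
Qed.

Lemma mxsmoothZ (c : R[i]) (f : V -> mat3 R) : mxsmooth U f ->
  mxsmooth U (fun z => c *: f z).
Proof.
move=> fs a b.
apply: (csmooth_eq oU _ (csmoothM oU (csmooth_cst U c) (fs a b))) => z _.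
by rewrite [RHS]mxE.
Qed.

Lemma mxsmoothN (f : V -> mat3 R) : mxsmooth U f -> mxsmooth U (fun z => - f z).
Proof.
move=> fs a b; apply: (csmooth_eq oU _ (csmoothN oU (fs a b))) => z _.
by rewrite [RHS]mxE.
Qed.

Lemma mxsmooth_ul (f : V -> mat3 R) i j : mxsmooth U f ->
  csmooth U (fun z => ulsubmx (f z : 'M[R[i]]_(2 + 1)) i j).
Proof.
move=> fs; apply: (csmooth_eq oU _ (fs (lshift 1 i) (lshift 1 j))) => z _.
by rewrite [RHS]mxE [RHS]mxE.
Qed.

(** By [su_projE], the projection is real linear on the traceless block. *)
Lemma mxsmooth_su_proj3 (f : V -> mat3 R) : mxsmooth U f ->
  (forall z, U z -> in_u3_0C (f z)) -> mxsmooth U (fun z => su_proj3 (f z)).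
Proof.
move=> fs fu.
pose m z := ulsubmx (f z : 'M[R[i]]_(2 + 1)).
have ms i j : csmooth U (fun z => m z i j) by exact: mxsmooth_ul.
have Im_smooth (g : V -> R[i]) (s : R) : csmooth U g ->
    csmooth U (fun z => 0 +i* (s * complex.Im (g z))).
  move=> [_ gi]; split; first exact: smooth_cst.
  by apply: smoothM => //; exact: smooth_cst.
have H : mxsmooth U (fun z => blk (su_part (m z)) 0).
  apply: mxsmooth_blk => i j.
  have [->|->] := ord2P i; have [->|->] := ord2P j.
  - apply: (csmooth_eq oU _ (Im_smooth _ 1 (ms 0 0))) => z _.
    by rewrite /su_part mx2E mul1r.
  - by apply: (csmooth_eq oU _ (ms 0 1)) => z _; rewrite /su_part mx2E.
  - apply: (csmooth_eq oU _ (csmoothN oU (csmoothJ oU (ms 0 1)))) => z _.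
    by rewrite /su_part mx2E.
  - apply: (csmooth_eq oU _ (Im_smooth _ (-1) (ms 0 0))) => z _.
    by rewrite /su_part mx2E mulN1r.
apply: mxsmooth_eq H => // z Uz.
have [m' fz m'0] := u3_0CP (fu z Uz).
have -> : m z = m' by rewrite /m fz ul_blk.
by rewrite fz su_proj3_blk su_projE.
Qed.

End BlockSmooth.

(** * The projection on twisted unitary loops for Laurent polynomials *)

Section LambdaProjection.
Variable R : realType.
Local Notation C := R[i].

Lemma limn_series2 (u : nat -> R) : (forall n, (1 < n)%N -> u n = 0) ->
  limn (series u) = u 0%N + u 1%N.
Proof.
move=> u0; apply/cvg_lim => //; apply: cvg_near_cst; exists 2%N => // n /= n2.
rewrite /series /= -(subnKC n2).
elim: (n - 2)%N => [|k IH]; first by rewrite addn0 !big_nat_recr //= big_nil add0r.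
by rewrite addnS big_nat_recr //= IH (u0 (2 + k)%N) // addr0.
Qed.

Lemma mxseries2 (u : nat -> mat3 R) : (forall n, (1 < n)%N -> u n = 0) ->
  mxseries u = u 0%N + u 1%N.
Proof.
move=> u0; apply/matrixP => a b; rewrite [LHS]mxE [RHS]mxE.
have v1 n : (1 < n)%N -> complex.Re (u n a b) = 0 by move=> /u0 ->; rewrite mxE.
have v2 n : (1 < n)%N -> complex.Im (u n a b) = 0 by move=> /u0 ->; rewrite mxE.
by rewrite (limn_series2 v1) (limn_series2 v2); apply: ReIm_eq; rewrite ?(cReD, cImD).
Qed.

(** The projection on twisted unitary loops of a loop whose lowest power is at
    least -2. *)
Definition Lambda_su2 (g : int -> mat3 R) (l : C) : mat3 R :=
  l ^ (- 1%:Z) *: g (- 1%:Z) + l ^ (- 2%:Z) *: g (- 2%:Z) + su_proj3 (g 0)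
  - (l ^ 1%:Z *: (g (- 1%:Z)) ^t* + l ^ 2%:Z *: (g (- 2%:Z)) ^t*).

(** Both series of the definition then have at most two nonzero terms. *)
Lemma Lambda_suE g (l : C) : (forall n, (1 < n)%N -> fourier g (- n.+1%:Z) = 0) ->
  Lambda_su g l = Lambda_su2 (fourier g) l.
Proof.
move=> g0; rewrite /Lambda_su !mxseries2 // => n n1; rewrite g0 //.
  by apply/matrixP => a b; rewrite [LHS]mxE [X in _ * X]mxE [X in Num.conj X]mxE [X in Num.conj X]mxE [RHS]mxE cJ0 mulr0.
by rewrite scaler0.
Qed.

Lemma sum_delta n k (l : C) (M : mat3 R) : (k < n)%N ->
  \sum_(j < n) l ^+ j *: ((j == k :> nat)%:R *: M) = l ^+ k *: M.
Proof.
move=> kn; rewrite (bigD1 (Ordinal kn)) //= eqxx scale1r big1 ?addr0 // => j jk.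
have -> : (j == k :> nat) = false by apply/negbTE; apply: contra jk => /eqP jk; apply/eqP/val_inj.
by rewrite scale0r scaler0.
Qed.

End LambdaProjection.

Section TwistedFourier.
Variable R : realType.
Local Notation C := R[i].

Lemma u3_0CZ (c : C) (M : mat3 R) : in_u3_0C M -> in_u3_0C (c *: M).
Proof.
move=> /u3_0CP[m -> m0]; rewrite blkZ mulr0; apply: u3_0C_blk.
by rewrite mxtraceZ m0 mulr0.
Qed.

Lemma ctsloop_tr (g : loop R) : ctsloop g -> ctsloop (fun l => (g l)^T).
Proof.
move=> gc a b; have := gc b a; congr ccont.
by apply/funext => t; rewrite mxE.
Qed.

Lemma fourier_tr (g : loop R) k : fourier (fun l => (g l)^T) k = (fourier g k)^T.
Proof.
apply/matrixP => a b; rewrite [RHS]mxE !fourierE; congr cmean.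
by apply/funext => t; rewrite mxE.
Qed.

Lemma tau_algE (M : mat3 R) : tau_alg M = - diagNJ1 R *m M^T *m diagJ1 R.
Proof. by rewrite /tau_alg !mulNmx. Qed.

(** Comparing the coefficients of lambda^k in tau (g (lambda)) = g (i lambda)
    gives tau (g_k) = i^k g_k, and i^k = 1 when 4 divides k. *)
Lemma fourier_tau p n (g : loop R) : Lambdau3_le n g ->
  in_u3_0C (fourier g (- (4 * p)%:Z)).
Proof.
move=> [gt gL]; set k := - (4 * p)%:Z.
pose e (j : 'I_(n + n).+1) : int := j%:Z - n%:Z.
pose x (j : 'I_(n + n).+1) := fourier g (e j).
have gc : ctsloop g.
  apply: (eq_ctsloop (g := fun l => \sum_j l ^ e j *: x j)) => [l l1|].
    by rewrite (gL l l1).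
  by apply: ctsloop_sum => j; exact: ctsloop_monomial.
have i0 : ('i : C) != 0 by rewrite neq0Ci.
have ik : ('i : C) ^ k = 1.
  by rewrite /k -exprnN exprM -[4%N]/(2 * 2)%N exprM sqrCi sqrrN expr1n expr1n invr1.
have E1 : fourier (fun l => tau_alg (g l)) k = tau_alg (fourier g k).
  rewrite tau_algE -fourier_tr -fourierMl; last exact: ctsloop_tr.
  rewrite -fourierMr; last by apply: ctsloopM; [exact: ctsloop_cst|exact: ctsloop_tr].
  by apply: eq_fourier => l _; rewrite tau_algE.
have E2 : fourier (fun l => tau_alg (g l)) k = fourier g k.
  have gE : forall l : C, `|l| = 1 -> g l = \sum_j l ^ e j *: x j by move=> l /gL.
  have tE : forall l : C, `|l| = 1 -> tau_alg (g l) = \sum_j l ^ e j *: ('i ^ e j *: x j).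
    move=> l l1; have [_ ->] := gt l l1; rewrite gE; last by rewrite normrM normCi l1 mulr1.
    by apply: eq_bigr => j _; rewrite expfzMl mulrC scalerA.
  have E3 := eq_fourier k gE; rewrite fourier_laurent in E3.
  rewrite (eq_fourier k tE) fourier_laurent E3.
  by apply: eq_bigr => j /eqP ->; rewrite ik scale1r.
by rewrite /in_u3_0C -E1 E2.
Qed.

End TwistedFourier.

(** * The explicit solution of dH = H Theta and its Fourier coefficients *)

Section Frame.
Variable R : realType.
Local Notation C := R[i].
Variables (U : set (plane R)) (z0 : plane R) (F xi : plane R -> loop R).
Hypotheses (oU : open U) (cU : connected U) (Uz0 : U z0).
Hypothesis Fs : smooth_loops U F.
Hypothesis FU : forall z, U z -> LambdaU3 (F z).
Hypothesis F0 : forall l : C, `|l| = 1 -> F z0 l = 1%:M.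
Let A := maurer_cartan F.

Lemma frame_unitary z l : U z -> `|l| = 1 -> F z l \is unitarymx.
Proof. by move=> Uz l1; have [] := FU Uz l1. Qed.

Lemma frame_mulV z l : U z -> `|l| = 1 -> F z l *m (F z l) ^t* = 1%:M.
Proof. by move=> Uz l1; apply/unitarymxP; exact: frame_unitary. Qed.

Lemma frame_mulV' z l : U z -> `|l| = 1 -> (F z l) ^t* *m F z l = 1%:M.
Proof. by move=> Uz l1; apply: mulmx1C; exact: frame_mulV. Qed.

Lemma frame_derive z l v : U z -> `|l| = 1 ->
  is_mxderive z v (F^~ l) (F z l *m ev (A z l) v).
Proof.
move=> Uz l1; have := mxsmooth_derive_plane v oU (smooth_loops_slice oU Fs l1) Uz.
congr is_mxderive.
have Fu : F z l \in unitmx by apply: unitarymx_unit; exact: frame_unitary.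
have E : ev (A z l) v = invmx (F z l) *m ev (ext_d (F^~ l) z) v by rewrite ev_mull.
rewrite E; exact: (esym (mulKVmx Fu _)).
Qed.

Lemma mx_cst_derive m n (f : plane R -> 'M[C]_(m, n)) c z v : U z ->
  (forall y, U y -> f y = c) -> is_mxderive z v f 0.
Proof.
move=> Uz fc; apply: is_mxderive_near (is_mxderive_cst z v c).
by near=> y; rewrite fc //; near: y; exact: open_nbhs_nbhs.
Unshelve. all: by end_near. Qed.

(** Differentiating F^* F = Id. *)
Lemma frame_skew z l v : U z -> `|l| = 1 -> (ev (A z l) v) ^t* = - ev (A z l) v.
Proof.
move=> Uz l1; have FD := frame_derive v Uz l1.
have := is_mxderiveM (is_mxderive_ctrans FD) FD.
have H : is_mxderive z v (fun y => (F y l) ^t* *m F y l) 0.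
  by apply: (mx_cst_derive (c := 1%:M) v Uz) => y Uy; exact: frame_mulV'.
move/(is_mxderive_unique H)/esym; rewrite ctransM -mulmxA (mulmxA _ (F z l)).
rewrite frame_mulV' // mulmx1 mul1mx => /eqP.
by rewrite addr_eq0 => /eqP.
Qed.

Hypothesis xis : smooth_loops U xi.
Hypothesis xiu : forall z, U z -> Lambdau3 (xi z).
Hypothesis xiD : forall z, U z -> forall l : C, `|l| = 1 ->
  ext_d (fun y => xi y l) z = form_map (lie (xi z l)) (A z l).

Lemma potential_derive z l v : U z -> `|l| = 1 ->
  is_mxderive z v (xi^~ l) (lie (xi z l) (ev (A z l) v)).
Proof.
move=> Uz l1; have := mxsmooth_derive_plane v oU (smooth_loops_slice oU xis l1) Uz.
congr is_mxderive; rewrite xiD // /lie ev_mull ev_mulr -evN -evD.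
by rewrite /form_map /lie.
Qed.

(** The derivative of F xi F^* is F (A xi + [xi, A] - xi A) F^* = 0. *)
Lemma potential_conj z l : U z -> `|l| = 1 -> F z l *m xi z l = xi z0 l *m F z l.
Proof.
move=> Uz l1.
pose Q y := F y l *m xi y l *m (F y l) ^t*.
have QD y v : U y -> is_mxderive y v Q 0.
  move=> Uy; have FD := frame_derive v Uy l1; have XD := potential_derive v Uy l1.
  have := is_mxderiveM (is_mxderiveM FD XD) (is_mxderive_ctrans FD).
  congr is_mxderive; rewrite ctransM frame_skew // /lie.
  move: (ev _ _) (F y l) ((F y l) ^t*) (xi y l) => a f g x.
  rewrite mulmxBr !mulmxA mulmxN mulmxDl mulmxBl.
  by rewrite [X in X + _ = _]addrCA subrr addr0 mulNmx subrr.
have QE : Q z = Q z0 by apply: (is_mxderive_cst_on oU cU Uz0) => // w v Uw; exact: QD.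
have Q0 : Q z0 = xi z0 l.
  by rewrite /Q F0 // (_ : (1%:M : mat3 R) ^t* = 1%:M) ?mulmx1 ?mul1mx // trmx1 map_mx1.
by rewrite -Q0 -QE /Q -!mulmxA frame_mulV' // mulmx1.
Qed.

Variable p : nat.

(** The exponent of H per unit of z - z0; conjugation by F turns it into
    - lambda^(4p) xi(z). *)
Definition ode_generator (l : C) : mat3 R := (- l ^+ (4 * p)) *: xi z0 l.

(** A complex multiple of a skew-Hermitian matrix is normal. *)
Lemma ode_generator_normal l : `|l| = 1 -> ode_generator l \is normalmx.
Proof.
move=> l1; have [x0 _] := xiu Uz0 l1.
apply/normalmxP; rewrite /ode_generator ctransZ x0 -!scalemxAl -!scalemxAr !scalerA.
by rewrite mulrC mulmxN mulNmx.
Qed.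

(** The explicit solution H of dH = H Theta. *)
Definition flow (z : plane R) : loop R := fun l =>
  mexp (ode_generator l) (vc (z - z0)) *m F z l.

(** Theta evaluated on v. *)
Definition flow_form (z : plane R) (l : C) (v : plane R) : mat3 R :=
  ev (A z l) v - (vc v * l ^+ (4 * p)) *: xi z l.

(** By [potential_conj], the generator, moved to the right of F, becomes the term
    - lambda^(4p) xi dz of the form. *)
Lemma flow_derive z l v : U z -> `|l| = 1 ->
  is_mxderive z v (flow^~ l) (flow z l *m flow_form z l v).
Proof.
move=> Uz l1; have Nn := ode_generator_normal l1.
have := is_mxderiveM (mexp_derive Nn (vc_derive z0 z v)) (frame_derive v Uz l1).
congr is_mxderive; rewrite mexp_comm // /flow /flow_form.
rewrite mulmxBr addrC !mulmxA; congr (_ + _).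
set E := mexp _ _.
rewrite /ode_generator -[E *m (_ *: xi z0 l)]scalemxAr scalerA -scalemxAl mulrN scaleNr.
rewrite -[E *m F z l *m (_ *: _)]scalemxAr -[E *m F z l *m xi z l]mulmxA.
by rewrite (potential_conj Uz l1) mulmxA.
Qed.

Lemma ctsloop_generator : ctsloop ode_generator.
Proof.
have xc := smooth_loops_cts oU xis Uz0.
have := ctsloopM (ctsloop_cst (- 1%:M)) (ctsloopZ (4 * p)%:Z xc).
apply: eq_ctsloop => l _.
by rewrite mulNmx mul1mx /ode_generator scaleNr.
Qed.

Lemma ctsloop_flow z : U z -> ctsloop (flow z).
Proof.
move=> Uz; apply: ctsloopM; last exact: smooth_loops_cts Uz.
by apply: ctsloop_mexp; [exact: ctsloop_generator|exact: ode_generator_normal].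
Qed.

(** F is unitary, and the exponential is bounded while z - z0 is, uniformly in
    lambda. *)
Lemma flow_bounded (W : R) : exists K : R, forall z l, U z -> `|l| = 1 ->
  `|z - z0| <= W -> mnorm1 (flow z l) <= K.
Proof.
have [K0 NK] := ctsloop_bounded ctsloop_generator.
eexists => z l Uz l1 zW; apply: le_trans (mnorm1M _ _) _.
apply: ler_pM; rewrite ?mnorm1_ge0 //; last first.
  by apply: unitary_mnorm1; exact: frame_unitary.
apply: mexp_bound; [exact: ode_generator_normal|exact: NK|].
apply: le_trans (cnorm1_vc _) _; apply: ler_wpM2l zW; exact: ler0n.
Qed.

Lemma flow0 l : `|l| = 1 -> flow z0 l = 1%:M.
Proof.
move=> l1; rewrite /flow subrr F0 // mulmx1.
have -> : vc (0 : plane R) = 0 by [].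
exact: mexp0.
Qed.

Variable B : plane R -> mform R.
Hypothesis Bs : form_u3_0C U B.
Hypothesis xiL : forall z, U z -> Lambdau3_le (2 + 4 * p) (xi z).
Hypothesis xiA : forall z, U z -> forall l : C, `|l| = 1 ->
  Lambda_su_dz (fun m => m ^+ (4 * p) *: xi z m) l = A z l + B z.

(** The coefficient of lambda^k in lambda^(4p) xi. *)
Definition coef (k : int) (z : plane R) : mat3 R := fourier (xi z) (k - (4 * p)%:Z).

Let n := (4 * p + (2 + 4 * p)).+1.

Lemma circle_neq0 (l : C) : `|l| = 1 -> l != 0.
Proof. by move=> l1; rewrite -normr_eq0 l1 oner_eq0. Qed.

Lemma potential_laurent z l : U z -> `|l| = 1 -> l ^+ (4 * p) *: xi z l =
  l ^ (- 2%:Z) *: coef (- 2%:Z) z + l ^ (- 1%:Z) *: coef (- 1%:Z) z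
  + \sum_(j < n) l ^+ j *: coef j z.
Proof.
move=> Uz l1; have l0 := circle_neq0 l1; have [_ /(_ l l1) ->] := xiL Uz.
have T (k k' : int) : k' = k + (4 * p)%:Z ->
    l ^+ (4 * p) *: (l ^ k *: fourier (xi z) k) = l ^ k' *: coef k' z.
  by move=> ->; rewrite scalerA exprnP -(expfzDr _ _ l0) (addrC _ k) /coef addrK.
rewrite scaler_sumr big_ord_recl big_ord_recl addrA.
apply: (congr2 +%R (congr2 +%R _ _) _).
- by apply: T => /=; lia.
- by apply: T; rewrite /= /bump /=; lia.
- by apply: eq_bigr => j _; rewrite (exprnP l j); apply: T; rewrite /= /bump /=; lia.
Qed.

Lemma coef_out z k : U z -> k < - 2%:Z -> coef k z = 0.
Proof.
move=> Uz k2; rewrite /coef.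
have [_ E] := xiL Uz; rewrite (eq_fourier _ (E)) fourier_laurent big_pred0 // => j.
by apply/negbTE/eqP; lia.
Qed.

Lemma fourier_potential z k : fourier (fun m => m ^+ (4 * p) *: xi z m) k = coef k z.
Proof. exact: (fourier_shift (4 * p)%:Z). Qed.

Lemma ctsloop_potential z : U z -> ctsloop (fun m => m ^+ (4 * p) *: xi z m).
Proof.
by move=> Uz; have := ctsloopZ (4 * p)%:Z (smooth_loops_cts oU xis Uz).
Qed.

Lemma fourier_potentialZ z c k : U z ->
  fourier (fun m => c *: (m ^+ (4 * p) *: xi z m)) k = c *: coef k z.
Proof. by move=> Uz; rewrite fourierZ ?fourier_potential //; exact: ctsloop_potential. Qed.

Lemma Lambda_su_potential z c l : U z ->
  Lambda_su (fun m => c *: (m ^+ (4 * p) *: xi z m)) l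
  = Lambda_su2 (fun k => c *: coef k z) l.
Proof.
move=> Uz; rewrite Lambda_suE => [|k k1].
  apply: (congr1 (fun g => Lambda_su2 g l)); apply/funext => k.
  exact: fourier_potentialZ.
by rewrite fourier_potentialZ // coef_out ?scaler0 //; lia.
Qed.

Lemma mc_dx z l : U z -> `|l| = 1 ->
  (A z l).1 = Lambda_su2 (fun k => 1 *: coef k z) l - (B z).1.
Proof.
move=> Uz l1; rewrite -Lambda_su_potential //.
have -> : (fun m => 1 *: (m ^+ (4 * p) *: xi z m)) = (fun m => m ^+ (4 * p) *: xi z m).
  by apply/funext => m; rewrite scale1r.
by have /(congr1 fst) /= -> := xiA Uz l1; rewrite addrK.
Qed.

Lemma mc_dy z l : U z -> `|l| = 1 ->
  (A z l).2 = Lambda_su2 (fun k => 'i *: coef k z) l - (B z).2.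
Proof.
move=> Uz l1; rewrite -Lambda_su_potential //.
by have /(congr1 snd) /= -> := xiA Uz l1; rewrite addrK.
Qed.

(** The coefficient of lambda^j in Theta evaluated on one coordinate vector,
    where c = dz of this vector and b the value of B; the adjoints come from the
    positive powers in the projection. *)
Definition flow_coef (c : C) (b : plane R -> mat3 R) (j : nat) (z : plane R) : mat3 R :=
  (j == 0%N)%:R *: (su_proj3 (c *: coef 0 z) - b z)
  - (j == 1%N)%:R *: (c *: coef (- 1%:Z) z) ^t*
  - (j == 2%N)%:R *: (c *: coef (- 2%:Z) z) ^t*
  - c *: coef j z.

Lemma flow_form_rearrange (y d s ly ld b t : mat3 R) :
  y + d + s - (ly + ld) - b - (d + y + t) = s - b - ly - ld - t.
Proof. by apply/matrixP => i j; rewrite !mxE; ring. Qed.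

Lemma sum_flow_coef (S Y D : mat3 R) (X : nat -> mat3 R) (c l : C) :
  \sum_(j < n) l ^+ j *: ((j == 0 :> nat)%:R *: S - (j == 1 :> nat)%:R *: Y
    - (j == 2 :> nat)%:R *: D - c *: X j)
  = S - l ^+ 1 *: Y - l ^+ 2 *: D - c *: \sum_(j < n) l ^+ j *: X j.
Proof.
have n2 : (2 < n)%N by rewrite /n; lia.
transitivity (\sum_(j < n) (l ^+ j *: ((j == 0 :> nat)%:R *: S)
    - l ^+ j *: ((j == 1 :> nat)%:R *: Y) - l ^+ j *: ((j == 2 :> nat)%:R *: D)
    - c *: (l ^+ j *: X j))).
  by apply: eq_bigr => j _; rewrite !scalerBr (scalerA c) (mulrC c) -scalerA.
rewrite !sumrB (sum_delta l Y (ltnW n2)) (sum_delta l D n2) -scaler_sumr.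
by rewrite (sum_delta l S (ltnW (ltnW n2))) expr0 scale1r.
Qed.

(** The negative powers of A and of lambda^(4p) xi dz are the same and
    cancel. *)
Lemma flow_coefE c b z l : U z -> `|l| = 1 ->
  Lambda_su2 (fun k => c *: coef k z) l - b z - c *: (l ^+ (4 * p) *: xi z l)
  = \sum_(j < n) l ^+ j *: flow_coef c b j z.
Proof.
move=> Uz l1; rewrite potential_laurent // /Lambda_su2 /flow_coef.
rewrite (sum_flow_coef _ _ _ (fun j => coef j z)) (scalerDr c) (scalerDr c).
have sw (k : int) (M : mat3 R) : c *: (l ^ k *: M) = l ^ k *: (c *: M).
  by rewrite !scalerA mulrC.
by rewrite !sw flow_form_rearrange.
Qed.

Definition flow_form_coef (j : nat) (z : plane R) : mform R :=
  (flow_coef 1 (fun z => (B z).1) j z, flow_coef 'i (fun z => (B z).2) j z).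

Lemma flow_form_laurent z l v : U z -> `|l| = 1 ->
  flow_form z l v = \sum_(j < n) l ^+ j *: ev (flow_form_coef j z) v.
Proof.
move=> Uz l1.
have E : A z l - fdz (l ^+ (4 * p) *: xi z l)
    = \sum_(j < n) (l ^+ j *: (flow_form_coef j z).1, l ^+ j *: (flow_form_coef j z).2).
  have e1 : \sum_(j < n) l ^+ j *: (flow_form_coef j z).1
      = (A z l).1 - l ^+ (4 * p) *: xi z l.
    by rewrite -(flow_coefE 1 (fun z => (B z).1) Uz l1) -(mc_dx Uz l1) scale1r.
  have e2 : \sum_(j < n) l ^+ j *: (flow_form_coef j z).2
      = (A z l).2 - 'i *: (l ^+ (4 * p) *: xi z l).
    by rewrite -(flow_coefE 'i (fun z => (B z).2) Uz l1) -(mc_dy Uz l1).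
  apply: (etrans _ (esym (sum_pair _ _))).
  apply: (etrans _ (esym (congr2 (@pair _ _) e1 e2))).
  exact: surjective_pairing.
rewrite /flow_form -scalerA -ev_fdz -evN -evD E ev_sum.
by apply: eq_bigr => j _; rewrite -ev_scale.
Qed.

Lemma coef_smooth (j : nat) : (j < n.+2)%N -> mxsmooth U (coef (j%:Z - 2%:Z)).
Proof.
move=> jn.
have := @laurent_coef_smooth R _ U n.+2 xi (fun z j => coef (j%:Z - 2%:Z) z) (2 + 4 * p) oU.
move=> /(_ (fun l l1 => smooth_loops_slice oU xis l1) _ (Ordinal jn)); apply.
move=> z l Uz l1; have l0 := circle_neq0 l1.
have T (k : int) (m : nat) : m%:Z = k + 2%:Z ->
    l ^+ 2 *: (l ^ k *: coef k z) = l ^+ m *: coef (m%:Z - 2%:Z) z.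
  move=> mk; have -> : m%:Z - 2%:Z = k by lia.
  rewrite scalerA exprnP -(expfzDr _ _ l0) exprnP.
  by have -> : 2%:Z + k = m%:Z by lia.
rewrite exprD -scalerA potential_laurent // !scalerDr.
rewrite [RHS]big_ord_recl [X in _ = _ + X]big_ord_recl addrA.
apply: (congr2 +%R (congr2 +%R _ _) _).
- by apply: T.
- by apply: T.
rewrite scaler_sumr; apply: eq_bigr => k _; rewrite (exprnP l k); apply: T.
by rewrite /= /bump /=; lia.
Qed.

Lemma coef0_u3 z : U z -> in_u3_0C (coef 0 z).
Proof.
move=> Uz; rewrite /coef sub0r; exact: (fourier_tau p (xiL Uz)).
Qed.

Let Bs1 : mxsmooth U (fun z => (B z).1). Proof. by case: Bs. Qed.
Let Bs2 : mxsmooth U (fun z => (B z).2). Proof. by case: Bs. Qed.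

Lemma flow_coef_smooth c (b : plane R -> mat3 R) j : mxsmooth U b -> (j < n)%N ->
  mxsmooth U (flow_coef c b j).
Proof.
move=> bs jn.
have c0 : mxsmooth U (coef 0) by exact: (@coef_smooth 2).
have c1 : mxsmooth U (coef (- 1%:Z)) by exact: (@coef_smooth 1).
have c2 : mxsmooth U (coef (- 2%:Z)) by exact: (@coef_smooth 0).
have cj : mxsmooth U (coef j).
  have -> : coef j = coef (j.+2%:Z - 2%:Z) by congr coef; lia.
  by apply: coef_smooth; rewrite !ltnS.
have s0 : mxsmooth U (fun z => su_proj3 (c *: coef 0 z)).
  apply: mxsmooth_su_proj3 => //; first exact: mxsmoothZ.
  by move=> z Uz; apply: u3_0CZ; exact: coef0_u3.
apply: mxsmoothD => //; last by apply: mxsmoothN => //; exact: mxsmoothZ.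
apply: mxsmoothD => //.
  apply: mxsmoothD => //; first by apply: mxsmoothZ => //; apply: mxsmoothD => //; exact: mxsmoothN.
  by apply: mxsmoothN => //; apply: mxsmoothZ => //; apply: mxsmooth_ctrans => //; exact: mxsmoothZ.
by apply: mxsmoothN => //; apply: mxsmoothZ => //; apply: mxsmooth_ctrans => //; exact: mxsmoothZ.
Qed.

Lemma flow_form_coef_bound z1 : U z1 -> exists CT : R, \forall z \near z1,
  forall (j : 'I_n) v, mnorm1 (ev (flow_form_coef j z) v) <= CT * `|v|.
Proof.
move=> Uz1.
pose b (j : 'I_n) z := mnorm1 (flow_form_coef j z).1 + mnorm1 (flow_form_coef j z).2.
have bc (j : 'I_n) : continuous_at z1 (b j).
  apply: cvgD.
    exact: (mnorm1_continuous (flow_coef_smooth _ Bs1 (ltn_ord j)) Uz1).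
  exact: (mnorm1_continuous (flow_coef_smooth _ Bs2 (ltn_ord j)) Uz1).
pose CT := \sum_j (b j z1 + 1).
have b0 j z : 0 <= b j z by rewrite addr_ge0 // mnorm1_ge0.
exists CT; have bn : \forall z \near z1, forall j, b j z <= b j z1 + 1.
  apply: (@filter_forall _ _ (fun (j : 'I_n) z => b j z <= b j z1 + 1) (nbhs z1) _) => j.
  have /cvgrPdist_lt /(_ 1 ltr01) := bc j; apply: filterS => z.
  by rewrite distrC => /ltW; rewrite ler_distl => /andP[].
apply: filterS bn => z bz j v; apply: le_trans (mnorm1_ev _ _) _.
apply: ler_wpM2r => //; apply: le_trans (bz j) _; rewrite /CT (bigD1 j) //= lerDl.
by apply: sumr_ge0 => i _; rewrite addr_ge0.
Qed.

Definition flow_fourier (k : int) (z : plane R) : mat3 R := fourier (flow z) k.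

Lemma mnorm1_pow (l : C) j (M : mat3 R) : `|l| = 1 ->
  mnorm1 (l ^+ j *: M) <= 2 * mnorm1 M.
Proof.
move=> /expi_surj[t _ ->]; apply: le_trans (mnorm1Z _ _) _.
by rewrite ler_wpM2r ?mnorm1_ge0 // expiX cnorm1_expi.
Qed.

(** Multiplication of H by lambda^j shifts its Fourier coefficients by j. *)
Lemma flow_fourier_derive k z v : U z -> is_mxderive z v (flow_fourier k)
  (\sum_(j < n) flow_fourier (k - j%:Z) z *m ev (flow_form_coef j z) v).
Proof.
move=> Uz; have [CT bT] := flow_form_coef_bound Uz.
have /nbhs_ballP[r /= r0 rP] : \forall y \near z, U y /\
    forall (j : 'I_n) v, mnorm1 (ev (flow_form_coef j y) v) <= CT * `|v|.
  by near=> y; split; near: y => //; exact: open_nbhs_nbhs.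
have [KH HK] := flow_bounded (`|z - z0| + r).
pose dg y l := flow y l *m \sum_(j < n) l ^+ j *: ev (flow_form_coef j y) v.
have gD y (t : R) : ball z r y -> is_mxderive y v (flow^~ (expi t)) (dg y (expi t)).
  move=> /rP[Uy _]; have l1 := norm_expi t.
  by have := flow_derive v Uy l1; rewrite (flow_form_laurent v Uy l1).
have gc y : ball z r y -> ctsloop (flow y) by move=> /rP[Uy _]; exact: ctsloop_flow.
have gB y (t : R) : ball z r y ->
    mnorm1 (dg y (expi t)) <= KH * \sum_(j < n) 2 * (CT * `|v|).
  move=> yr; have [Uy Ty] := rP _ yr; have l1 := norm_expi t.
  apply: le_trans (mnorm1M _ _) _; apply: ler_pM; rewrite ?mnorm1_ge0 //.
    apply: HK => //; move: yr; rewrite -ball_normE /ball_ /= => zy.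
    rewrite -(subrKA z) addrC; apply: le_trans (ler_normD _ _) _.
    by rewrite lerD2l distrC ltW.
  apply: le_trans (mnorm1_sum _ _ _) _; apply: ler_sum => j _.
  apply: le_trans (mnorm1_pow _ _ l1) _; apply: ler_wpM2l; [exact: ler0n|exact: Ty].
have := derive_fourier k r0 gD gc gB; congr is_mxderive.
have fc := gc z (ballxx z r0).
have fjc (j : 'I_n) : ctsloop (fun l => flow z l *m ev (flow_form_coef j z) v).
  by apply: ctsloopM => //; exact: ctsloop_cst.
rewrite (eq_fourier (h := fun l => \sum_(j < n) l ^ j%:Z *: (flow z l *m ev (flow_form_coef j z) v))).
  rewrite fourier_sum; last by move=> j; apply: ctsloopZ.
  by apply: eq_bigr => j _; rewrite fourier_shift fourierMr.
move=> l l1; rewrite /dg mulmx_sumr; apply: eq_bigr => j _.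
by rewrite -scalemxAr.
Unshelve. all: by end_near. Qed.

Lemma flow_fourier_init k : flow_fourier k z0 = (k == 0)%:R *: 1%:M.
Proof.
rewrite -fourier_cst; apply: eq_fourier => l l1; exact: flow0.
Qed.

(** Only powers j >= 0 occur in the form, so the derivative of a coefficient of
    negative index involves coefficients of negative index only.  These vanish at
    z0, where H is the identity. *)
Lemma flow_fourier_neg z m : U z -> flow_fourier (- m.+1%:Z) z = 0.
Proof.
(* An index records the order, the entry, and whether the real part is taken. *)
pose I := (nat * 'I_3 * 'I_3 * bool)%type.
pose part (s : bool) (x : C) : R := if s then complex.Re x else complex.Im x.
pose f (i : I) z := part i.2 (flow_fourier (- (i.1.1.1).+1%:Z) z i.1.1.2 i.1.2).
pose dF k z v := \sum_(j < n) flow_fourier (k - j%:Z) z *m ev (flow_form_coef j z) v.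
pose df (i : I) z v := part i.2 (dF (- (i.1.1.1).+1%:Z) z v i.1.1.2 i.1.2).
have fD i w v : U w -> is_derive w v (f i) (df i w v).
  case: i => [[[k a] b] s] Uw; have [D1 D2] := flow_fourier_derive (- k.+1%:Z) v Uw a b.
  by case: s.
have part_le s x : `|part s x| <= cnorm1 x.
  by case: s; rewrite /part /cnorm1 ?lerDl ?lerDr.
have loc z1 : U z1 -> exists CM M : R, \forall w \near z1,
    (forall i, `|f i w| <= M) /\
    forall b : R, (forall j, `|f j w| <= b) -> forall i v, `|df i w v| <= CM * b * `|v|.
  move=> Uz1; have [CT bT] := flow_form_coef_bound Uz1.
  have [KH HK] := flow_bounded (`|z1 - z0| + 1).
  exists (\sum_(j < n) 18%:R * CT), (36%:R * KH); near=> w.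
  have Uw : U w by near: w; exact: open_nbhs_nbhs.
  have wz : `|w - z0| <= `|z1 - z0| + 1.
    have w1 : ball z1 1 w by near: w; exact: nbhsx_ballx.
    move: w1; rewrite -ball_normE /ball_ /= => w1.
    rewrite -(subrKA z1) addrC; apply: le_trans (ler_normD _ _) _.
    by rewrite lerD2l distrC ltW.
  have Tw : forall (j : 'I_n) v, mnorm1 (ev (flow_form_coef j w) v) <= CT * `|v|.
    by near: w.
  split=> [[[[k a] b] s]|b fb [[[k a] c] s] v].
    apply: le_trans (part_le _ _) _; apply: le_trans (cnorm1_le_mnorm1 _ _ _) _.
    apply: fourier_bound; first exact: ctsloop_flow.
    by move=> t; apply: HK => //; exact: norm_expi.
  apply: le_trans (part_le _ _) _; apply: le_trans (cnorm1_le_mnorm1 _ _ _) _.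
  apply: le_trans (mnorm1_sum _ _ _) _; rewrite -mulrA mulr_suml; apply: ler_sum => j _.
  apply: le_trans (mnorm1M _ _) _.
  have -> : 18%:R * CT * (b * `|v|) = 18%:R * b * (CT * `|v|) by ring.
  apply: ler_pM; rewrite ?mnorm1_ge0 //.
  (* The coefficient of index - k - 1 is coupled to that of index - (k + j) - 1. *)
  have -> : - k.+1%:Z - j%:Z = - (k + j).+1%:Z by lia.
  have -> : 18%:R * b = (3 * 3)%:R * (b + b) by ring.
  apply: mnorm1_le => a' b'; apply: lerD.
    exact: (fb (((k + j)%N, a', b'), true)).
  exact: (fb (((k + j)%N, a', b'), false)).
have f0 i : f i z0 = 0.
  case: i => [[[k a] b] s]; rewrite /f /= flow_fourier_init.
  have -> : (- k.+1%:Z == 0) = false by apply/negbTE/eqP; lia.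
  by rewrite scale0r mxE; case: s.
move=> Uz; have fz := linear_system_unique oU cU Uz0 fD loc f0.
apply/matrixP => a b; rewrite [RHS]mxE; apply: ReIm_eq.
  exact: (fz ((m, a, b), true) z Uz).
exact: (fz ((m, a, b), false) z Uz).
Unshelve. all: by end_near. Qed.

Lemma flow_fourier0_derive z v : U z -> is_mxderive z v (flow_fourier 0)
  (flow_fourier 0 z *m ev (flow_form_coef 0 z) v).
Proof.
move=> Uz; have := flow_fourier_derive 0 v Uz.
rewrite big_ord_recl big1 ?addr0 ?subr0 // => j _.
have -> : 0 - (lift ord0 j)%:Z = - j.+1%:Z by rewrite /= /bump /=; lia.
by rewrite flow_fourier_neg // mul0mx.
Qed.

Lemma flow_fourier_bounded z1 k : U z1 -> exists M : R, \forall z \near z1,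
  mnorm1 (flow_fourier k z) <= M.
Proof.
move=> Uz1; have [KH HK] := flow_bounded (`|z1 - z0| + 1).
exists (36%:R * KH); near=> w.
have Uw : U w by near: w; exact: open_nbhs_nbhs.
apply: fourier_bound => [|t]; first exact: ctsloop_flow.
apply: HK => //; first exact: norm_expi.
have w1 : ball z1 1 w by near: w; exact: nbhsx_ballx.
move: w1; rewrite -ball_normE /ball_ /= => w1.
rewrite -(subrKA z1) addrC; apply: le_trans (ler_normD _ _) _.
by rewrite lerD2l distrC ltW.
Unshelve. all: by end_near. Qed.

End Frame.

(** * A nowhere vanishing row and its normalisation *)

Section LinearSystemSmooth.
Variables (R : realType) (V : normedModType R) (U : set V).
Hypothesis oU : open U.
Local Notation C := R[i].

Definition is_cCk k (f : V -> C) := is_Ck k U (fun x => complex.Re (f x)) /\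
  is_Ck k U (fun x => complex.Im (f x)).

Lemma is_cCkM k f g : is_cCk k f -> is_cCk k g -> is_cCk k (fun x => f x * g x).
Proof.
move=> [f1 f2] [g1 g2]; split.
  have H : is_Ck k U (fun x => -1 * (complex.Im (f x) * complex.Im (g x))).
    by apply: is_CkM => //; [exact: is_Ck_cst|exact: is_CkM].
  apply: (is_Ck_eq oU _ (is_CkD oU (is_CkM oU f1 g1) H)) => x _.
  by rewrite cReM mulN1r.
by apply: (is_Ck_eq oU _ (is_CkD oU (is_CkM oU f1 g2) (is_CkM oU f2 g1))) => x _;
  rewrite cImM.
Qed.

Lemma is_cCkD k f g : is_cCk k f -> is_cCk k g -> is_cCk k (fun x => f x + g x).
Proof.
move=> [f1 f2] [g1 g2]; split.
  by apply: (is_Ck_eq oU _ (is_CkD oU f1 g1)) => x _; rewrite cReD.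
by apply: (is_Ck_eq oU _ (is_CkD oU f2 g2)) => x _; rewrite cImD.
Qed.

(** If the row is of class C^k then so is its derivative, by the equation, and
    the row is of class C^(k+1). *)
Lemma linear_system_smooth (r : 'I_2 -> V -> C) (th : V -> 'I_2 -> 'I_2 -> V -> C) :
  (forall v i k, csmooth U (th v i k)) ->
  (forall k z, U z -> {for z, continuous (fun y => complex.Re (r k y))} /\
     {for z, continuous (fun y => complex.Im (r k y))}) ->
  (forall k z v, U z ->
    is_cderive z v (r k) (r 0 z * th v 0 k z + r 1 z * th v 1 k z)) ->
  forall k, csmooth U (r k).
Proof.
move=> ths rc rD; suff H : forall m k, is_cCk m (r k).
  by move=> k; split=> m; have [] := H m k.
elim=> [|m IH] k.
  by split; split=> // z /set_mem Uz; have [] := rc k z Uz.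
have dm v : is_cCk m (fun z => r 0 z * th v 0 k z + r 1 z * th v 1 k z).
  have tm i : is_cCk m (th v i k) by have [t1 t2] := ths v i k; split.
  by apply: is_cCkD; apply: is_cCkM.
split.
  apply: (is_CkS oU (df := fun v z =>
    complex.Re (r 0 z * th v 0 k z + r 1 z * th v 1 k z))) => [z Uz|v z Uz|v].
  - by have [] := rc k z Uz.
  - by have [] := rD k z v Uz.
  - by have [] := dm v.
apply: (is_CkS oU (df := fun v z =>
  complex.Im (r 0 z * th v 0 k z + r 1 z * th v 1 k z))) => [z Uz|v z Uz|v].
- by have [] := rc k z Uz.
- by have [] := rD k z v Uz.
- by have [] := dm v.
Qed.

End LinearSystemSmooth.

Section UnitaryRow.
Variable R : realType.
Local Notation C := R[i].
Variables (U : set (plane R)) (z0 : plane R).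
Hypotheses (oU : open U) (cU : connected U) (Uz0 : U z0).
Variables (r : 'I_2 -> plane R -> C) (T : plane R -> mform R).
Hypothesis Ts1 : mxsmooth U (fun z => (T z).1).
Hypothesis Ts2 : mxsmooth U (fun z => (T z).2).

Definition row_form (v : plane R) (i k : 'I_2) (z : plane R) : C :=
  ev (T z) v (lshift 1 i) (lshift 1 k).

Hypothesis rD : forall k z v, U z -> is_cderive z v (r k)
  (r 0 z * row_form v 0 k z + r 1 z * row_form v 1 k z).
Hypothesis r_bounded : forall z1, U z1 -> exists M : R, \forall z \near z1,
  forall k, cnorm1 (r k z) <= M.
Hypotheses (r0E : r 0 z0 = 1) (r1E : r 1 z0 = 0).

Lemma row_form_bound z1 : U z1 -> exists K : R, \forall z \near z1,
  forall v i k, cnorm1 (row_form v i k z) <= K * `|v|.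
Proof.
move=> Uz1; pose b z := mnorm1 (T z).1 + mnorm1 (T z).2.
have bc : continuous_at z1 b.
  by apply: cvgD; [exact: mnorm1_continuous Ts1 Uz1|exact: mnorm1_continuous Ts2 Uz1].
exists (b z1 + 1); have /cvgrPdist_lt /(_ 1 ltr01) := bc; apply: filterS => z.
rewrite distrC => /ltW; rewrite ler_distl => /andP[_ bz] v i k.
apply: le_trans (cnorm1_le_mnorm1 _ _ _) _; apply: le_trans (mnorm1_ev _ _) _.
by rewrite ler_wpM2r.
Qed.

Lemma row_derive_bound (K M : R) z v k :
  (forall i k, cnorm1 (row_form v i k z) <= K * `|v|) ->
  (forall k, cnorm1 (r k z) <= M) ->
  cnorm1 (r 0 z * row_form v 0 k z + r 1 z * row_form v 1 k z) <= 2 * K * M * `|v|.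
Proof.
move=> tK rM; apply: le_trans (cnorm1D _ _) _.
have -> : 2 * K * M * `|v| = M * (K * `|v|) + M * (K * `|v|) by ring.
by apply: lerD; apply: le_trans (cnorm1M _ _) _; apply: ler_pM; rewrite ?cnorm1_ge0.
Qed.

Let part (s : bool) (x : C) : R := if s then complex.Re x else complex.Im x.

Let part_le s x : `|part s x| <= cnorm1 x.
Proof. by case: s; rewrite /part /cnorm1 ?lerDl ?lerDr. Qed.

Let row_part_derive s k z v : U z -> is_derive z v (fun y => part s (r k y))
  (part s (r 0 z * row_form v 0 k z + r 1 z * row_form v 1 k z)).
Proof. by move=> Uz; have [] := rD k v Uz; case: s. Qed.

Lemma row_continuous s k z : U z -> {for z, continuous (fun y => part s (r k y))}.
Proof.
move=> Uz; have [K tK] := row_form_bound Uz; have [M rM] := r_bounded Uz.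
have /nbhs_ballP[e /= e0 eP] : \forall y \near z, [/\ U y,
    forall v i k, cnorm1 (row_form v i k y) <= K * `|v|
    & forall k, cnorm1 (r k y) <= M].
  by near=> y; split; near: y => //; exact: open_nbhs_nbhs.
apply: (@continuous_bounded_derive _ _ _ (fun y v =>
  part s (r 0 y * row_form v 0 k y + r 1 y * row_form v 1 k y)) z e (2 * K * M) e0).
  by move=> y v /eP[Uy _ _]; exact: row_part_derive.
move=> y v /eP[Uy tKy rMy]; apply: le_trans (part_le _ _) _.
by apply: row_derive_bound => // i j; exact: tKy.
Unshelve. all: by end_near. Qed.

(** A solution vanishing at z1 would vanish on all of U, contradicting its value
    at z0. *)
Lemma row_neq0 z1 : U z1 -> ~ (r 0 z1 = 0 /\ r 1 z1 = 0).
Proof.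
move=> Uz1 [r01 r11].
pose f (i : bool * 'I_2) z := part i.1 (r i.2 z).
pose df (i : bool * 'I_2) z v :=
  part i.1 (r 0 z * row_form v 0 i.2 z + r 1 z * row_form v 1 i.2 z).
have fD i w v : U w -> is_derive w v (f i) (df i w v).
  by case: i => s k Uw; exact: row_part_derive.
have loc z : U z -> exists CM M : R, \forall w \near z,
    (forall i, `|f i w| <= M) /\
    forall b : R, (forall j, `|f j w| <= b) -> forall i v, `|df i w v| <= CM * b * `|v|.
  move=> Uz; have [K tK] := row_form_bound Uz; have [M rM] := r_bounded Uz.
  exists (4 * K), M; near=> w.
  have tw : forall v i k, cnorm1 (row_form v i k w) <= K * `|v| by near: w.
  have rw : forall k, cnorm1 (r k w) <= M by near: w.
  split=> [[s k]|b fb [s k] v].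
    by apply: le_trans (part_le _ _) _; exact: rw.
  apply: le_trans (part_le _ _) _.
  have -> : 4 * K * b * `|v| = 2 * K * (b + b) * `|v| by ring.
  apply: row_derive_bound; first exact: tw.
  by move=> j; apply: lerD; [exact: (fb (true, j))|exact: (fb (false, j))].
have f0 i : f i z1 = 0.
  by case: i => s k; rewrite /f /=; have [->|->] := ord2P k; rewrite ?r01 ?r11; case: s.
have := linear_system_unique oU cU Uz1 fD loc f0 (true, 0) Uz0.
by rewrite /f /= r0E => /eqP; rewrite oner_eq0.
Unshelve. all: by end_near. Qed.

Lemma row_smooth k : csmooth U (r k).
Proof.
apply: (linear_system_smooth oU (th := row_form)) => [v i j|j z Uz|j z v Uz].
- apply: (csmooth_eq oU (f := fun z => v.1%:C * (T z).1 (lshift 1 i) (lshift 1 j)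
    + v.2%:C * (T z).2 (lshift 1 i) (lshift 1 j))) => [z _|].
    by rewrite /row_form evE.
  by apply: csmoothD => //; apply: csmoothM => //; exact: csmooth_cst.
- by split; [exact: (row_continuous (s := true))|exact: (row_continuous (s := false))].
- exact: rD.
Qed.

Definition sqnorm (x : C) : R := complex.Re x ^+ 2 + complex.Im x ^+ 2.

Lemma sqnormE x : x * Num.conj x = (sqnorm x)%:C.
Proof.
by apply: ReIm_eq; rewrite ?(cReM, cImM, cReJ, cImJ) /= /sqnorm; ring.
Qed.

Let q z := sqnorm (r 0 z) + sqnorm (r 1 z).

Definition row_scale z : R := (Num.sqrt (q z))^-1.

Lemma sqnorm_ge0 x : 0 <= sqnorm x.
Proof. by rewrite addr_ge0 // sqr_ge0. Qed.

Lemma sqnorm_eq0 x : sqnorm x = 0 -> x = 0.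
Proof.
move=> /eqP; rewrite paddr_eq0 ?sqr_ge0 // !sqrf_eq0 => /andP[/eqP a /eqP b].
exact: ReIm_eq.
Qed.

Let q_gt0 z : U z -> 0 < q z.
Proof.
move=> Uz; have q0 : 0 <= q z by rewrite addr_ge0 // sqnorm_ge0.
rewrite lt0r q0 andbT; apply/eqP => /eqP; rewrite paddr_eq0 ?sqnorm_ge0 //.
by move=> /andP[/eqP /sqnorm_eq0 a /eqP /sqnorm_eq0 b]; exact: (row_neq0 Uz).
Qed.

Let q_smooth : smooth U q.
Proof.
have sm k : smooth U (fun z => sqnorm (r k z)).
  have [sRe sIm] := row_smooth k.
  exact: (smoothD oU (smoothM oU sRe sRe) (smoothM oU sIm sIm)).
exact: (smoothD oU (sm 0) (sm 1)).
Qed.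

Lemma row_scale_smooth : smooth U row_scale.
Proof. by apply: (smooth_rsqrt oU) q_smooth => z; exact: q_gt0. Qed.

Lemma row_scale_gt0 z : U z -> 0 < row_scale z.
Proof. by move=> Uz; rewrite invr_gt0 sqrtr_gt0 q_gt0. Qed.

Definition unit_row k z : C := (row_scale z)%:C * r k z.

Lemma unit_row_smooth k : csmooth U (unit_row k).
Proof.
apply: csmoothM => //; last exact: row_smooth.
by apply: csmooth_real; exact: row_scale_smooth.
Qed.

Lemma unit_row_norm z : U z ->
  unit_row 0 z * Num.conj (unit_row 0 z) + unit_row 1 z * Num.conj (unit_row 1 z) = 1.
Proof.
move=> Uz; rewrite !sqnormE -rmorphD /=.
have E k : sqnorm (unit_row k z) = row_scale z ^+ 2 * sqnorm (r k z).
  by rewrite /sqnorm /unit_row cRe_realM cIm_realM; ring.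
rewrite !E -mulrDr -/(q z) /row_scale exprVn sqr_sqrtr ?ltW ?q_gt0 //.
by rewrite mulVf ?gt_eqF ?q_gt0.
Qed.

(** Scaling the row by a positive function adds the logarithmic derivative of
    this function, which is real. *)
Lemma unit_row_derive k z v : U z ->
  is_cderive z v (unit_row k) (unit_row 0 z * row_form v 0 k z
    + unit_row 1 z * row_form v 1 k z
    + ('D_v row_scale z / row_scale z)%:C * unit_row k z).
Proof.
move=> Uz.
have sD : is_cderive z v (fun y => (row_scale y)%:C) ('D_v row_scale z)%:C.
  split; last exact: is_derive_cst.
  exact: (smooth_derive row_scale_smooth v Uz).
have := is_cderiveM sD (rD k v Uz); congr is_cderive.
have s0 : row_scale z != 0 by rewrite gt_eqF // row_scale_gt0.
have E : ('D_v row_scale z)%:C = ('D_v row_scale z / row_scale z)%:C * (row_scale z)%:C.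
  by rewrite -rmorphM /= divfK.
rewrite /unit_row E; ring.
Qed.

Lemma unit_row_init : unit_row 0 z0 = 1 /\ unit_row 1 z0 = 0.
Proof.
have s1 : row_scale z0 = 1.
  rewrite /row_scale /q r0E r1E /sqnorm /= !expr0n /= expr1n !addr0.
  by rewrite sqrtr1 invr1.
by rewrite /unit_row s1 r0E r1E mulr0 mulr1.
Qed.

End UnitaryRow.

(** * Construction of the gauge *)

Section GaugeMatrix.
Variables (R : realType) (V : normedModType R).
Local Notation C := R[i].

Lemma blkEul (m : 'M[C]_2) d (i j : 'I_2) : blk m d (lshift 1 i) (lshift 1 j) = m i j.
Proof. exact: (@block_mxEul _ 2 1 2 1 m 0 0 d%:M i j). Qed.

Lemma blkEur (m : 'M[C]_2) d (i : 'I_2) (j : 'I_1) : blk m d (lshift 1 i) (rshift 2 j) = 0.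
Proof. by apply: (etrans (@block_mxEur _ 2 1 2 1 m 0 0 d%:M i j)); rewrite mxE. Qed.

Lemma blkEdl (m : 'M[C]_2) d (i : 'I_1) (j : 'I_2) : blk m d (rshift 2 i) (lshift 1 j) = 0.
Proof. by apply: (etrans (@block_mxEdl _ 2 1 2 1 m 0 0 d%:M i j)); rewrite mxE. Qed.

Lemma blkEdr (m : 'M[C]_2) d (i j : 'I_1) : blk m d (rshift 2 i) (rshift 2 j) = d%:M i j.
Proof. exact: (@block_mxEdr _ 2 1 2 1 m 0 0 d%:M i j). Qed.

Lemma is_mxderive_blk (m : V -> 'M[C]_2) (dm : 'M[C]_2) d z v :
  (forall i j, is_cderive z v (fun y => m y i j) (dm i j)) ->
  is_mxderive z v (fun y => blk (m y) d) (blk dm 0).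
Proof.
move=> mD a b; case: (@split_ordP 2 1 a) => i ->; case: (@split_ordP 2 1 b) => j ->.
- have := mD i j; rewrite blkEul; congr is_cderive.
  by apply/funext => y; rewrite blkEul.
- have := is_cderive_cst z v 0; rewrite blkEur; congr is_cderive.
  by apply/funext => y; rewrite blkEur.
- have := is_cderive_cst z v 0; rewrite blkEdl; congr is_cderive.
  by apply/funext => y; rewrite blkEdl.
- have := is_cderive_cst z v (d%:M i j); rewrite blkEdr.
  rewrite (_ : (0%:M : 'M[C]_1) i j = 0); last by rewrite raddf0 mxE.
  by congr is_cderive; apply/funext => y; rewrite blkEdr.
Qed.

Lemma is_cderiveN z v (f : V -> C) df : is_cderive z v f df ->
  is_cderive z v (fun y => - f y) (- df).
Proof.
move=> fD; have := is_cderiveM (is_cderive_cst z v (-1)) fD.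
rewrite mul0r add0r mulN1r; congr is_cderive.
by apply/funext => y; rewrite mulN1r.
Qed.

Lemma gmx_derive (u w : V -> C) du dw z v :
  is_cderive z v u du -> is_cderive z v w dw ->
  is_mxderive z v (fun y => blk (gmx (u y) (w y)) 1) (blk (gmx du dw) 0).
Proof.
move=> uD wD; apply: is_mxderive_blk => i j.
have [->|->] := ord2P i; have [->|->] := ord2P j; rewrite /gmx mx2E.
- have := is_cderive_conj uD; congr is_cderive.
  by apply/funext => y; rewrite mx2E.
- have := is_cderiveN wD; congr is_cderive.
  by apply/funext => y; rewrite mx2E.
- have := is_cderive_conj wD; congr is_cderive.
  by apply/funext => y; rewrite mx2E.
- have := uD; congr is_cderive.
  by apply/funext => y; rewrite mx2E.
Qed.

Lemma gmx_smooth (U : set V) (u w : V -> C) : open U -> csmooth U u -> csmooth U w ->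
  mxsmooth U (fun y => blk (gmx (u y) (w y)) 1).
Proof.
move=> oU us ws; apply: mxsmooth_blk => // i j.
have [->|->] := ord2P i; have [->|->] := ord2P j.
- apply: (csmooth_eq oU _ (csmoothJ oU us)) => y _; by rewrite mx2E.
- apply: (csmooth_eq oU _ (csmoothN oU ws)) => y _; by rewrite mx2E.
- apply: (csmooth_eq oU _ (csmoothJ oU ws)) => y _; by rewrite mx2E.
- apply: (csmooth_eq oU _ us) => y _; by rewrite mx2E.
Qed.

Lemma gmx_in_U3_0 (u w : C) : u * Num.conj u + w * Num.conj w = 1 ->
  in_U3_0 (blk (gmx u w) 1).
Proof.
move=> uw.
have GG : blk (gmx u w) 1 \is unitarymx.
  apply/unitarymxP; rewrite blk_ctrans blkM gmx_unitary_r // mul1r.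
  by rewrite (_ : Num.conj 1 = 1) ?blk1 //; apply: ReIm_eq; rewrite ?cReJ ?cImJ /= ?oppr0.
split => //; rewrite /tau_grp invmx_unitary // blk_ctrans blkT diagJ1E diagNJ1E !blkM.
rewrite gmx_J mul1r mulr1.
by congr blk; apply: ReIm_eq; rewrite ?cReJ ?cImJ /= ?oppr0.
Qed.

Lemma mul_blk_row (M : mat3 R) (t : 'M[C]_2) a (k : 'I_2) :
  (M *m blk t 0) a (lshift 1 k)
  = M a (lshift 1 (0 : 'I_2)) * t 0 k + M a (lshift 1 (1 : 'I_2)) * t 1 k.
Proof.
rewrite mxE (@big_split_ord _ _ _ 2 1) big_ord1 /=.
rewrite [X in _ + X](_ : _ = 0); last by rewrite blkEdl mulr0.
rewrite addr0 sum2E; congr (_ * _ + _ * _); by rewrite blkEul.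
Qed.

End GaugeMatrix.

Section GaugeExistence.
Variable R : realType.
Local Notation C := R[i].
Variables (U : set (plane R)) (z0 : plane R) (F xi : plane R -> loop R).
Hypotheses (oU : open U) (cU : connected U) (Uz0 : U z0).
Hypothesis Fs : smooth_loops U F.
Hypothesis FU : forall z, U z -> LambdaU3 (F z).
Hypothesis F0 : forall l : C, `|l| = 1 -> F z0 l = 1%:M.
Hypothesis xis : smooth_loops U xi.
Let A := maurer_cartan F.
Hypothesis xiD : forall z, U z -> forall l : C, `|l| = 1 ->
  ext_d (fun y => xi y l) z = form_map (lie (xi z l)) (A z l).
Variables (p : nat) (B : plane R -> mform R).
Hypothesis Bs : form_u3_0C U B.
Hypothesis xiL : forall z, U z -> Lambdau3_le (2 + 4 * p) (xi z).
Hypothesis xiA : forall z, U z -> forall l : C, `|l| = 1 ->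
  Lambda_su_dz (fun m => m ^+ (4 * p) *: xi z m) l = A z l + B z.
Let xiu z (Uz : U z) : Lambdau3 (xi z). Proof. by have [] := xiL Uz. Qed.

Lemma Lambda_su2_skew g : in_u3_0C (g 0) ->
  (Lambda_su2 (R := R) g 1) ^t* = - Lambda_su2 g 1.
Proof.
move=> /u3_0CP[m gm m0]; rewrite /Lambda_su2 !exp1rz !scale1r gm su_proj3_blk su_projE //.
have s : (blk (su_part m) 0) ^t* = - blk (su_part m) 0.
  by have [s1 _] := su_part_su2 m; rewrite blk_ctrans s1 cJ0 blkN oppr0.
rewrite ctransD ctransN !ctransD !ctransK s.
move: (g _) (g _) ((g _) ^t*) ((g _) ^t*) (blk _ _) => y d y' d' t.
by rewrite [RHS]opprB [X in _ = _ + X]opprD addrA [LHS]addrAC.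
Qed.

(** B is the difference of two skew-Hermitian forms, namely the projection of
    lambda^(4p) xi dz at lambda = 1 and A. *)
Lemma remainder_su2 z : U z ->
  (exists2 b, (B z).1 = blk b 0 & in_su2 b) /\ (exists2 b, (B z).2 = blk b 0 & in_su2 b).
Proof.
move=> Uz; have [_ _ /(_ z Uz)[b1 b2]] := Bs; have n1 := normr1 C.
have X0 := coef0_u3 xiL Uz.
have skew c (a b : mat3 R) : a = Lambda_su2 (fun k => c *: coef xi p k z) 1 - b ->
    a ^t* = - a -> in_u3_0C b -> exists2 b', b = blk b' 0 & in_su2 b'.
  move=> E a_skew /u3_0CP[b' bE b'0]; exists b' => //; split=> //.
  have b_skew : b ^t* = - b.
    have -> : b = Lambda_su2 (fun k => c *: coef xi p k z) 1 - a.
      by rewrite E opprB addrC subrK.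
    rewrite ctransD ctransN a_skew Lambda_su2_skew; last exact: u3_0CZ.
    by rewrite opprK [RHS]opprB addrC.
  move: b_skew; rewrite bE blk_ctrans blkN; exact: blk_inj.
have dx := frame_skew oU Fs FU ((1, 0) : plane R) Uz n1.
have dy := frame_skew oU Fs FU ((0, 1) : plane R) Uz n1.
rewrite ev_dx in dx; rewrite ev_dy in dy; split.
  exact: (skew 1 _ _ (mc_dx oU xis xiL xiA Uz n1)).
exact: (skew 'i _ _ (mc_dy oU xis xiL xiA Uz n1)).
Qed.

Let H := flow_fourier z0 F xi p 0.
Let T := flow_form_coef xi p B 0.
Let r (k : 'I_2) (z : plane R) : C := H z 0 (lshift 1 k).

Lemma flow_coef_blk c b z m b' : coef xi p 0 z = blk m 0 -> \tr m = 0 -> b z = blk b' 0 ->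
  flow_coef xi p c b 0 z = blk (su_proj (c *: m) - b' - c *: m) 0.
Proof.
move=> mE m0 bE.
have gen (s y d t : mat3 R) : (0%N == 0%N)%:R *: s - (0%N == 1%N)%:R *: y
    - (0%N == 2%N)%:R *: d - t = s - t by rewrite scale1r !scale0r !subr0.
rewrite /flow_coef gen mE bE (blkZ c m 0) mulr0 su_proj3_blk.
by rewrite (blkN b') (blkN (c *: m)) (blkD (su_proj _)) blkD !oppr0 !addr0.
Qed.

Lemma form_blk z v : U z -> exists t, ev (T z) v = blk t 0.
Proof.
move=> Uz; have [m mE m0] := u3_0CP (coef0_u3 xiL Uz).
have [[b1 b1E _] [b2 b2E _]] := remainder_su2 Uz.
rewrite /T /flow_form_coef /ev /=.
rewrite (flow_coef_blk 1 mE m0 b1E) (flow_coef_blk 'i mE m0 b2E) !blkZ blkD !mulr0 addr0.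
by eexists.
Qed.

Let Ts1 : mxsmooth U (fun z => (T z).1).
Proof. by have [b1 _ _] := Bs; exact: (flow_coef_smooth oU xis xiL 1 b1). Qed.

Let Ts2 : mxsmooth U (fun z => (T z).2).
Proof. by have [_ b2 _] := Bs; exact: (flow_coef_smooth oU xis xiL 'i b2). Qed.

Let rD k z v : U z -> is_cderive z v (r k)
  (r 0 z * row_form T v 0 k z + r 1 z * row_form T v 1 k z).
Proof.
move=> Uz.
have := flow_fourier0_derive oU cU Uz0 Fs FU F0 xis xiu xiD Bs xiL xiA v Uz 0 (lshift 1 k).
have [t tE] := form_blk v Uz; rewrite /row_form -/T tE mul_blk_row.
by rewrite !blkEul.
Qed.

Let r_bounded z1 : U z1 -> exists M : R, \forall z \near z1,
  forall k, cnorm1 (r k z) <= M.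
Proof.
move=> Uz1; have [M HM] := flow_fourier_bounded oU Uz0 Fs FU xis xiu p 0 Uz1.
exists M; apply: filterS HM => z zM k; apply: le_trans zM; exact: cnorm1_le_mnorm1.
Qed.

Let r0E : r 0 z0 = 1.
Proof. by rewrite /r /H flow_fourier_init // eqxx scale1r mxE. Qed.

Let r1E : r 1 z0 = 0.
Proof. by rewrite /r /H flow_fourier_init // eqxx scale1r mxE. Qed.

(** The gauge is the adjoint of the element of SU(2) whose first row is the
    normalised first row of H_0; the logarithmic derivative of the normalising
    factor is the real scalar c of [gauge_su_proj]. *)
Lemma exists_gauge : exists (G : plane R -> mat3 R) (g : plane R -> 'M[C]_2),
  [/\ mxsmooth U G, forall z, U z -> G z = blk (g z) 1,
      forall z, U z -> in_U3_0 (G z), G z0 = 1%:M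
    & forall z, U z ->
      su_proj3 ((G z) ^t* *m (1 *: coef xi p 0 z) *m G z) =
        (G z) ^t* *m (su_proj3 (1 *: coef xi p 0 z) - (B z).1) *m G z
        + (G z) ^t* *m mxderive G z (1, 0) /\
      su_proj3 ((G z) ^t* *m ('i *: coef xi p 0 z) *m G z) =
        (G z) ^t* *m (su_proj3 ('i *: coef xi p 0 z) - (B z).2) *m G z
        + (G z) ^t* *m mxderive G z (0, 1)].
Proof.
pose u := unit_row r 0; pose w := unit_row r 1.
pose g z := gmx (u z) (w z); pose G z := blk (g z) 1.
have uw z : U z -> u z * Num.conj (u z) + w z * Num.conj (w z) = 1.
  by move=> Uz; exact: (unit_row_norm oU cU Uz0 Ts1 Ts2 rD r_bounded r0E).
have us : csmooth U u by exact: (unit_row_smooth oU cU Uz0 Ts1 Ts2 rD r_bounded r0E).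
have ws : csmooth U w by exact: (unit_row_smooth oU cU Uz0 Ts1 Ts2 rD r_bounded r0E).
have c1 : Num.conj (1 : C) = 1.
  by apply: ReIm_eq; rewrite ?cReJ ?cImJ /= ?oppr0.
exists G, g; split => //.
- exact: gmx_smooth.
- by move=> z Uz; apply: gmx_in_U3_0; exact: uw.
- have [u1 w0] := unit_row_init r0E r1E.
  rewrite /G /g /u /w u1 w0 -blk1; congr blk.
  by apply: mx2P; rewrite [RHS]mxE /gmx mx2E ?c1 ?cJ0 ?oppr0.
move=> z Uz; have [m mE m0] := u3_0CP (coef0_u3 xiL Uz).
have [[b1 b1E b1s] [b2 b2E b2s]] := remainder_su2 Uz.
have key c b b' v : b z = blk b' 0 -> in_su2 b' ->
    ev (T z) v = flow_coef xi p c b 0 z ->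
    su_proj3 ((G z) ^t* *m (c *: coef xi p 0 z) *m G z) =
        (G z) ^t* *m (su_proj3 (c *: coef xi p 0 z) - b z) *m G z
        + (G z) ^t* *m mxderive G z v.
  move=> bE b's TE.
  have uD := unit_row_derive oU cU Uz0 Ts1 Ts2 rD r_bounded r0E 0 v Uz.
  have wD := unit_row_derive oU cU Uz0 Ts1 Ts2 rD r_bounded r0E 1 v Uz.
  move: uD wD; set c0 := (_ / _)%:C; rewrite -/u -/w; set du := _ + _; set dw := _ + _ => uD wD.
  have cm0 : \tr (c *: m) = 0 by rewrite mxtraceZ m0 mulr0.
  (* The constant coefficient theta, on the block. *)
pose th := su_proj (c *: m) - b' - c *: m.
  have thE i k : row_form T v i k z = th i k.
    by rewrite /row_form TE (flow_coef_blk c mE m0 bE) blkEul.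
  have duE : du = u z * th 0 0 + w z * th 1 0 + c0 * u z by rewrite /du !thE.
  have dwE : dw = u z * th 0 1 + w z * th 1 1 + c0 * w z by rewrite /dw !thE.
  have c0r : Num.conj c0 = c0.
    by rewrite /c0; apply: ReIm_eq; rewrite ?cReJ ?cImJ /= ?oppr0.
  (* The derivative of the constant |u|^2 + |w|^2. *)
  have nD : du * Num.conj (u z) + u z * Num.conj du
      + (dw * Num.conj (w z) + w z * Num.conj dw) = 0.
    have D1 := is_cderiveD (is_cderiveM uD (is_cderive_conj uD))
      (is_cderiveM wD (is_cderive_conj wD)).
    have D2 : is_cderive z v (fun y => u y * Num.conj (u y) + w y * Num.conj (w y)) 0.
      have near1 : \forall y \near z, 1 = u y * Num.conj (u y) + w y * Num.conj (w y).
        by near=> y; rewrite uw //; near: y; exact: open_nbhs_nbhs.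
      have [d1 d2] := is_cderive_cst z v (1 : C); split.
        by apply: near_eq_is_derive d1; apply: filterS near1 => y ->.
      by apply: near_eq_is_derive d2; apply: filterS near1 => y ->.
    have [[_ a1] [_ a2]] := D1; have [[_ e1] [_ e2]] := D2.
    by apply: ReIm_eq; [rewrite -a1 e1|rewrite -a2 e2].
  have := gauge_su_proj (uw z Uz) nD c0r cm0 b's duE dwE; rewrite -/(g z) => E.
  rewrite (is_mxderive_val (gmx_derive uD wD)) /G mE bE !blkZ mulr0 su_proj3_blk.
  rewrite blk_ctrans c1 !blkN blkD !blkM !blkD !mulr0 !mul0r !oppr0 !addr0 ?mulr0 ?mul0r.
  by rewrite su_proj3_blk E.
split.
  exact: (key 1 (fun z => (B z).1) b1 (1, 0) b1E b1s (ev_dx _)).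
exact: (key 'i (fun z => (B z).2) b2 (0, 1) b2E b2s (ev_dy _)).
Unshelve. all: by end_near. Qed.

End GaugeExistence.

(** * Effect of the gauge *)

Section MatrixIdentities.
Variables (R : realType) (n : nat).
Local Notation C := R[i].
Implicit Types M N : 'M[C]_n.

Lemma conj_lie_rearrange (q a b c : 'M[C]_n) : - q + (a - b) + c = a + c - (b + q).
Proof. by apply/matrixP => i j; rewrite !mxE; ring. Qed.

(** The derivative of h x k when dx = [x, m], dk = d and dh = - h d h, as for
    h = k^-1: conjugation by the gauge preserves the Lax equation. *)
Lemma conj_lie (h k m d x : 'M[C]_n) : k *m h = 1%:M ->
  (- (h *m d *m h) *m x + h *m (x *m m - m *m x)) *m k + h *m x *m d
  = (h *m x *m k) *m (h *m m *m k + h *m d) - (h *m m *m k + h *m d) *m (h *m x *m k).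
Proof.
move=> kh.
have K (X Y : 'M[C]_n) : X *m k *m (h *m Y) = X *m Y.
  by rewrite mulmxA -(mulmxA X) kh mulmx1.
have e1 : (h *m x *m k) *m (h *m m *m k) = h *m x *m m *m k.
  by rewrite -[h *m m *m k]mulmxA K mulmxA.
have e2 : (h *m x *m k) *m (h *m d) = h *m x *m d by rewrite K.
have e3 : (h *m m *m k) *m (h *m x *m k) = h *m m *m x *m k.
  by rewrite -[h *m x *m k]mulmxA K mulmxA.
have e4 : (h *m d) *m (h *m x *m k) = h *m d *m h *m x *m k by rewrite !mulmxA.
rewrite (mulmxDr (h *m x *m k)) (mulmxDl (h *m m *m k)) e1 e2 e3 e4.
rewrite mulmxDl !mulNmx mulmxBr mulmxBl !mulmxA.
exact: conj_lie_rearrange.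
Qed.

Lemma conjmxD (h k M N : 'M[C]_n) : h *m (M + N) *m k = h *m M *m k + h *m N *m k.
Proof. by rewrite mulmxDr mulmxDl. Qed.

Lemma conjmxN (h k M : 'M[C]_n) : h *m (- M) *m k = - (h *m M *m k).
Proof. by rewrite mulmxN mulNmx. Qed.

Lemma conjmxZ (h k M : 'M[C]_n) c : h *m (c *: M) *m k = c *: (h *m M *m k).
Proof. by rewrite -scalemxAr -scalemxAl. Qed.

Lemma conj_ctrans (h M : 'M[C]_n) : (h ^t* *m M *m h) ^t* = h ^t* *m M ^t* *m h.
Proof. by rewrite !ctransM ctransK mulmxA. Qed.

(** Stated for an abstract linear map f so that the instance where f is a
    conjugation reduces to linearity. *)
Lemma linear_collect (V : lmodType C) (f : V -> V) (y d s b e y' d' : V)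
    (a1 a2 a3 a4 : C) :
  (forall u v, f (u + v) = f u + f v) -> (forall v, f (- v) = - f v) ->
  (forall a v, f (a *: v) = a *: f v) ->
  a1 *: f y + a2 *: f d + (f (s - b) + e) - (a3 *: f y' + a4 *: f d')
  = f (a1 *: y + a2 *: d + s - (a3 *: y' + a4 *: d') - b) + e.
Proof.
move=> fD fN fZ; rewrite !(fD, fN, fZ) !opprD !addrA.
by rewrite (addrAC _ e) (addrAC _ e) (addrAC _ (- f b)) (addrAC _ (- f b)).
Qed.

(** Conjugation by a unitary h commutes with the projection except in the
    constant term, whose defect is the form e together with b. *)
Lemma conj_collect (h y d s b e : 'M[C]_n) (a1 a2 a3 a4 : C) :
  a1 *: (h ^t* *m y *m h) + a2 *: (h ^t* *m d *m h)
    + (h ^t* *m (s - b) *m h + e)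
    - (a3 *: (h ^t* *m y *m h) ^t* + a4 *: (h ^t* *m d *m h) ^t*)
  = h ^t* *m (a1 *: y + a2 *: d + s - (a3 *: y ^t* + a4 *: d ^t*) - b) *m h + e.
Proof.
rewrite (conj_ctrans h y) (conj_ctrans h d).
apply: (linear_collect (f := fun M => h ^t* *m M *m h)).
- exact: conjmxD.
- exact: conjmxN.
- by move=> c M; exact: conjmxZ.
Qed.

Lemma conj_eq0 (h k M : 'M[C]_n) : k *m h = 1%:M -> h *m M *m k = 0 -> M = 0.
Proof.
move=> kh E; have <- : k *m (h *m M *m k) *m h = M.
  by rewrite !mulmxA kh mul1mx -mulmxA kh mulmx1.
by rewrite E mulmx0 mul0mx.
Qed.

(** The multiplicativity behind the twists of both the group and the Lie
    algebra. *)
Lemma twisted_trans (h k m q r : 'M[C]_n) : q *m r = 1%:M ->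
  r *m (h *m m *m k)^T *m q = (r *m k^T *m q) *m (r *m m^T *m q) *m (r *m h^T *m q).
Proof.
move=> qr; rewrite !trmx_mul !mulmxA.
by rewrite -(mulmxA (r *m k^T) q r) qr mulmx1 -(mulmxA (r *m k^T *m m^T) q r) qr mulmx1.
Qed.

Lemma mulmx_inv_derive (a b h k m d : 'M[C]_n) : b *m a = 1%:M ->
  (h *m b) *m (a *m m *m k + a *m d) = h *m m *m k + h *m d.
Proof.
move=> ba; rewrite mulmxDr -[a *m m *m k]mulmxA.
by rewrite [h *m b *m (a *m d)]mulmxA -(mulmxA h b a) ba mulmx1
  [h *m b *m (a *m _)]mulmxA -(mulmxA h b a) ba mulmx1 mulmxA.
Qed.

End MatrixIdentities.

Section GaugeTransform.
Variable R : realType.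
Local Notation C := R[i].
Variables (U : set (plane R)) (z0 : plane R) (F : plane R -> loop R).
Variables (G : plane R -> mat3 R) (g : plane R -> 'M[C]_2).
Hypothesis oU : open U.
Hypothesis Fs : smooth_loops U F.
Hypothesis FU : forall z, U z -> LambdaU3 (F z).
Hypothesis Gs : mxsmooth U G.
Hypothesis Gblk : forall z, U z -> G z = blk (g z) 1.
Hypothesis GU : forall z, U z -> in_U3_0 (G z).
Let A := maurer_cartan F.
Let AG := gauge_form A G.

Lemma gauge_unitary z : U z -> G z \is unitarymx.
Proof. by move=> Uz; have [] := GU Uz. Qed.

Lemma gauge_inv z : U z -> invmx (G z) = (G z) ^t*.
Proof. by move=> Uz; rewrite invmx_unitary // gauge_unitary. Qed.

Lemma gauge_mulV z : U z -> G z *m (G z) ^t* = 1%:M.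
Proof. by move=> Uz; apply/unitarymxP; exact: gauge_unitary. Qed.

Lemma gauge_mulV' z : U z -> (G z) ^t* *m G z = 1%:M.
Proof. by move=> Uz; apply: mulmx1C; exact: gauge_mulV. Qed.

Lemma gauge_derive z v : U z -> is_mxderive z v G (ev (ext_d G z) v).
Proof. by move=> Uz; exact: (mxsmooth_derive_plane v oU Gs Uz). Qed.

Lemma gauge_derive_adj z v : U z ->
  (ev (ext_d G z) v) ^t* = - ((G z) ^t* *m ev (ext_d G z) v *m (G z) ^t*).
Proof.
move=> Uz; have GD := gauge_derive v Uz.
have := is_mxderiveM (is_mxderive_ctrans GD) GD.
have H : is_mxderive z v (fun y => (G y) ^t* *m G y) 0.
  by apply: (mx_cst_derive oU (c := 1%:M) v Uz) => y Uy; exact: gauge_mulV'.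
move/(is_mxderive_unique H)/esym => E.
have := congr1 (mulmx^~ ((G z) ^t*)) E.
rewrite mul0mx mulmxDl -[_ ^t* *m G z *m _]mulmxA (gauge_mulV Uz) mulmx1 => /eqP.
by rewrite addr_eq0 => /eqP.
Qed.

Definition gauge_ev z l v : mat3 R :=
  (G z) ^t* *m ev (A z l) v *m G z + (G z) ^t* *m ev (ext_d G z) v.

Lemma ev_conj (h k : mat3 R) (w : mform R) v :
  ev (form_map (fun M => h *m M *m k) w) v = h *m ev w v *m k.
Proof. by rewrite ev_mull ev_mulr. Qed.

Lemma gauge_form_ev z l v : U z -> ev (AG z l) v = gauge_ev z l v.
Proof.
move=> Uz; rewrite /AG /gauge_form (gauge_inv Uz) evD ev_conj
  -(ev_mull ((G z) ^t*) (ext_d G z) v).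
exact: erefl.
Qed.

Lemma form_ext (w w' : mform R) :
  (forall v : plane R, ev w v = ev w' v) -> w = w'.
Proof.
move=> E; have e1 := E (1, 0); have e2 := E (0, 1).
rewrite !ev_dx in e1; rewrite !ev_dy in e2.
by rewrite [w]surjective_pairing [w']surjective_pairing e1 e2.
Qed.

Lemma maurer_cartan_gauge z l : U z -> `|l| = 1 ->
  maurer_cartan (gauge F G) z l = AG z l.
Proof.
move=> Uz l1; apply: form_ext => v; rewrite gauge_form_ev //.
have FD := frame_derive oU Fs FU v Uz l1.
have D := is_mxderiveM FD (gauge_derive v Uz).
have FGs : mxsmooth U (fun y => gauge F G y l).
  by apply: mxsmooth_mul => //; exact: smooth_loops_slice.
rewrite /maurer_cartan -ev_mull.
rewrite (is_mxderive_unique (mxsmooth_derive_plane v oU FGs Uz) D).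
have Fun := unitarymx_unit (frame_unitary FU Uz l1).
have Gun := unitarymx_unit (gauge_unitary Uz).
rewrite /gauge (invmx_mul Fun Gun) (gauge_inv Uz) (mulmx_inv_derive _ _ _ _ (mulVmx Fun)).
exact: erefl.
Qed.

Lemma gauge_twisted z l : U z -> `|l| = 1 ->
  in_U3 (gauge F G z l) /\ tau_grp (gauge F G z l) = gauge F G z ('i * l).
Proof.
move=> Uz l1; have Fu := frame_unitary FU Uz l1; have Gu := gauge_unitary Uz.
have [_ tF] := FU Uz l1; have [_ tG] := GU Uz.
split; first exact: (mul_unitarymx Fu Gu).
by rewrite /gauge (tau_grpM (unitarymx_unit Fu) (unitarymx_unit Gu)) tF tG.
Qed.

Lemma smooth_loops_gauge : smooth_loops U (gauge F G).
Proof.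
apply: mxsmooth_mul; first exact: open_cylinder.
  exact: Fs.
exact: smooth_loops_pull.
Qed.

(** diag(a, a, 0) is scalar on the block in which G varies. *)
Lemma gauge_conj_diag110 z a : U z -> (G z) ^t* *m diag110 a *m G z = diag110 a.
Proof.
move=> Uz; have := gauge_mulV' Uz; rewrite Gblk // diag110E !blk_ctrans !blkM -blk1.
move/blk_inj => gg; rewrite !mulr0 !mul0r; congr blk.
by rewrite mul_mx_scalar -scalemxAl gg scalemx1.
Qed.

(** The gauge does not depend on lambda, so its logarithmic derivative d only
    affects the constant coefficient. *)
Lemma gauge_fourier z (a : C -> mat3 R) (d : mat3 R) k : U z -> ctsloop a ->
  k != 0 -> fourier (fun l => (G z) ^t* *m a l *m G z + d) k
    = (G z) ^t* *m fourier a k *m G z.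
Proof.
move=> Uz ac k0.
have c1 : ctsloop (fun l => (G z) ^t* *m a l).
  by apply: ctsloopM => //; exact: ctsloop_cst.
have c2 : ctsloop (fun l => (G z) ^t* *m a l *m G z).
  by apply: ctsloopM => //; exact: ctsloop_cst.
rewrite fourierD //; last exact: ctsloop_cst.
by rewrite fourierMr // fourierMl // fourier_cst (negbTE k0) scale0r addr0.
Qed.

Hypothesis Ac1 : forall z, U z -> ctsloop (fun l => (A z l).1).
Hypothesis Ac2 : forall z, U z -> ctsloop (fun l => (A z l).2).

Lemma fourierf_gauge z k : U z -> k != 0 ->
  fourierf (maurer_cartan (gauge F G) z) k
  = form_map (fun M => (G z) ^t* *m M *m G z) (fourierf (A z) k).
Proof.
move=> Uz k0.
have e1 : fourier (fun l => (maurer_cartan (gauge F G) z l).1) k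
    = (G z) ^t* *m fourier (fun l => (A z l).1) k *m G z.
  rewrite -(gauge_fourier ((G z) ^t* *m mxderive G z (1, 0)) Uz (Ac1 Uz) k0).
  apply: eq_fourier => l l1; rewrite (maurer_cartan_gauge Uz l1) -ev_dx.
  by rewrite (gauge_form_ev _ _ Uz) /gauge_ev !ev_dx.
have e2 : fourier (fun l => (maurer_cartan (gauge F G) z l).2) k
    = (G z) ^t* *m fourier (fun l => (A z l).2) k *m G z.
  rewrite -(gauge_fourier ((G z) ^t* *m mxderive G z (0, 1)) Uz (Ac2 Uz) k0).
  apply: eq_fourier => l l1; rewrite (maurer_cartan_gauge Uz l1) -ev_dy.
  by rewrite (gauge_form_ev _ _ Uz) /gauge_ev !ev_dy.
exact: (congr2 pair e1 e2).
Qed.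

Lemma contr_conj (e : C) (h k : mat3 R) (w : mform R) :
  2^-1 *: ((form_map (fun M => h *m M *m k) w).1
    + e *: (form_map (fun M => h *m M *m k) w).2)
  = h *m (2^-1 *: (w.1 + e *: w.2)) *m k.
Proof. by rewrite conjmxZ conjmxD conjmxZ. Qed.

Lemma fdz_conj (h k M : mat3 R) :
  form_map (fun M => h *m M *m k) (fdz M) = fdz (h *m M *m k).
Proof.
rewrite /fdz -(conjmxZ h k M 'i).
exact: erefl.
Qed.

(** The requirements on A concern its coefficients of negative index, which are
    conjugated by G ([fourierf_gauge]). *)
Lemma HSL_family_gauge : G z0 = 1%:M -> HSL_family U z0 F ->
  HSL_family U z0 (gauge F G).
Proof.
move=> G0 [_ _ F0 [A3 [alpha [alphas A2]] A1 A1']]; split.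
- exact: smooth_loops_gauge.
- by move=> z Uz l l1; exact: gauge_twisted.
- by move=> l l1; rewrite /gauge F0 // G0 mul1mx.
have n1 : - (1 : int) != 0 by [].
have n2 : - (2 : int) != 0 by [].
split.
- move=> z Uz k k3; have k0 : k != 0 by apply/eqP; lia.
  rewrite (fourierf_gauge Uz k0) (A3 z Uz k k3) /form_map.
  by rewrite [(0 : mform R).1]/(0 : mat3 R) [(0 : mform R).2]/(0 : mat3 R) mulmx0 mul0mx.
- exists alpha; split=> [//|z Uz].
  by rewrite (fourierf_gauge Uz n2) (A2 z Uz) fdz_conj conjmxZ (gauge_conj_diag110 _ Uz).
- move=> z Uz; rewrite (fourierf_gauge Uz n1) /contr_dzbar contr_conj.
  have := A1 z Uz; rewrite /contr_dzbar => ->.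
  by rewrite mulmx0 mul0mx.
- move=> z Uz; rewrite (fourierf_gauge Uz n1) /contr_dz -scaleNr contr_conj scaleNr.
  apply: contra (A1' z Uz) => /eqP E; apply/eqP.
  rewrite /contr_dz; move: E; move: (2^-1 *: _) => M E.
  exact: (conj_eq0 (gauge_mulV Uz) E).
Qed.

Variables (xi : plane R -> loop R) (p : nat) (a : C) (B : plane R -> mform R).
Hypothesis xis : smooth_loops U xi.
Hypothesis xiD : forall z, U z -> forall l : C, `|l| = 1 ->
  ext_d (fun y => xi y l) z = form_map (lie (xi z l)) (A z l).
Hypothesis xiL : forall z, U z -> Lambdau3_le (2 + 4 * p) (xi z).
Hypothesis xiA : forall z, U z -> forall l : C, `|l| = 1 ->
  Lambda_su_dz (fun m => m ^+ (4 * p) *: xi z m) l = A z l + B z.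
Let xiG := gauge_loops xi G.

Lemma gauge_loopsE z l : U z -> xiG z l = (G z) ^t* *m xi z l *m G z.
Proof. by move=> Uz; rewrite /xiG /gauge_loops gauge_inv. Qed.

Lemma smooth_loops_conj : smooth_loops U xiG.
Proof.
have oC := open_cylinder oU; have Gp := smooth_loops_pull oU Gs.
have H := mxsmooth_mul oC (mxsmooth_mul oC (mxsmooth_ctrans oC Gp) xis) Gp.
apply: mxsmooth_eq H => [//|q Uq].
exact: (esym (gauge_loopsE _ Uq)).
Qed.

Lemma fourier_conj z k : U z -> fourier (xiG z) k = (G z) ^t* *m fourier (xi z) k *m G z.
Proof.
move=> Uz; have xc := smooth_loops_cts oU xis Uz.
have c1 : ctsloop (fun l => (G z) ^t* *m xi z l).
  by apply: ctsloopM => //; exact: ctsloop_cst.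
rewrite -(fourierMl _ _ xc) -(fourierMr _ _ c1); apply: eq_fourier => l _.
exact: gauge_loopsE.
Qed.

(** G is fixed by the automorphism tau of the group. *)
Lemma tau_alg_conj z M : U z ->
  tau_alg ((G z) ^t* *m M *m G z) = (G z) ^t* *m tau_alg M *m G z.
Proof.
move=> Uz; have [_ tG] := GU Uz; rewrite /tau_grp (gauge_inv Uz) in tG.
have tG' : diagNJ1 R *m (G z)^T *m diagJ1 R = (G z) ^t*.
  have H := twisted_trans (1%:M : mat3 R) (G z) ((G z) ^t*) (diagQP R).
  rewrite mul1mx (gauge_mulV' Uz) trmx1 mulmx1 diagPQ tG mulmx1 in H.
  have := congr1 (mulmx^~ ((G z) ^t*)) H.
  by rewrite mul1mx -[_ *m G z *m _]mulmxA (gauge_mulV Uz) mulmx1 => <-.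
have H := twisted_trans ((G z) ^t*) (G z) M (diagQP R).
rewrite tG tG' in H.
rewrite /tau_alg H.
exact: (esym (conjmxN _ _ _)).
Qed.

Lemma Lambdau3_le_conj z : U z -> Lambdau3_le (2 + 4 * p) (xiG z).
Proof.
move=> Uz; have [xt xL] := xiL Uz; split=> [l l1|l l1].
  have [x1 x2] := xt l l1; rewrite !gauge_loopsE //; split.
    by rewrite /in_u3 !ctransM ctransK x1 mulNmx mulmxN mulmxA.
  by rewrite tau_alg_conj // x2.
rewrite gauge_loopsE // {1}xL // mulmx_sumr mulmx_suml; apply: eq_bigr => j _.
by rewrite fourier_conj // -scalemxAr -scalemxAl.
Qed.

Lemma fourier_conj_top z : U z -> fourier (xi z) (- (4 * p + 2)%N%:Z) = diag110 ('i * a) ->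
  fourier (xiG z) (- (4 * p + 2)%N%:Z) = diag110 ('i * a).
Proof. by move=> Uz E; rewrite fourier_conj // E gauge_conj_diag110. Qed.

Lemma conj_derive z l : U z -> `|l| = 1 ->
  ext_d (fun y => xiG y l) z = form_map (lie (xiG z l)) (AG z l).
Proof.
move=> Uz l1; apply: form_ext => v.
have XGs : mxsmooth U (fun y => xiG y l) by apply: smooth_loops_slice smooth_loops_conj l1.
have GD := gauge_derive v Uz.
have XD := potential_derive oU xis xiD v Uz l1.
have D := is_mxderiveM (is_mxderiveM (is_mxderive_ctrans GD) XD) GD.
have nE : \forall y \near z, (G y) ^t* *m xi y l *m G y = xiG y l.
  by near=> y; rewrite gauge_loopsE //; near: y; exact: open_nbhs_nbhs.
have D' := is_mxderive_near nE D.
rewrite (is_mxderive_unique (mxsmooth_derive_plane v oU XGs Uz) D').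
have -> : ev (form_map (lie (xiG z l)) (AG z l)) v = lie (xiG z l) (ev (AG z l) v).
  by rewrite /lie ev_mull ev_mulr -evN -evD.
rewrite (gauge_form_ev _ _ Uz) (gauge_loopsE _ Uz) (gauge_derive_adj v Uz).
exact: (conj_lie _ _ _ (gauge_mulV Uz)).
Unshelve. all: by end_near. Qed.

(** The hypothesis says that in degree zero the projection of the conjugated
    coefficient is the gauged one with b removed; in the other degrees
    conjugation by G and the projection commute. *)
Lemma Lambda_su_conj z c l (b dg : mat3 R) : U z ->
  su_proj3 ((G z) ^t* *m (c *: coef xi p 0 z) *m G z)
    = (G z) ^t* *m (su_proj3 (c *: coef xi p 0 z) - b) *m G z + dg ->
  Lambda_su (fun m => c *: (m ^+ (4 * p) *: xiG z m)) l
    = (G z) ^t* *m (Lambda_su2 (fun k => c *: coef xi p k z) l - b) *m G z + dg.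
Proof.
move=> Uz E.
have XGL z' (Uz' : U z') := Lambdau3_le_conj Uz'.
rewrite (Lambda_su_potential oU smooth_loops_conj XGL c l Uz) /Lambda_su2.
have cE k : c *: coef xiG p k z = (G z) ^t* *m (c *: coef xi p k z) *m G z.
  by rewrite /coef (fourier_conj _ Uz) conjmxZ.
rewrite (cE (- 1%:Z)) (cE (- 2%:Z)) (cE 0) E; exact: conj_collect.
Qed.

Hypothesis Gsu : forall z, U z ->
  su_proj3 ((G z) ^t* *m (1 *: coef xi p 0 z) *m G z) =
    (G z) ^t* *m (su_proj3 (1 *: coef xi p 0 z) - (B z).1) *m G z
    + (G z) ^t* *m mxderive G z (1, 0) /\
  su_proj3 ((G z) ^t* *m ('i *: coef xi p 0 z) *m G z) =
    (G z) ^t* *m (su_proj3 ('i *: coef xi p 0 z) - (B z).2) *m G z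
    + (G z) ^t* *m mxderive G z (0, 1).

Lemma gauge_form_dx z l : U z ->
  (AG z l).1 = (G z) ^t* *m (A z l).1 *m G z + (G z) ^t* *m mxderive G z (1, 0).
Proof.
move=> Uz; have := gauge_form_ev l (1, 0) Uz.
by rewrite /gauge_ev (ev_dx (AG z l)) (ev_dx (A z l)) (ev_dx (ext_d G z)).
Qed.

Lemma gauge_form_dy z l : U z ->
  (AG z l).2 = (G z) ^t* *m (A z l).2 *m G z + (G z) ^t* *m mxderive G z (0, 1).
Proof.
move=> Uz; have := gauge_form_ev l (0, 1) Uz.
by rewrite /gauge_ev (ev_dy (AG z l)) (ev_dy (A z l)) (ev_dy (ext_d G z)).
Qed.

Lemma Lambda_su_dz_conj z l : U z -> `|l| = 1 ->
  Lambda_su_dz (fun m => m ^+ (4 * p) *: xiG z m) l = AG z l.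
Proof.
move=> Uz l1; have [g1 g2] := Gsu Uz.
have e1 : Lambda_su (fun m => m ^+ (4 * p) *: xiG z m) l = (AG z l).1.
  have -> : (fun m => m ^+ (4 * p) *: xiG z m) = (fun m => 1 *: (m ^+ (4 * p) *: xiG z m)).
    by apply/funext => m; rewrite scale1r.
  have E : (A z l).1 = Lambda_su2 (fun k => 1 *: coef xi p k z) l - (B z).1.
    exact: (mc_dx oU xis xiL xiA Uz l1).
  rewrite (gauge_form_dx l Uz) E.
  exact: (Lambda_su_conj l Uz g1).
have e2 : Lambda_su (fun m => 'i *: (m ^+ (4 * p) *: xiG z m)) l = (AG z l).2.
  have E : (A z l).2 = Lambda_su2 (fun k => 'i *: coef xi p k z) l - (B z).2.
    exact: (mc_dy oU xis xiL xiA Uz l1).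
  rewrite (gauge_form_dy l Uz) E.
  exact: (Lambda_su_conj l Uz g2).
by rewrite /Lambda_su_dz e1 e2 -surjective_pairing.
Qed.

Lemma finite_with_gauge :
  (forall z, U z -> fourier (xi z) (- (4 * p + 2)%N%:Z) = diag110 ('i * a)) ->
  finite_with U (gauge F G) p xiG.
Proof.
move=> top; exists a; split.
- exact: smooth_loops_conj.
- exact: Lambdau3_le_conj.
- by move=> z Uz; apply: fourier_conj_top => //; exact: top.
- by move=> z Uz l l1; rewrite maurer_cartan_gauge //; exact: conj_derive.
- by move=> z Uz l l1; rewrite maurer_cartan_gauge // addr0; exact: Lambda_su_dz_conj.
Qed.

End GaugeTransform.

Lemma ctsloop_Lambda_su2 (R : realType) (g : int -> mat3 R) :
  ctsloop (fun l => Lambda_su2 g l).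
Proof.
have H1 := ctsloopD (ctsloopD (ctsloop_monomial (g (- 1%:Z)) (- 1%:Z))
  (ctsloop_monomial (g (- 2%:Z)) (- 2%:Z))) (ctsloop_cst (su_proj3 (g 0))).
have H2 := ctsloopD (ctsloop_monomial (- (g (- 1%:Z)) ^t*) 1%:Z)
  (ctsloop_monomial (- (g (- 2%:Z)) ^t*) 2%:Z).
apply: eq_ctsloop (ctsloopD H1 H2) => l _.
by rewrite /Lambda_su2 !scalerN opprD.
Qed.

Lemma lie_cancel (R : realType) (w : mform R) (x : mat3 R) :
  form_map (lie x) w + form_map (fun M => lie M x) w = 0.
Proof. by rewrite /form_map /lie; congr pair; rewrite /= addrA subrK subrr. Qed.

Local Close Scope sesquilinear_scope.

Theorem theorem3p5 (R : realType) (Omega : set (plane R)) (z0 : plane R)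
    (F : plane R -> loop R) (p : nat) (xi : plane R -> loop R) :
  simply_connected_domain Omega -> Omega z0 ->
  HSL_family Omega z0 F ->
  quasi_finite_with Omega F p xi ->
  exists G : plane R -> mat3 R,
    let A := maurer_cartan F in
    let AG := gauge_form A G in
    let xiG := gauge_loops xi G in
    [/\ mxsmooth Omega G,
        forall z, Omega z -> in_U3_0 (G z),
        finite_type Omega z0 (gauge F G),
        finite_with Omega (gauge F G) p xiG
      & forall z, Omega z -> forall l : R[i], `|l| = 1 ->
          [/\ cov_d AG xiG z l
                = form_map (fun M => invmx (G z) *m M *m G z) (cov_d A xi z l),
              form_map (fun M => invmx (G z) *m M *m G z) (cov_d A xi z l) = 0
            & Lambda_su_dz (fun m => m ^+ (4 * p) *: xiG z m) l = AG z l]].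
Proof.
move=> [oU _ cU _] Uz0 HF [a [B [Bs [xis xiL top xiD xiA]]]].
have [Fs FU F0 _] := HF.
have [G [g [Gs Gblk GU G0 Gsu]]] :=
  exists_gauge oU cU Uz0 Fs FU F0 xis xiD Bs xiL xiA.
have Ac1 z : Omega z -> ctsloop (fun l => (maurer_cartan F z l).1).
  move=> Uz; have H := ctsloopD (ctsloop_Lambda_su2 (fun k => 1 *: coef xi p k z))
    (ctsloop_cst (- (B z).1)).
  apply: eq_ctsloop H => l l1.
  by rewrite (mc_dx oU xis xiL xiA Uz l1).
have Ac2 z : Omega z -> ctsloop (fun l => (maurer_cartan F z l).2).
  move=> Uz; have H := ctsloopD (ctsloop_Lambda_su2 (fun k => 'i *: coef xi p k z))
    (ctsloop_cst (- (B z).2)).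
  apply: eq_ctsloop H => l l1.
  by rewrite (mc_dy oU xis xiL xiA Uz l1).
have fin : finite_with Omega (gauge F G) p (gauge_loops xi G).
  exact: (finite_with_gauge oU Fs FU Gs Gblk GU xis xiD xiL xiA Gsu top).
exists G => A AG xiG; split.
- exact: Gs.
- exact: GU.
- split; last by exists p, xiG; exact: fin.
  exact: (HSL_family_gauge oU Fs FU Gs Gblk GU Ac1 Ac2 G0 HF).
- exact: fin.
- move=> z Uz l l1.
  have d0 : cov_d A xi z l = 0 by rewrite /cov_d (xiD z Uz l l1) lie_cancel.
  have dG0 : cov_d AG xiG z l = 0.
    by rewrite /cov_d (conj_derive oU Gs GU xis xiD Uz l1) lie_cancel.
  have f0 : form_map (fun M => invmx (G z) *m M *m G z) 0 = 0.
    by rewrite /form_map mulmx0 mul0mx.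
  split; [by rewrite dG0 d0 f0|by rewrite d0 f0|].
  exact: (Lambda_su_dz_conj oU Gs GU xis xiL xiA Gsu Uz l1).
Qed.
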